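(* There are absolute constants $c>6$ (used in the definition of $\ell_s$) and $c_0>0$ such that the following holds. Let $K\subseteq\mathbb R^p$ be a centrally symmetric, sign-invariant and permutation-invariant convex body. Let $Y=X\beta+\xi$, where the rows of $X\in\mathbb R^{N\times p}$ are independent, mean-zero, $L$-sub-Gaussian with covariance $\Sigma$ satisfying $\lambda_-I_p\preceq\Sigma\preceq\lambda_+I_p$ ($0<\lambda_-\le\lambda_+<\infty$), and $\xi=(\xi_1,\dots,\xi_N)$ is independent of $X$ with i.i.d. mean-zero entries satisfying $\|\xi_i\|_{\psi_2}\le\sigma$, $\sigma>0$. Let $$(\widehat s,\widehat\beta)\in\operatorname*{argmin}_{1\le r\le p,\ \nu\in K^{(r)}}\left\{\frac1N\|Y-X\nu\|_2^2+\lambda\operatorname{pen}(r)\right\},$$ where $\lambda$ is a constant with $\lambda\ge\lambda_0$, for a suitable $\lambda_0$ depending only on $L,\lambda_-,\lambda_+$. Let $a,b>0$ be constants, let $1\le s\le c_0p$, and suppose that $$N\ \ge\ a\left[\left(\frac{\sigma s\log(ep/s)}{w(K^{(s)})}\right)^2\vee\frac{w(K^{(s)})^2\,\ell_s}{\sigma^2}\vee\ell_s\right],\qquad N\le b\,p .$$ Then, if it is known that $\beta\in K^{(s)}$, $\widehat\beta$ is minimax optimal over $K^{(s)}$ up to the logarithmic factor $\log^2(ep)\sqrt{\ell_s}$; that is, $$\sup_{\beta\in K^{(s)},\,P_\xi}\mathbb E\|\widehat\beta-\beta\|_2^2\ \le\ C\,\log^2(ep)\sqrt{\ell_s}\ \inf_{\widetilde\beta}\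 \sup_{\beta\in K^{(s)},\,P_\xi}\mathbb E\|\widetilde\beta-\beta\|_2^2,$$ where the infimum is over all estimators $\widetilde\beta=\widetilde\beta(X,Y)$, the suprema over $P_\xi$ range over all laws of the noise vector $\xi=(\xi_1,\dots,\xi_N)$ such that $\xi$ is independent of $X$ and $\xi_1,\dots,\xi_N$ are i.i.d., mean-zero and satisfy $\|\xi_i\|_{\psi_2}\le\sigma$ with the given $\sigma$, and $C$ depends only on $a,b,\lambda,L,\lambda_-,\lambda_+$.
   Context: A convex body is a compact convex set with nonempty interior. $K$ is sign-invariant and permutation-invariant if $(\varepsilon_1x_{\pi(1)},\dots,\varepsilon_px_{\pi(p)})\in K$ for all $x\in K$, all signs $\varepsilon_j\in\{-1,1\}$ and all permutations $\pi$ of $\{1,\dots,p\}$. For $1\le s\le p$, $K^{(s)}=\operatorname{conv}\{v\in K:\|v\|_0\le s\}$, where $\|v\|_0$ is the number of nonzero entries of $v$. The Gaussian width of $T\subseteq\mathbb R^p$ is $w(T)=\mathbb E\sup_{v\in T}\langle g,v\rangle$ with $g\sim N(0,I_p)$. Put $w_s=w(K^{(s)})$, $\ell_s=c\log(e+s)$, and $$\operatorname{pen}(s)=\sigma\left(\frac{w_s\sqrt{\ell_s}}{\sqrt N}+\frac{w_s\ell_s}{N}\right)+\frac{w_s^2\ell_s}{N}.$$ For a real random variable $Z$, $\|Z\|_{\psi_2}=\inf\{a>0:\mathbb E\exp(Z^2/a^2)\le e\}$. A mean-zero random vector $X_i$ in $\mathbb R^p$ is $L$-sub-Gaussian if $\mathbb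 E\exp(\delta\langle v,X_i\rangle)\le\exp(\delta^2L^2/2)$ for all $\delta\in\mathbb R$ and all unit vectors $v\in\mathbb R^p$. Notation: $x\vee y=\max(x,y)$. *)

(* Defs.v *)
From HB Require Import structures.
From mathcomp Require Import all_boot all_order all_algebra all_fingroup.
From mathcomp Require Import all_classical all_reals all_analysis.

Set Implicit Arguments.
Unset Strict Implicit.
Unset Printing Implicit Defensive.

Import Order.TTheory GRing.Theory Num.Theory.
Import numFieldNormedType.Exports.

Local Open Scope classical_set_scope.
Local Open Scope ring_scope.

(* Real matrices carry the product sigma-algebra of their entries, which is
   the Borel sigma-algebra; vectors of R^p are columns 'cV[R]_p. *)
Definition measure_matrix_display : measure_display.
Proof. exact: default_measure_display. Qed.

Section measurable_matrix.
Variables (R : realType) (m n : nat).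

Definition mx_cylinders : set (set 'M[R]_(m, n)) :=
  [set B | exists i j, preimage_set_system setT
    (fun M : 'M[R]_(m, n) => M i j) measurable B].

Let mx_set0 : <<s mx_cylinders >> set0.
Proof. exact: sigma_algebra0. Qed.

Let mx_setC A : <<s mx_cylinders >> A -> <<s mx_cylinders >> (~` A).
Proof. by move=> sA; rewrite -setTD; exact: sigma_algebraCD. Qed.

Let mx_bigcup (F : (set 'M[R]_(m, n))^nat) :
  (forall i, <<s mx_cylinders >> (F i)) ->
  <<s mx_cylinders >> (\bigcup_i (F i)).
Proof. exact: sigma_algebra_bigcup. Qed.

HB.instance Definition _ := @isMeasurable.Build measure_matrix_display
  'M[R]_(m, n) <<s mx_cylinders >> mx_set0 mx_setC mx_bigcup.

End measurable_matrix.

Lemma measurable_mx_entry (R : realType) m n (i : 'I_m) (j : 'I_n) :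
  measurable_fun [set: 'M[R]_(m, n)] (fun M => M i j).
Proof.
by move=> _ Y mY; apply: sub_sigma_algebra; exists i, j; exists Y.
Qed.

Lemma measurable_fun_mxP d (T : measurableType d) (R : realType) m n
    (f : T -> 'M[R]_(m, n)) :
  measurable_fun setT f <->
  forall i j, measurable_fun setT (fun t => f t i j).
Proof.
split=> [mf i j|mf].
  exact: (measurableT_comp (measurable_mx_entry i j) mf).
apply: (@measurability _ _ _ _ _ _ (@mx_cylinders R m n)) => //.
move=> _ [_ [i [j [B mB <-]]] <-].
rewrite setTI.
by have := mf i j measurableT B mB; rewrite setTI.
Qed.

Section geometry.
Variables (R : realType) (p : nat).
Implicit Types (K T : set 'cV[R]_p) (u v : 'cV[R]_p).

Definition dotv u v : R := \sum_(j < p) u j 0 * v j 0.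

Definition norm0 v : nat := #|[pred j | v j 0 != 0]|.

Definition convex_body K :=
  [/\ compact K, convex_set (K : set (convex_lmodType 'cV[R]_p))
    & interior K !=set0].

Definition centrally_symmetric K := forall v, K v -> K (- v).

Definition sign_perm_invariant K :=
  forall v (eps : 'I_p -> bool) (pi : 'S_p),
    K v -> K (\col_j ((-1) ^+ eps j * v (pi j) 0)).

Definition conv_hull T : set 'cV[R]_p :=
  smallest (fun A => convex_set (A : set (convex_lmodType 'cV[R]_p))) T.

Definition sparse_hull K (s : nat) : set 'cV[R]_p :=
  conv_hull [set v | K v /\ (norm0 v <= s)%N].

End geometry.

Definition sqnorm2 (R : realType) n (v : 'cV[R]_n) : R := dotv v v.

Section gaussian.
Variable R : realType.

Definition cons_cV n (z : measurableTypeR R * 'cV[R]_n) : 'cV[R]_n.+1 :=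
  col_mx (const_mx z.1 : 'cV[R]_1) z.2.

Lemma measurable_cons_cV n : measurable_fun setT (@cons_cV n).
Proof.
apply/measurable_fun_mxP => i j.
have -> : (fun z => cons_cV z i j) = fun z => match @fintype.split 1 n i with
    | inl _ => z.1 | inr k => z.2 k j end.
  by apply/funext => z; rewrite /cons_cV mxE; case: fintype.split => k //; rewrite mxE.
case: fintype.split => k; first exact: measurable_fst.
exact: (measurableT_comp (measurable_mx_entry k j) measurable_snd).
Qed.

HB.instance Definition _ n :=
  isMeasurableFun.Build _ _ _ _ (@cons_cV n) (@measurable_cons_cV n).

(* N(0, I_n) as the n-fold product of N(0, 1). *)
Fixpoint std_gaussian n : probability 'cV[R]_n R :=
  match n with
  | 0 => dirac (0 : 'cV[R]_0)
  | k.+1 => distribution ((normal_prob 0 1 : probability (measurableTypeR R) R) \x std_gaussian k)%E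
              (@cons_cV k)
  end.

(* The width is finite on bounded nonempty sets; fine turns it into a real. *)
Definition gaussian_width n (T : set 'cV[R]_n) : R :=
  fine (\int[std_gaussian n]_g ereal_sup [set (dotv g v)%:E | v in T]).

End gaussian.

Section random_vectors.
Variables (d : measure_display) (T : measurableType d) (R : realType).
Variable P : probability T R.

Definition mutually_independent d' (U : measurableType d') (I : finType)
    (Z : I -> T -> U) :=
  forall (J : {set I}) (A : I -> set U), (forall i, measurable (A i)) ->
    P (\bigcap_(i in [set` J]) Z i @^-1` A i) =
    (\prod_(i in J) P (Z i @^-1` A i))%E.

Definition identically_distributed d' (U : measurableType d') (I : finType)
    (Z : I -> T -> U) :=
  forall i j A, measurable A -> P (Z i @^-1` A) = P (Z j @^-1` A).

Definition psi2_norm (Z : T -> R) : \bar R :=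
  ereal_inf [set a%:E | a in
    [set a : R | 0 < a /\
      ('E_P[fun w => expR (Z w ^+ 2 / a ^+ 2)] <= (expR 1)%:E)%E]].

Definition sub_gaussian p (L : R) (Z : T -> 'cV[R]_p) :=
  forall (delta : R) v, sqnorm2 v = 1 ->
    ('E_P[fun w => expR (delta * dotv v (Z w))]
      <= (expR (delta ^+ 2 * L ^+ 2 / 2))%:E)%E.

Definition mean_zero p (Z : T -> 'cV[R]_p) :=
  forall j, ('E_P[fun w => Z w j ord0] = 0)%E.

Definition covariance_matrix p (Z : T -> 'cV[R]_p) (Sigma : 'M[R]_p) :=
  forall j k, covariance P (fun w => Z w j 0) (fun w => Z w k 0)
              = (Sigma j k)%:E.

Definition sub_gaussian_design N p (X : T -> 'M[R]_(N, p)) (L : R)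
    (Sigma : 'M[R]_p) :=
  let Xrow i w := (row i (X w))^T in
  mutually_independent Xrow /\
  forall i, [/\ mean_zero (Xrow i), sub_gaussian L (Xrow i)
              & covariance_matrix (Xrow i) Sigma].

End random_vectors.

Definition loewner_le (R : realType) p (A B : 'M[R]_p) :=
  forall v : 'cV[R]_p, 0 <= (v^T *m (B - A) *m v) 0 0.

Definition admissible_noise (R : realType) N (sigma : R)
    (Q : probability 'cV[R]_N R) :=
  let xi (i : 'I_N) (z : 'cV[R]_N) := z i 0 in
  [/\ mutually_independent Q xi, identically_distributed Q xi
    & forall i, ('E_Q[xi i] = 0)%E /\ (psi2_norm Q (xi i) <= sigma%:E)%E].

Section regression.
Variables (R : realType) (N p : nat).

Definition data := ('M[R]_(N, p) * 'cV[R]_N)%type.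

Section penalty.
Variables (c sigma : R) (K : set 'cV[R]_p).

Definition ell (s : nat) : R := c * ln (expR 1 + s%:R).

Definition pen (s : nat) : R :=
  let w := gaussian_width (sparse_hull K s) in
  sigma * (w * Num.sqrt (ell s) / Num.sqrt N%:R + w * ell s / N%:R)
  + w ^+ 2 * ell s / N%:R.

Definition objective (lambda : R) (D : data) (r : nat) (nu : 'cV[R]_p) : R :=
  N%:R^-1 * sqnorm2 (D.2 - D.1 *m nu) + lambda * pen r.

Definition penalized_argmin (lambda : R) (shat : data -> nat)
    (bhat : data -> 'cV[R]_p) :=
  forall D,
    [/\ (1 <= shat D <= p)%N, sparse_hull K (shat D) (bhat D)
      & forall r nu, (1 <= r <= p)%N -> sparse_hull K r nu ->
          objective lambda D (shat D) (bhat D) <= objective lambda D r nu].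

End penalty.

Section risk.
Variables (d : measure_display) (T : measurableType d) (P : probability T R).
Variable X : T -> 'M[R]_(N, p).

(* Under P \x Q the noise has law Q and is independent of the design X. *)
Definition risk (Q : probability 'cV[R]_N R) (beta : 'cV[R]_p)
    (est : data -> 'cV[R]_p) : \bar R :=
  \int[(P \x Q)%E]_z
    (sqnorm2 (est (X z.1, X z.1 *m beta + z.2) - beta))%:E.

Definition worst_risk (B : set 'cV[R]_p) (sigma : R)
    (est : data -> 'cV[R]_p) : \bar R :=
  ereal_sup [set r | exists beta Q,
    [/\ B beta, admissible_noise sigma Q & r = risk Q beta est]].

Definition minimax_risk (B : set 'cV[R]_p) (sigma : R) : \bar R :=
  ereal_inf [set worst_risk B sigma est | est in
    [set est : data -> 'cV[R]_p | measurable_fun setT est]].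

End risk.
End regression.

(* Main.v *)
(** Let f(j) be the largest t such that t(1,..,1,0,..,0) (j ones) lies in K,
    and let s_m = sqrt(log(ep/m)).  Everything is expressed through the
    admissible set {y : sum_{i in J} |y_i| <= |J| s_|J| for all J}: its support
    function over K^(s) is, up to absolute constants, at most w(K^(s)), while
    w(K^(s)) <= 8 sum_{j <= s} f(j) s_j.  Random vectors with sub-Gaussian
    tails are multiples of admissible ones outside an event of expectation
    (ep)^-2, by a union bound over integer vectors z with weight
    exp(-6 |z|_1 log(ep/|z|_1)).

    Upper bound.  The multiplier <X^T xi, u> is then at most
    C sigma sqrt(N) (w_shat + w_s), so the penalty forces pen(shat) <= 3 pen(s).
    Rounding u to an integer vector turns the lower isometry of X on sparse
    integer vectors into sqrt(N) |u| <= C (|Xu| + <y,u>) with y admissible, whence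
    |u|^2 <= C pen(s).  For large noise Cauchy-Schwarz suffices, and on the
    exceptional event |u|^2 <= 4 p f(1)^2 is compensated by (ep)^-2.

    Lower bound.  Assouad's lemma with Gaussian noise of variance (sigma/2)^2
    over cubes {t eps : eps in {-1,1}^m}, t <= c sigma / sqrt(N), that lie in
    K^(s): averages of q flat vectors with disjoint supports of size j give such
    cubes with m = qj.  This bounds every f(j), j <= s, in terms of the minimax
    risk, and summing yields w(K^(s)) sigma / sqrt(N) <= C log(ep)^2 times the
    minimax risk. *)

Require Import Defs.
From HB Require Import structures.
From mathcomp Require Import all_boot all_order all_algebra all_fingroup.
From mathcomp Require Import all_classical all_reals all_analysis.
From mathcomp Require Import measurable_realfun ring lra.

Set Implicit Arguments.
Unset Strict Implicit.
Unset Printing Implicit Defensive.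

Import Order.TTheory GRing.Theory Num.Theory.
Import numFieldNormedType.Exports.

Local Open Scope classical_set_scope.
Local Open Scope ring_scope.

(** * Logarithmic weights and integer vectors *)

(** The multiplier is tested on a hull whose index is chosen by the data. The admissible set does
    not depend on [K] or on that index, so one union bound over sign vectors serves all hulls at
    once, and the width enters only afterwards, through the deterministic inequality
    [adm_dotv_le_width]. Instead of working on a good event, each random constraint is dominated by
    a term of a nonnegative sum of exponentials. Where the sum is at most 1 the constraints hold;
    elsewhere the sum itself, times a bound on the loss over the whole body, majorizes the loss.
    Only its expectation has to be computed. The lower isometry holds only for integer vectors with
    n log(ep/n) <= eps N, while [u] is not sparse. The remainder left by rounding is made of flat
    vectors with large supports m, where N <= C m log(ep/m); this says that sqrt m is at most C
    phi(m)/sqrt N, so a linear functional <y,u> can pay for the Euclidean norm. The factor sqrt(ell)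
    comes from the penalty alone. The factor log^2 comes from the lower bound, where s_j is replaced
    by s_1 and a harmonic sum appears. *)

Section slope_weights.
Variables (R : realType) (p : nat).
Hypothesis p0 : (0 < p)%N.

Definition lgp (m : nat) : R := ln (expR 1 * p%:R / m%:R).
Definition slp (m : nat) : R := Num.sqrt (lgp m).
Definition phi (m : nat) : R := m%:R * slp m.

Lemma ln_le_subr1 (x : R) : 0 < x -> ln x <= x - 1.
Proof.
move=> x0; have := @le_ln1Dx R (x - 1); rewrite subrKC.
by apply; rewrite ltrBrDr addNr.
Qed.

Let p0R : 0 < p%:R :> R. Proof. by rewrite ltr0n. Qed.
Let e0 : 0 < expR 1 :> R. Proof. exact: expR_gt0. Qed.

Lemma lgpE m : (0 < m)%N -> lgp m = 1 + ln p%:R - ln m%:R.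
Proof.
move=> m0; rewrite /lgp ln_div ?posrE ?mulr_gt0 ?ltr0n// lnM ?posrE//.
by rewrite expRK.
Qed.

Lemma lgp_anti m n : (0 < m)%N -> (m <= n)%N -> lgp n <= lgp m.
Proof.
move=> m0 mn; have n0 := leq_trans m0 mn.
by rewrite !lgpE// lerD2l lerN2 ler_ln ?posrE ?ltr0n// ler_nat.
Qed.

Lemma lgp_ge1 m : (0 < m <= p)%N -> 1 <= lgp m.
Proof.
case/andP=> m0 mp; rewrite lgpE//.
suff : ln m%:R <= ln p%:R :> R by lra.
by rewrite ler_ln ?posrE ?ltr0n// ler_nat.
Qed.

Lemma lgp1 : lgp 1 = ln (expR 1 * p%:R).
Proof. by rewrite /lgp divr1. Qed.

(** Since ln(n/m) <= n/m - 1, replacing [lgp m] by [lgp n] costs at most n - m after multiplication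
    by m, and (n - m) [lgp n] pays for it because [lgp n >= 1] for n <= p. *)
Lemma mul_lgp_homo m n : (0 < m <= n)%N -> (n <= p)%N ->
  m%:R * lgp m <= n%:R * lgp n.
Proof.
case/andP=> m0 mn np; have n0 := leq_trans m0 mn.
have m0R : 0 < m%:R :> R by rewrite ltr0n.
have n0R : 0 < n%:R :> R by rewrite ltr0n.
have mnR : m%:R <= n%:R :> R by rewrite ler_nat.
have h : ln n%:R - ln m%:R <= n%:R / m%:R - 1 :> R.
  by rewrite -ln_div ?posrE// ln_le_subr1// divr_gt0.
have h1 : m%:R * (ln n%:R - ln m%:R) <= n%:R - m%:R :> R.
  apply: le_trans (ler_wpM2l (ltW m0R) h) _.
  by rewrite mulrBr mulrCA divff ?gt_eqF// !mulr1.
have l1 : 1 <= lgp n by apply: lgp_ge1; rewrite n0.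
have h2 : 0 <= (n%:R - m%:R) * (lgp n - 1) by rewrite mulr_ge0// subr_ge0.
have -> : lgp m = lgp n + (ln n%:R - ln m%:R) by rewrite !lgpE//; ring.
nra.
Qed.

Lemma slp_ge1 m : (0 < m <= p)%N -> 1 <= slp m.
Proof. by move=> mp; rewrite /slp -{1}(@sqrtr1 R) ler_wsqrtr// lgp_ge1. Qed.

Lemma slp_ge0 m : 0 <= slp m. Proof. exact: sqrtr_ge0. Qed.

Lemma sqr_slp m : (0 < m <= p)%N -> slp m ^+ 2 = lgp m.
Proof. by move=> mp; rewrite /slp sqr_sqrtr// (le_trans _ (lgp_ge1 mp)). Qed.

Lemma slp_anti m n : (0 < m)%N -> (m <= n)%N -> slp n <= slp m.
Proof. by move=> m0 mn; rewrite /slp ler_wsqrtr// lgp_anti. Qed.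

Lemma sqr_phi m : (0 < m <= p)%N -> phi m ^+ 2 = m%:R * (m%:R * lgp m).
Proof. by move=> mp; rewrite /phi exprMn sqr_slp// mulrA. Qed.

Lemma phi_ge0 m : 0 <= phi m.
Proof. by rewrite mulr_ge0// slp_ge0. Qed.

Lemma phi0 : phi 0 = 0. Proof. by rewrite /phi mul0r. Qed.

Lemma phi_incr m : phi m.+1 - phi m <= slp m.+1.
Proof.
rewrite /phi; case: m => [|m]; first by rewrite mul1r mul0r subr0.
have h : slp m.+2 <= slp m.+1 by rewrite slp_anti.
have m0 : 0 <= m.+1%:R :> R by [].
rewrite -(natr1 m.+1); nra.
Qed.

Lemma phi1_le m : (0 < m <= p)%N -> phi 1 <= phi m.
Proof.
case/andP=> m0 mp; rewrite /phi mul1r /slp.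
have m0R : 0 <= m%:R :> R by [].
rewrite -[leRHS]ger0_norm ?mulr_ge0 ?sqrtr_ge0//.
rewrite -sqrtr_sqr ler_wsqrtr// exprMn sqr_sqrtr; last first.
  by rewrite (le_trans _ (@lgp_ge1 m _)) ?m0.
have h := @mul_lgp_homo 1 m.
rewrite mul1r m0 in h; apply: le_trans (h isT mp) _.
rewrite ler_wpM2r//; first by rewrite (le_trans _ (@lgp_ge1 m _)) ?m0.
by rewrite expr2 -natrM ler_nat leq_pmull.
Qed.

(** The induction step asks for 2 m ([slp m] - [slp m.+1]) <= [slp m.+1]. The squares differ by
    ln((m+1)/m) <= 1/m; divide by the sum of the roots, which is at least 2 [slp m.+1], and use
    [slp m.+1 >= 1]. *)
Lemma sum_slp_le m : (m <= p)%N -> \sum_(j < m) slp j.+1 <= 2 * phi m.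
Proof.
elim: m => [_|m IH mp]; first by rewrite big_ord0 phi0 mulr0.
rewrite big_ord_recr/=; have {}IH := IH (ltnW mp).
case: m IH mp => [|m] IH mp.
  by rewrite big_ord0 add0r /phi mul1r; have := slp_ge0 1; lra.
set a := slp m.+1; set b := slp m.+2.
have b1 : 1 <= b by apply: slp_ge1.
have ab : b <= a by apply: slp_anti.
have m0R : 0 < m.+1%:R :> R by rewrite ltr0n.
have h : m.+1%:R * (a ^+ 2 - b ^+ 2) <= 1.
  rewrite /a /b !sqr_slp ?(ltnW mp)// !lgpE//.
  have -> : 1 + ln p%:R - ln m.+1%:R - (1 + ln p%:R - ln m.+2%:R) =
    ln (m.+2%:R / m.+1%:R) :> R by rewrite ln_div ?posrE//; ring.
  have h0 : 0 < m.+2%:R / m.+1%:R :> R by rewrite divr_gt0.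
  apply: le_trans (ler_wpM2l (ltW m0R) (ln_le_subr1 h0)) _.
  by rewrite mulrBr mulrCA divff ?gt_eqF// !mulr1 -(natr1 m.+1) addrAC subrr add0r.
have h2 : m.+1%:R * (a - b) * (2 * b) <= 1.
  apply: le_trans h; rewrite subr_sqr.
  have h4 : 0 <= m.+1%:R * (a - b) by rewrite mulr_ge0// subr_ge0.
  have h5 : 0 <= a - b by rewrite subr_ge0.
  have := mulr_ge0 h4 h5; nra.
have h3 : 2 * (m.+1%:R * (a - b)) <= b.
  have : 0 <= m.+1%:R * (a - b) by rewrite mulr_ge0// subr_ge0.
  nra.
move: IH; rewrite /phi -/a -/b -(natr1 m.+1); lra.
Qed.

End slope_weights.

Lemma sum_inv_nat_le_ln (R : realType) (s : nat) : (0 < s)%N ->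
  \sum_(j < s) (j.+1%:R)^-1 <= 1 + ln s%:R :> R.
Proof.
case: s => // s _; elim: s => [|s IH].
  by rewrite big_ord_recr big_ord0/= ln1 invr1 addr0 add0r.
rewrite big_ord_recr/=; apply: le_trans (lerD IH (lexx _)) _.
have := @ln_le_subr1 R (s.+1%:R / s.+2%:R) _.
rewrite ln_div ?posrE// divr_gt0// => /(_ isT).
have -> : s.+1%:R / s.+2%:R = 1 - s.+2%:R^-1 :> R.
  have -> : s.+1%:R = s.+2%:R - 1 :> R by rewrite -(natr1 s.+1) addrK.
  by rewrite mulrBl divff// mul1r.
set u := s.+2%:R^-1; move=> h; lra.
Qed.

Section integer_vectors.
Variables (R : realType) (p : nat).

(** Integer vectors with entries between -p and p, over a finite type so that union bounds are
    finite sums. [inl k] stands for k and [inr k] for -(k+1), so each integer has one code; every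
    integer vector of l1 norm at most p is covered. *)
Definition zvec := {ffun 'I_p -> 'I_p.+1 + 'I_p}%type.

Definition zcoord (c : 'I_p.+1 + 'I_p) : int :=
  match c with inl k => Posz k | inr k => Negz k end.

Definition zl1 (z : zvec) : nat := \sum_i absz (zcoord (z i)).

Definition zval (z : zvec) : 'cV[R]_p := \col_i (zcoord (z i))%:~R.

Lemma zvec_of_int (a : 'I_p -> int) : (\sum_i absz (a i) <= p)%N ->
  exists z : zvec, forall i, zcoord (z i) = a i.
Proof.
move=> ap.
have aip i : (absz (a i) <= p)%N.
  by apply: leq_trans ap; rewrite (bigD1 i)//= leq_addr.
suff /fin_all_exists[f fE] : forall i, exists c, zcoord c = a i.
  by exists [ffun i => f i] => i; rewrite ffunE.
move=> i; have := aip i; case: (a i) => k /=; rewrite ?absz_nat => kp.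
  by exists (inl (inord k)); rewrite /= inordK.
by exists (inr (Ordinal kp)).
Qed.

Hypothesis p0 : (0 < p)%N.

(* The weights [theta ^ zl1 z] with [theta = n / 2p] sum to at most [exp (2n)]. *)
Lemma card_zl1_le n : (0 < n <= p)%N ->
  (#|[pred z : zvec | zl1 z == n]|)%:R <= expR (3 * (n%:R * lgp R p n)).
Proof.
case/andP=> n0 np.
have p0R : 0 < p%:R :> R by rewrite ltr0n.
have n0R : 0 < n%:R :> R by rewrite ltr0n.
set th : R := n%:R / (2 * p%:R).
have th0 : 0 < th by rewrite divr_gt0// mulr_gt0.
have th12 : th <= 1 / 2.
  rewrite ler_pdivrMr ?mulr_gt0// mulrA -mulrA mul1r mulrA mulVf ?mul1r ?ler_nat//.
have geo k : \sum_(j < k) th ^+ j <= 2.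
  have e := subrX1 th k.
  have h1 : 0 <= th ^+ k by rewrite exprn_ge0// ltW.
  have : 0 <= \sum_(j < k) th ^+ j by apply: sumr_ge0 => i _; rewrite exprn_ge0// ltW.
  nra.
have s1 : \sum_(z : zvec) th ^+ zl1 z <= expR (2 * n%:R).
  have -> : \sum_(z : zvec) th ^+ zl1 z =
      \prod_(i < p) \sum_(c : 'I_p.+1 + 'I_p) th ^+ absz (zcoord c).
    rewrite bigA_distr_bigA/=; apply: eq_bigr => z _.
    by rewrite /zl1 prodrXr.
  rewrite prodr_const card_ord.
  (* Zero contributes 1, and the positive and the negative integers contribute at most [2 * th] each
     because [th <= 1/2]. The p-th power is then at most exp(4 p th) = exp(2n). *)
  have h : \sum_(c : 'I_p.+1 + 'I_p) th ^+ absz (zcoord c) <= 1 + 4 * th.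
    rewrite big_sumType/= big_ord_recl/= expr0 -addrA lerD2l.
    have -> : \sum_(i < p) th ^+ bump 0 i + \sum_(i < p) th ^+ i.+1 =
       2 * (th * \sum_(i < p) th ^+ i).
      rewrite mulr_sumr mulr_natl mulr2n; congr (_ + _);
      by apply: eq_bigr => i _; rewrite -exprS.
    by have := geo p; nra.
  have h0 : 0 <= \sum_(c : 'I_p.+1 + 'I_p) th ^+ absz (zcoord c).
    by apply: sumr_ge0 => i _; rewrite exprn_ge0// ltW.
  apply: (@le_trans _ _ ((1 + 4 * th) ^+ p)); first by rewrite lerXn2r// nnegrE; lra.
  apply: (@le_trans _ _ (expR (4 * th) ^+ p)).
    by rewrite lerXn2r ?nnegrE ?expR_ge0 ?expR_ge1Dx//; lra.
  rewrite -expRM_natl ler_expR /th le_eqVlt; apply/orP; left; apply/eqP.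
  by field; rewrite gt_eqF.
have s2 : (#|[pred z : zvec | zl1 z == n]|)%:R * th ^+ n <= expR (2 * n%:R).
  apply: le_trans s1; rewrite (bigID (fun z => zl1 z == n))/=.
  rewrite -[leLHS]addr0 lerD//; last by apply: sumr_ge0 => i _; rewrite exprn_ge0// ltW.
  rewrite -sum1_card natr_sum mulr_suml le_eqVlt; apply/orP; left; apply/eqP.
  by apply: eq_big => // z /eqP ->; rewrite mul1r.
have e1 : th ^+ n = expR (- (n%:R * ln (2 * p%:R / n%:R))).
  rewrite -mulrN -lnV ?posrE ?divr_gt0 ?mulr_gt0// invf_div -/th.
  by rewrite expRM_natl lnK.
move: s2; rewrite e1 expRN -ler_pdivlMr ?invr_gt0 ?expR_gt0// invrK => /le_trans; apply.
rewrite -expRD ler_expR.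
have h1 : ln (2 * p%:R / n%:R) <= lgp R p n.
  rewrite /lgp ler_ln ?posrE ?divr_gt0 ?mulr_gt0 ?expR_gt0//.
  rewrite ler_pM2r ?invr_gt0// ler_pM2r//.
  by apply: le_trans (expR_ge1Dx _).
have h2 : 1 <= lgp R p n by apply: lgp_ge1; rewrite ?n0.
nra.
Qed.

(** Level n has at most exp(3 n lgp n) vectors, so it contributes at most exp(-3 n lgp n) <= exp(-3
    lgp 1) by [mul_lgp_homo]. The p levels cost a factor p <= exp(lgp 1), which leaves (ep)^-2. *)
Lemma zl1_union_bound :
  \sum_(z : zvec | (0 < zl1 z <= p)%N) expR (- (6 * ((zl1 z)%:R * lgp R p (zl1 z))))
  <= expR (- (2 * lgp R p 1)).
Proof.
have p0R : 0 < p%:R :> R by rewrite ltr0n.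
pose F n : R := expR (- (6 * (n%:R * lgp R p n))).
have -> : \sum_(z : zvec | (0 < zl1 z <= p)%N) F (zl1 z) =
   \sum_(n < p) \sum_(z : zvec | zl1 z == n.+1) F n.+1.
  rewrite (partition_big (fun z => insubd (Ordinal p0) (zl1 z).-1) predT)//=.
  apply: eq_bigr => n _.
  apply: eq_big => [z|z /andP[/andP[z0 zp] /eqP <-]].
    apply/andP/eqP => [[/andP[z0 zp] /eqP <-]|->].
      by rewrite val_insubd/= prednK// zp prednK.
    split; first exact: ltn_ord.
    by apply/eqP/val_inj; rewrite val_insubd/= ltn_ord.
  by rewrite val_insubd prednK// zp prednK.
apply: (@le_trans _ _ (\sum_(n < p) expR (- (3 * lgp R p 1)))).
  apply: ler_sum => n _; rewrite sumr_const -[leLHS]mulr_natl.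
  have h := @card_zl1_le n.+1 (ltn_ord n).
  apply: le_trans (ler_wpM2r (expR_ge0 _) h) _.
  rewrite -expRD ler_expR.
  have := @mul_lgp_homo R p p0 1 n.+1 isT (ltn_ord n); rewrite mul1r; lra.
rewrite sumr_const card_ord -[leLHS]mulr_natl.
have h : p%:R <= expR (lgp R p 1).
  rewrite lgp1 lnK ?posrE ?mulr_gt0 ?expR_gt0//.
  by rewrite ler_peMl ?ltW// expR_gt1.
apply: le_trans (ler_wpM2r (expR_ge0 _) h) _.
by rewrite -expRD ler_expR; lra.
Qed.

End integer_vectors.

(** * Sorted profiles and Abel summation *)

Section sorting.
Variables (R : realType) (p : nat).

Lemma sort_perm_exists (a : 'I_p -> R) :
  exists pi : 'S_p, forall i j : 'I_p, (i <= j)%N -> a (pi j) <= a (pi i).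
Proof.
set s := [tuple a i | i < p].
have /tuple_permP[pi e] : perm_eq (sort >=%O s) s by rewrite perm_sort.
have e2 (i : 'I_p) : nth 0 (sort >=%O s) i = a (pi i).
  by rewrite e -tnth_nth !tnth_mktuple.
exists pi => i j ij; rewrite -!e2.
have st : sorted >=%O (sort >=%O s) by apply: sort_sorted; exact: ge_total.
apply: (sorted_leq_nth (@ge_trans _ _) (@lexx _ _) 0 st) => //;
  by rewrite inE size_sort size_tuple.
Qed.

Lemma abel_sum (n : nat) (x b : nat -> R) : x n = 0 ->
  \sum_(i < n) x i * b i = \sum_(m < n) (x m - x m.+1) * \sum_(i < m.+1) b i.
Proof.
move=> xn.
suff -> : \sum_(i < n) x i * b i =
  \sum_(m < n) (x m - x m.+1) * (\sum_(i < m.+1) b i) + x n * \sum_(i < n) b i.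
  by rewrite xn mul0r addr0.
elim: n {xn} => [|n IH]; first by rewrite !big_ord0 mulr0 addr0.
rewrite big_ord_recr/= IH [in RHS]big_ord_recr/= [in RHS]big_ord_recr/=.
ring.
Qed.

(** The value 0 beyond p is the boundary term of Abel summation: the last difference of consecutive
    values is the last entry itself. *)
Definition profile (a : 'I_p -> R) (pi : 'S_p) (m : nat) : R :=
  if insub m is Some i then a (pi i) else 0.

Lemma profileE a pi (i : 'I_p) : profile a pi i = a (pi i).
Proof. by rewrite /profile valK. Qed.

Lemma profile_ge a pi m : (p <= m)%N -> profile a pi m = 0.
Proof. by move=> pm; rewrite /profile insubF// ltnNge pm. Qed.

Lemma profile_ge0 a pi m : (forall i, 0 <= a i) -> 0 <= profile a pi m.
Proof. by move=> a0; rewrite /profile; case: insub. Qed.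

Lemma profile_anti (a : 'I_p -> R) (pi : 'S_p) : (forall i, 0 <= a i) ->
  (forall i j : 'I_p, (i <= j)%N -> a (pi j) <= a (pi i)) ->
  forall m n, (m <= n)%N -> profile a pi n <= profile a pi m.
Proof.
move=> a0 api m n mn; have [pn|np] := leqP p n.
  by rewrite (profile_ge _ _ pn) profile_ge0.
rewrite -[n]/(val (Ordinal np)) -[m]/(val (Ordinal (leq_ltn_trans mn np))).
by rewrite !profileE api.
Qed.

Lemma card_ord_lt m : (m <= p)%N -> #|[set k : 'I_p | (k < m)%N]%SET| = m.
Proof.
move=> mp; rewrite -sum1_card (eq_bigl (fun k : 'I_p => (k < m)%N)).
  by rewrite -(big_ord_widen p (fun=> 1%N))// sum1_card card_ord.
by move=> k; rewrite inE.
Qed.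

Lemma card_rank_lt (pi : 'S_p) m : (m <= p)%N ->
  #|[set i | ((pi^-1)%g i < m)%N]%SET| = m.
Proof.
move=> mp; rewrite -[RHS](card_ord_lt mp).
rewrite -[RHS](card_preimset _ (@perm_inj _ (pi^-1)%g)).
by apply: eq_card => i; rewrite !inE.
Qed.

(** Induction on the size of [J], removing its element of largest rank. The other elements have
    smaller ranks, so that rank is at least [#|J| - 1], and the entry removed is at most the
    matching entry of the profile. *)
Lemma sum_set_le_sorted (a : 'I_p -> R) (pi : 'S_p) (J : {set 'I_p}) :
  (forall i, 0 <= a i) ->
  (forall i j : 'I_p, (i <= j)%N -> a (pi j) <= a (pi i)) ->
  \sum_(i in J) a i <= \sum_(i < #|J|) profile a pi i.
Proof.
move=> a0 api.
have [m] := ubnP #|J|; elim: m J => // m IH J; rewrite ltnS => Jm.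
have [->|/set0Pn[i0 i0J]] := eqVneq J finset.set0.
  by rewrite big_set0 cards0 big_ord0.
pose rk (i : 'I_p) : nat := (pi^-1)%g i.
case: (arg_maxnP (P := fun i => i \in J) rk i0J) => i iJ imax.
have cJ : #|J| = #|J :\ i|.+1 by rewrite (cardsD1 i) iJ.
rewrite (big_setD1 i)//= cJ big_ord_recr/= addrC lerD//.
  by apply: IH; rewrite cJ in Jm.
have h : (#|J :\ i| <= rk i)%N.
  have sub : [set (pi^-1)%g j | j in J]%SET \subset
     [set k : 'I_p | (k < (rk i).+1)%N]%SET.
    by apply/fintype.subsetP => k /imsetP[j jJ ->]; rewrite inE ltnS; exact: imax.
  have := subset_leq_card sub.
  by rewrite card_imset ?card_ord_lt ?cJ//; [exact: ltn_ord|exact: perm_inj].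
rewrite -{1}(permKV pi i) -profileE; exact: profile_anti.
Qed.

End sorting.

(** * Layer decomposition and admissible vectors *)

Section euclidean.
Variables (R : realType) (p : nat).
Implicit Types u v w : 'cV[R]_p.

Lemma dotvDl u v w : dotv (u + v) w = dotv u w + dotv v w.
Proof. by rewrite /dotv -big_split; apply: eq_bigr => i _; rewrite mxE mulrDl. Qed.

Lemma dotvC u v : dotv u v = dotv v u.
Proof. by apply: eq_bigr => i _; rewrite mulrC. Qed.

Lemma dotvDr u v w : dotv u (v + w) = dotv u v + dotv u w.
Proof. by rewrite dotvC dotvDl !(dotvC u). Qed.

Lemma dotvZl a u v : dotv (a *: u) v = a * dotv u v.
Proof. by rewrite /dotv mulr_sumr; apply: eq_bigr => i _; rewrite mxE mulrA. Qed.

Lemma dotvZr a u v : dotv u (a *: v) = a * dotv u v.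
Proof. by rewrite dotvC dotvZl dotvC. Qed.

Lemma dotvNr u v : dotv u (- v) = - dotv u v.
Proof. by rewrite -scaleN1r dotvZr mulN1r. Qed.

Lemma dotvNl u v : dotv (- u) v = - dotv u v.
Proof. by rewrite dotvC dotvNr dotvC. Qed.

Lemma dotv0r u : dotv u 0 = 0.
Proof. by rewrite /dotv big1// => i _; rewrite mxE mulr0. Qed.

Lemma dotv_sumr (I : Type) (r : seq I) (P : pred I) (F : I -> 'cV[R]_p) u :
  dotv u (\sum_(i <- r | P i) F i) = \sum_(i <- r | P i) dotv u (F i).
Proof. by apply: (big_morph (dotv u)) => [x y|]; [exact: dotvDr|exact: dotv0r]. Qed.

Lemma sqnorm2_ge0 v : 0 <= sqnorm2 v.
Proof. by apply: sumr_ge0 => i _; rewrite -expr2 sqr_ge0. Qed.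

Lemma sqnorm2Z a v : sqnorm2 (a *: v) = a ^+ 2 * sqnorm2 v.
Proof. by rewrite /sqnorm2 dotvZl dotvZr mulrA expr2. Qed.

Lemma sqnorm2N v : sqnorm2 (- v) = sqnorm2 v.
Proof. by rewrite /sqnorm2 dotvNl dotvNr opprK. Qed.

Lemma sqnorm2D u v : sqnorm2 (u + v) = sqnorm2 u + 2 * dotv u v + sqnorm2 v.
Proof. by rewrite /sqnorm2 dotvDl !dotvDr (dotvC v u); ring. Qed.

Lemma sqnorm2_eq0 v : sqnorm2 v = 0 -> v = 0.
Proof.
move=> v0; apply/colP => i; rewrite mxE.
have /eqP := v0; rewrite psumr_eq0; last by move=> j _; rewrite -expr2 sqr_ge0.
by move=> /allP/(_ i); rewrite mem_index_enum => /(_ isT)/=; rewrite mulf_eq0 orbb => /eqP.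
Qed.

Lemma cauchy_schwarz u v : dotv u v ^+ 2 <= sqnorm2 u * sqnorm2 v.
Proof.
have [/sqnorm2_eq0 ->|v0] := eqVneq (sqnorm2 v) 0.
  by rewrite dotv0r expr0n mulr_ge0// sqnorm2_ge0.
have vp : 0 < sqnorm2 v by rewrite lt_def v0 sqnorm2_ge0.
have := sqnorm2_ge0 (sqnorm2 v *: u - dotv u v *: v).
rewrite sqnorm2D sqnorm2N !sqnorm2Z dotvNr dotvZl dotvZr.
move=> h.
have : 0 <= sqnorm2 v * (sqnorm2 u * sqnorm2 v - dotv u v ^+ 2) by nra.
by rewrite pmulr_rge0// subr_ge0.
Qed.

Definition nrm v : R := Num.sqrt (sqnorm2 v).

Lemma nrm_ge0 v : 0 <= nrm v. Proof. exact: sqrtr_ge0. Qed.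

Lemma sqr_nrm v : nrm v ^+ 2 = sqnorm2 v.
Proof. by rewrite sqr_sqrtr// sqnorm2_ge0. Qed.

Lemma dotv_le_nrm u v : dotv u v <= nrm u * nrm v.
Proof.
rewrite -sqrtrM ?sqnorm2_ge0//; apply: le_trans (ler_norm _) _.
by rewrite -sqrtr_sqr ler_wsqrtr// cauchy_schwarz.
Qed.

Lemma nrmD u v : nrm (u + v) <= nrm u + nrm v.
Proof.
rewrite -(@ler_pXn2r _ 2) ?nnegrE ?addr_ge0 ?nrm_ge0//.
rewrite sqrrD !sqr_nrm sqnorm2D lerD2r lerD2l -[leRHS]mulr_natl.
by rewrite ler_wpM2l// dotv_le_nrm.
Qed.

Lemma nrmZ a v : nrm (a *: v) = `|a| * nrm v.
Proof. by rewrite /nrm sqnorm2Z sqrtrM ?sqr_ge0// sqrtr_sqr. Qed.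

Lemma nrm0 : nrm 0 = 0.
Proof. by rewrite /nrm /sqnorm2 dotv0r sqrtr0. Qed.

Lemma nrm_sum (I : Type) (r : seq I) (P : pred I) (F : I -> 'cV[R]_p) :
  nrm (\sum_(i <- r | P i) F i) <= \sum_(i <- r | P i) nrm (F i).
Proof.
elim/big_ind2 : _ => [|x1 x2 y1 y2 h1 h2|//]; first by rewrite nrm0.
exact: le_trans (nrmD _ _) (lerD h1 h2).
Qed.

End euclidean.

Section layers.
Variables (R : realType) (p : nat).
Implicit Types u v y e : 'cV[R]_p.

Definition sgnv v i : R := (-1) ^+ (v i 0 < 0)%R.
Definition absv v (i : 'I_p) : R := `|v i 0|.

Lemma sgnv_abs v i : v i 0 = sgnv v i * absv v i.
Proof. by rewrite /sgnv /absv -numEsign. Qed.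

Lemma normr_sgnv v i : `|sgnv v i| = 1.
Proof. by rewrite /sgnv normrX normrN1 expr1n. Qed.

Lemma absv_ge0 v i : 0 <= absv v i. Proof. exact: normr_ge0. Qed.

(** When [pi] sorts [v], the layers carry the signs of [v] on its [m.+1] largest entries and [v] is
    a nonnegative combination of them, so functionals and norms need only be tested on flat sign
    vectors. *)
Definition layer v (pi : 'S_p) (m : nat) : 'cV[R]_p :=
  \col_i (if ((pi^-1)%g i <= m)%N then sgnv v i else 0).

Lemma layer_decomposition v pi : v =
  \sum_(m < p) (profile (absv v) pi m - profile (absv v) pi m.+1) *: layer v pi m.
Proof.
set x := profile _ _; apply/colP => i; rewrite summxE.
set r := (pi^-1)%g i.
have -> : v i 0 = sgnv v i * \sum_(j < p) x j * (j == r)%:R.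
  rewrite (bigD1 r)//= eqxx mulr1 big1 ?addr0; last first.
    by move=> j; rewrite -val_eqE => /negbTE ->; rewrite mulr0.
  by rewrite /x profileE permKV -sgnv_abs.
rewrite (@abel_sum R p x (fun j => (j == r)%:R)); last exact: profile_ge.
rewrite mulr_sumr; apply: eq_bigr => m _; rewrite !mxE -/r.
have -> : \sum_(j < m.+1) (nat_of_ord j == r)%:R = (r <= m)%N%:R :> R.
  case: leqP => rm.
    rewrite (bigD1 (Ordinal (rm : (r < m.+1)%N)))//= eqxx big1 ?addr0// => j.
    by rewrite -val_eqE/= => /negbTE ->.
  by rewrite big1// => j _; rewrite ltn_eqF// (leq_trans (ltn_ord j)).
by case: leqP => _; rewrite ?mulr1 ?mulr0// mulrC.
Qed.

Definition adm y := forall J : {set 'I_p}, \sum_(i in J) `|y i 0| <= phi R p #|J|.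

Lemma dotv_layer_le y v pi (m : 'I_p) : adm y -> dotv y (layer v pi m) <= phi R p m.+1.
Proof.
move=> ay; pose J := [set i | ((pi^-1)%g i < m.+1)%N]%SET.
have cJ : #|J| = m.+1 by exact: card_rank_lt.
rewrite -cJ; apply: le_trans (ay J).
rewrite [leRHS]big_mkcond; apply: ler_sum => i _; rewrite mxE inE ltnS.
case: leqP => _; last by rewrite mulr0.
by rewrite (le_trans (ler_norm _))// normrM normr_sgnv mulr1.
Qed.

(** For sorting [pi] this is the Lovasz extension of [J |-> phi #|J|] at the absolute values of [v];
    it bounds the support function of the admissible set. *)
Definition layer_norm v pi : R :=
  \sum_(m < p) (profile (absv v) pi m - profile (absv v) pi m.+1) * phi R p m.+1.

(** For sorting [pi] this is the sorted l1 norm of SLOPE regression with weights [slp]. *)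
Definition slope v pi : R := \sum_(m < p) profile (absv v) pi m * slp R p m.+1.

Definition sorts v (pi : 'S_p) :=
  forall i j : 'I_p, (i <= j)%N -> absv v (pi j) <= absv v (pi i).

Lemma sorts_exists v : exists pi, sorts v pi.
Proof. exact: sort_perm_exists. Qed.

Lemma sorts_anti v pi m : sorts v pi ->
  0 <= profile (absv v) pi m - profile (absv v) pi m.+1.
Proof.
by move=> vpi; rewrite subr_ge0; apply: profile_anti => // i; exact: absv_ge0.
Qed.

Lemma adm_dotv_le y v pi : adm y -> sorts v pi -> dotv y v <= layer_norm v pi.
Proof.
move=> ay vpi; rewrite {1}(layer_decomposition v pi) dotv_sumr.
apply: ler_sum => m _; rewrite dotvZr ler_wpM2l ?sorts_anti//.
exact: dotv_layer_le.
Qed.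

Hypothesis p0 : (0 < p)%N.

Lemma layer_norm_le_slope v pi : layer_norm v pi <= slope v pi.
Proof.
rewrite /layer_norm.
have e (m : nat) : phi R p m.+1 = \sum_(i < m.+1) (phi R p i.+1 - phi R p i).
  rewrite -(big_mkord predT (fun i => phi R p i.+1 - phi R p i)).
  by rewrite telescope_sumr// phi0 subr0.
under eq_bigr => m _ do rewrite e.
rewrite -(@abel_sum R p _ (fun i => phi R p i.+1 - phi R p i)) ?profile_ge//.
apply: ler_sum => m _; rewrite ler_wpM2l ?phi_incr//.
by apply: profile_ge0 => i; exact: absv_ge0.
Qed.

(** Among sets of a given size, the weights [slp] of the ranks have the largest sum over the first
    ranks, and that sum is at most [2 * phi #|J|] by [sum_slp_le]; hence the factor 1/2. *)
Lemma adm_rank (s : 'I_p -> R) (pi : 'S_p) : (forall i, `|s i| <= 1) ->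
  adm (2^-1 *: \col_i (s i * slp R p ((pi^-1)%g i).+1)).
Proof.
move=> s1 J; set a := fun i => slp R p ((pi^-1)%g i).+1.
have a0 i : 0 <= a i by exact: slp_ge0.
have h : \sum_(i in J) a i <= \sum_(i < #|J|) slp R p i.+1.
  apply: le_trans (sum_set_le_sorted (pi := pi) J a0 _) _.
    by move=> i j ij; rewrite /a !permK slp_anti.
  apply: ler_sum => i _.
  have ip : (i < p)%N by rewrite (leq_trans (ltn_ord i))// -[leqRHS]card_ord max_card.
  by rewrite -[val i]/(val (Ordinal ip)) profileE /a permK.
have Jp : (#|J| <= p)%N by rewrite -[leqRHS]card_ord max_card.
have {}h := le_trans h (sum_slp_le R p0 Jp).
apply: (@le_trans _ _ (2^-1 * \sum_(i in J) a i)); last by lra.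
rewrite mulr_sumr; apply: ler_sum => i _; rewrite !mxE.
rewrite normrM (ger0_norm (ltW _))//; rewrite ler_wpM2l//.
by rewrite normrM (ger0_norm (a0 i)) ler_piMl.
Qed.

(** The witness has the signs of [u] but the ranks of [e], so pairing it with [u] only enlarges each
    term [absv e i]. A bound in terms of a rounding remainder [e] thus becomes a bound in terms of
    [u]. *)
Lemma slope_dominated u e pi : (forall i, absv e i <= absv u i) ->
  exists y, adm y /\ slope e pi <= 2 * dotv y u.
Proof.
move=> eu; exists (2^-1 *: \col_i (sgnv u i * slp R p ((pi^-1)%g i).+1)).
split; first by apply: adm_rank => i; rewrite normr_sgnv.
rewrite dotvZl mulrA divff// mul1r /slope /dotv.
rewrite (reindex_inj (@perm_inj _ pi^-1%g))/=.
apply: ler_sum => i _; rewrite mxE profileE permKV (sgnv_abs u i).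
rewrite mulrACA -expr2 /sgnv sqrr_sign mul1r mulrC.
by rewrite ler_wpM2l ?slp_ge0.
Qed.

Lemma nrm_layer v pi (m : 'I_p) : nrm (layer v pi m) = Num.sqrt (m.+1)%:R.
Proof.
congr Num.sqrt; rewrite -[in RHS](card_rank_lt pi (ltn_ord m)).
rewrite -sum1_card natr_sum.
rewrite [RHS]big_mkcond; apply: eq_bigr => i _; rewrite !inE mxE ltnS.
case: leqP => _; last by rewrite mulr0.
by rewrite -expr2 /sgnv sqrr_sign.
Qed.

Definition sign_zvec (z : zvec p) := [forall i, absz (zcoord (z i)) <= 1]%N.

Lemma layer_zval v pi (m : 'I_p) : exists z : zvec p,
  [/\ sign_zvec z, zl1 z = m.+1 & zval R z = layer v pi m].
Proof.
pose a (i : 'I_p) : int := if ((pi^-1)%g i <= m)%N then (-1) ^+ (v i 0 < 0)%R else 0.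
have a1 i : absz (a i) = ((pi^-1)%g i < m.+1)%N.
  rewrite /a ltnS; case: leqP => // _; by case: (v i 0 < 0).
have sa : (\sum_i absz (a i))%N = m.+1.
  under eq_bigr => i _ do rewrite a1.
  rewrite -[RHS](card_rank_lt pi (ltn_ord m)) -sum1_card.
  rewrite [RHS]big_mkcond; apply: eq_bigr => i _; rewrite !inE.
  by case: (_ < _)%N.
have [z zE] := @zvec_of_int p a (leq_trans (eq_leq sa) (ltn_ord m)).
exists z; split.
- by apply/forallP => i; rewrite zE a1; case: (_ < _)%N.
- by rewrite -sa; apply: eq_bigr => i _; rewrite zE.
- apply/colP => i; rewrite !mxE zE /a /sgnv; case: leqP => // _.
  by case: (v i 0 < 0).
Qed.

End layers.

(** * Lower bound for the quadratic form *)

Lemma absv_le_nrm (R : realType) (p : nat) (u : 'cV[R]_p) i : absv u i <= nrm u.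
Proof.
rewrite /absv -sqrtr_sqr ler_wsqrtr// /sqnorm2 /dotv (bigD1 i)//= -expr2 lerDl; apply: sumr_ge0 => j _.
by rewrite -expr2 sqr_ge0.
Qed.

Section quadratic_lower_bound.
Variables (R : realType) (N p : nat).
Hypotheses (N0 : (0 < N)%N) (p0 : (0 < p)%N).
Variables (Cu cl eps b : R).
Hypotheses (Cu0 : 0 < Cu) (cl0 : 0 < cl) (eps0 : 0 < eps) (b0 : 0 < b).
Hypothesis Nbp : N%:R <= b * p%:R.
Variable X : 'M[R]_(N, p).

Hypothesis Xup : forall z : zvec p, sign_zvec z -> (0 < zl1 z <= p)%N ->
  sqnorm2 (X *m zval R z) <= Cu * (zl1 z)%:R * (N%:R + (zl1 z)%:R * lgp R p (zl1 z)).
Hypothesis Xlow : forall z : zvec p, (0 < zl1 z <= p)%N ->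
  (zl1 z)%:R * lgp R p (zl1 z) <= eps * N%:R ->
  cl * N%:R * sqnorm2 (zval R z) <= sqnorm2 (X *m zval R z).

Let S := Num.sqrt (N%:R : R).
Let NR : 0 < N%:R :> R. Proof. by rewrite ltr0n. Qed.
Let S0 : 0 < S. Proof. by rewrite sqrtr_gt0. Qed.

(** Handles a vector for which only upper estimates on [X] are at hand. Layers of size at most [T]
    have norm at most sqrt T, and the weights telescope to at most [h]. For larger layers,
    [N <= B m lgp m] says that sqrt m is at most sqrt(B/N) [phi m], which sums to [layer_norm]. The
    image under [X] is bounded layer by layer with [Xup]. *)
Lemma layer_remainder (e : 'cV[R]_p) (pi : 'S_p) (h T B : R) : sorts e pi ->
  0 <= h -> 0 <= T -> 0 <= B -> (forall i, absv e i <= h) ->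
  (forall m, (0 < m <= p)%N -> T < m%:R -> N%:R <= B * (m%:R * lgp R p m)) ->
  let r := h * Num.sqrt T + Num.sqrt (B / N%:R) * layer_norm e pi in
  nrm e <= r /\ nrm (X *m e) <= Num.sqrt Cu * (S * r + layer_norm e pi).
Proof.
move=> epi h0 T0 B0 eh TB r.
set x := profile (absv e) pi.
have xd m : 0 <= x m - x m.+1 by exact: sorts_anti.
have x0 : x 0%N <= h by rewrite /x /profile; case: insub.
have step (m : 'I_p) : Num.sqrt m.+1%:R <=
    Num.sqrt T + Num.sqrt (B / N%:R) * phi R p m.+1.
  have ph := phi_ge0 R p m.+1.
  have [mT|Tm] := leP m.+1%:R T.
    by apply: (le_trans (ler_wsqrtr mT)); rewrite lerDl mulr_ge0// sqrtr_ge0.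
  have mp : (0 < m.+1 <= p)%N by rewrite ltn_ord.
  have h1 := TB m.+1 mp Tm.
  apply: (@le_trans _ _ (Num.sqrt (B / N%:R) * phi R p m.+1)); last first.
    by rewrite lerDr sqrtr_ge0.
  have hr : 0 <= Num.sqrt (B / N%:R) * phi R p m.+1 by rewrite mulr_ge0// sqrtr_ge0.
  rewrite -[leRHS]ger0_norm// -sqrtr_sqr ler_wsqrtr//.
  rewrite exprMn sqr_sqrtr ?divr_ge0 ?(ltW NR)// sqr_phi//.
  rewrite mulrAC ler_pdivlMr//.
  have : 0 <= m.+1%:R * (B * (m.+1%:R * lgp R p m.+1) - N%:R).
    by rewrite mulr_ge0// subr_ge0.
  lra.
have sum1 : \sum_(m < p) (x m - x m.+1) * Num.sqrt m.+1%:R <= r.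
  apply: (@le_trans _ _ (\sum_(m < p) (x m - x m.+1) *
     (Num.sqrt T + Num.sqrt (B / N%:R) * phi R p m.+1))).
    by apply: ler_sum => m _; rewrite ler_wpM2l.
  under eq_bigr => m _ do rewrite mulrDr.
  rewrite big_split/= -mulr_suml lerD//.
    rewrite ler_wpM2r ?sqrtr_ge0//.
    suff -> : \sum_(m < p) (x m - x m.+1) = x 0%N - x p.
      by rewrite /x (profile_ge _ _ (leqnn p)) subr0.
    rewrite -(big_mkord predT (fun m => x m - x m.+1)) -[LHS]opprK -sumrN.
    by under eq_bigr do rewrite opprB; rewrite telescope_sumr// opprB.
  rewrite /layer_norm mulr_sumr; apply: ler_sum => m _.
  by rewrite mulrCA.
have eE := layer_decomposition e pi.
split.
  rewrite {1}eE; apply: le_trans (nrm_sum _ _ _) _.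
  apply: le_trans sum1; apply: ler_sum => m _.
  by rewrite nrmZ ger0_norm// nrm_layer.
rewrite {1}eE mulmx_sumr; apply: le_trans (nrm_sum _ _ _) _.
apply: (@le_trans _ _ (\sum_(m < p) (x m - x m.+1) *
     (Num.sqrt Cu * (S * Num.sqrt m.+1%:R + phi R p m.+1)))).
  apply: ler_sum => m _; rewrite -scalemxAr nrmZ ger0_norm// ler_wpM2l//.
  have [z [zs z1 <-]] := layer_zval e pi m.
  have mp : (0 < m.+1 <= p)%N by rewrite ltn_ord.
  have := Xup zs; rewrite z1 => /(_ mp) h1.
  have h2 : 0 <= Num.sqrt Cu * (S * Num.sqrt m.+1%:R + phi R p m.+1).
    by rewrite mulr_ge0 ?addr_ge0 ?mulr_ge0 ?sqrtr_ge0 ?phi_ge0// ltW.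
  rewrite -[leRHS]ger0_norm// -sqrtr_sqr ler_wsqrtr//.
  apply: le_trans h1 _; rewrite exprMn (sqr_sqrtr (ltW Cu0)) -[leLHS]mulrA.
  rewrite ler_wpM2l ?(ltW Cu0)//.
  rewrite sqrrD exprMn (sqr_sqrtr (ltW NR)) sqr_sqrtr// sqr_phi//.
  have : 0 <= S * Num.sqrt m.+1%:R * phi R p m.+1.
    by rewrite !mulr_ge0 ?sqrtr_ge0 ?phi_ge0// ltW.
  rewrite -[_ *+ 2]mulr_natl; lra.
under eq_bigr => m _ do rewrite mulrCA mulrDr (mulrCA _ S).
rewrite -mulr_sumr ler_wpM2l ?sqrtr_ge0// big_split/= lerD2r -mulr_sumr.
by rewrite ler_wpM2l// ltW.
Qed.

(* [n] is the largest sparsity level with [n lgp n <= eps N], hence [N <= C m lgp m]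
   for [m] above a fraction of [n]. *)
Lemma isometry_level : lgp R p 1 <= eps * N%:R ->
  exists n, [/\ (0 < n <= p)%N, n%:R * lgp R p n <= eps * N%:R &
    forall m, (0 < m <= p)%N -> forall k2 : R, 0 < k2 <= 1 -> k2 * n%:R < m%:R ->
      N%:R <= (2 / eps + b) / k2 * (m%:R * lgp R p m)].
Proof.
move=> l1.
pose Q n := (0 < n <= p)%N && (n%:R * lgp R p n <= eps * N%:R).
have exQ : exists n, Q n by exists 1%N; rewrite /Q p0 mul1r.
have Qp n : Q n -> (n <= p)%N by case/andP => /andP[].
case: (ex_maxnP exQ Qp) => n /andP[np nl] nmax.
exists n; split=> // m mp k2 /andP[k20 k21] km.
have [n0 np'] := andP np; have [m0 mp'] := andP mp.
have lm1 : 1 <= lgp R p m by exact: lgp_ge1.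
have ln1' : 1 <= lgp R p n by exact: lgp_ge1.
have e2 : 0 <= 2 / eps by rewrite divr_ge0// ltW.
have k2i : 1 <= k2^-1 by rewrite invf_ge1.
have mlm : 0 <= m%:R * lgp R p m by rewrite mulr_ge0// (le_trans _ lm1).
have key : N%:R <= (2 / eps + b) * (n%:R * lgp R p n).
  have nln : 0 <= n%:R * lgp R p n by rewrite mulr_ge0// (le_trans _ ln1').
  (* Below p, maximality gives eps N < (n+1) lgp(n+1) <= 2 n lgp n. At n = p, the assumption
     [N <= b p] takes over. *)
  have [nltp|pn] := ltnP n p.
    have : ~~ Q n.+1 by apply/negP => /nmax; rewrite ltnn.
    rewrite /Q nltp/= -ltNge => h.
    have h2 : n.+1%:R * lgp R p n.+1 <= 2 * (n%:R * lgp R p n).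
      have a1 := lgp_anti R p0 n0 (leqnSn n).
      have n2 : n.+1%:R <= 2 * n%:R :> R by rewrite -natrM ler_nat mul2n -addnn -addn1 leq_add2l.
      apply: (@le_trans _ _ (n.+1%:R * lgp R p n)); first by rewrite ler_wpM2l.
      by rewrite mulrA ler_wpM2r// (le_trans _ ln1').
    have h3 : N%:R <= 2 / eps * (n%:R * lgp R p n).
      by rewrite mulrAC ler_pdivlMr// mulrC; apply: le_trans (ltW h) h2.
    apply: le_trans h3 _; rewrite ler_wpM2r// lerDl ltW//.
  have -> : n = p by apply/eqP; rewrite eqn_leq np' pn.
  apply: le_trans Nbp _.
  have lp1 : 1 <= lgp R p p by apply: lgp_ge1; rewrite p0/=.
  apply: (@le_trans _ _ (b * (p%:R * lgp R p p))).
    by rewrite ler_wpM2l ?(ltW b0)// ler_peMr.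
  rewrite ler_wpM2r ?mulr_ge0 ?(le_trans _ lp1)//; first by rewrite lerDr.
have [mn|nm] := leqP m n.
  apply: le_trans key _; rewrite -[leRHS]mulrA ler_wpM2l ?addr_ge0 ?(ltW b0)//.
  rewrite ler_pdivlMl// mulrA ler_pM ?mulr_ge0 ?(ltW k20) ?(ltW km) ?(le_trans _ ln1')//.
  exact: lgp_anti.
apply: le_trans key _.
apply: (@le_trans _ _ ((2 / eps + b) * (m%:R * lgp R p m))).
  rewrite ler_wpM2l ?addr_ge0 ?(ltW b0)//.
  by apply: mul_lgp_homo => //; rewrite n0 ltnW.
rewrite ler_wpM2r//; rewrite -[leLHS]mulr1 ler_wpM2l// addr_ge0// ltW//.
Qed.

(** Round [u] towards zero to [h z] with step h = |u|/sqrt n, where n comes from [isometry_level].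
    The lower isometry applies to [z]; [layer_remainder] applies to the remainder with [T = k^2 n],
    so that h sqrt T = k |u|. As K k is half of sqrt(cl), this loss is absorbed on the left, and the
    layer norm of the remainder becomes <y,u> by [slope_dominated]. *)
Lemma quadratic_lower_bound (u : 'cV[R]_p) :
  let K := Num.sqrt Cu + Num.sqrt cl in
  let B := (2 / eps + b) / (Num.sqrt cl / (2 * K)) ^+ 2 in
  let C := 2 / Num.sqrt cl * (1 + 2 * (K * Num.sqrt B + Num.sqrt Cu)) in
  exists y, [/\ adm y, 0 <= dotv y u & S * nrm u <= C * (nrm (X *m u) + dotv y u)].
Proof.
move=> K B C.
have cu0 : 0 < Num.sqrt Cu by rewrite sqrtr_gt0.
have cl0' : 0 < Num.sqrt cl by rewrite sqrtr_gt0.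
have K0 : 0 < K by rewrite addr_gt0.
have k0 : 0 < Num.sqrt cl / (2 * K) by rewrite divr_gt0// mulr_gt0.
set k := Num.sqrt cl / (2 * K) in k0 B C *.
have kK : k * K = Num.sqrt cl / 2 by rewrite /k; field; rewrite gt_eqF.
have k1 : k <= 1.
  by rewrite ler_pdivrMr ?mulr_gt0// mul1r /K; lra.
have e2 : 0 < 2 / eps by rewrite divr_gt0.
have B0 : 0 < B by rewrite divr_gt0 ?addr_gt0// exprn_gt0.
have sB0 : 0 <= Num.sqrt B by exact: sqrtr_ge0.
have BN : Num.sqrt (B / N%:R) = Num.sqrt B / S by rewrite sqrtrM ?ltW// sqrtrV ?ltW.
have final (L : R) y : 0 <= L -> L <= 2 * dotv y u ->
   Num.sqrt cl / 2 * (S * nrm u) <= nrm (X *m u) + (K * Num.sqrt B + Num.sqrt Cu) * L ->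
   0 <= dotv y u /\ S * nrm u <= C * (nrm (X *m u) + dotv y u).
  move=> L0 Ly h; have d0 : 0 <= dotv y u by lra.
  split=> //.
  have -> : S * nrm u = 2 / Num.sqrt cl * (Num.sqrt cl / 2 * (S * nrm u)).
    by field; rewrite gt_eqF.
  rewrite /C -[leRHS]mulrA ler_wpM2l ?divr_ge0 ?(ltW cl0')//; apply: le_trans h _.
  set A := K * Num.sqrt B + Num.sqrt Cu.
  have A0 : 0 <= A by rewrite /A addr_ge0 ?mulr_ge0 ?(ltW K0) ?(ltW cu0).
  have n0 := nrm_ge0 (X *m u).
  have : 0 <= A * (2 * dotv y u - L) by rewrite mulr_ge0// subr_ge0.
  have : 0 <= A * nrm (X *m u) by rewrite mulr_ge0.
  lra.
(* If the isometry does not even cover level 1, then eps N < lgp 1 <= m lgp m for every m, and all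
   of [u] is treated as a remainder with [T = 0]. *)
have [l1|l1] := leP (lgp R p 1) (eps * N%:R); last first.
  have [pi upi] := sorts_exists u.
  have TB m : (0 < m <= p)%N -> 0 < m%:R :> R -> N%:R <= B * (m%:R * lgp R p m).
    move=> mp _.
    have h : lgp R p 1 <= m%:R * lgp R p m.
      case/andP: mp => m0 mp.
      by have := @mul_lgp_homo R p p0 1 m; rewrite mul1r m0; apply.
    apply: (@le_trans _ _ (eps^-1 * (m%:R * lgp R p m))).
      by rewrite ler_pdivlMl//; lra.
    apply: ler_wpM2r.
      by rewrite (le_trans _ h)// (le_trans _ (ltW l1))// mulr_ge0// ltW.
    apply: (@le_trans _ _ (2 / eps + b)); first by have := ltW b0; lra.
    by rewrite /B ler_pdivlMr ?exprn_gt0// ler_piMr ?addr_ge0 ?(ltW e2) ?(ltW b0)// exprn_ile1// ltW.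
  have [h0 _] := @layer_remainder u pi (nrm u) 0 B upi (nrm_ge0 _) (lexx _) (ltW B0)
    (absv_le_nrm u) TB.
  have [y [ay Ly]] := slope_dominated p0 pi (fun i => lexx (absv u i)).
  exists y; have L0 : 0 <= layer_norm u pi.
    by apply: sumr_ge0 => m _; rewrite mulr_ge0 ?sorts_anti ?phi_ge0.
  suff /(final _ y L0 (le_trans (layer_norm_le_slope p0 u pi) Ly)) [d0 dS] :
    Num.sqrt cl / 2 * (S * nrm u) <= nrm (X *m u) +
      (K * Num.sqrt B + Num.sqrt Cu) * layer_norm u pi by split.
  move: h0; rewrite sqrtr0 mulr0 add0r BN mulrAC ler_pdivlMr// => h0.
  have n0 := nrm_ge0 (X *m u).
  have h1 : Num.sqrt cl / 2 * (S * nrm u) <= K * (S * nrm u).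
    by rewrite ler_wpM2r ?mulr_ge0 ?nrm_ge0 ?(ltW S0)// /K; lra.
  have h2 : K * (nrm u * S) <= K * (Num.sqrt B * layer_norm u pi).
    by rewrite ler_wpM2l ?(ltW K0).
  have h3 : 0 <= Num.sqrt Cu * layer_norm u pi by rewrite mulr_ge0// ltW.
  lra.
have [u0|u0] := eqVneq (nrm u) 0.
  exists 0; split.
  - by move=> J; rewrite big1 ?phi_ge0// => i _; rewrite mxE normr0.
  - by rewrite dotvC dotv0r.
  - rewrite u0 mulr0 dotvC dotv0r addr0 mulr_ge0 ?nrm_ge0//.
    by rewrite /C !(mulr_ge0, addr_ge0)// ?invr_ge0// ltW.
have un0 : 0 < nrm u by rewrite lt_def u0 nrm_ge0.
have [n [np nl TB]] := isometry_level l1.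
have [n0 np'] := andP np.
have n0R : 0 < n%:R :> R by rewrite ltr0n.
have sn0 : 0 < Num.sqrt n%:R :> R by rewrite sqrtr_gt0.
have [h hE] : exists h, h = nrm u / Num.sqrt n%:R by eexists.
have h0 : 0 < h by rewrite hE divr_gt0.
pose t i := Num.truncn (absv u i / h).
have tle i : h * (t i)%:R <= absv u i.
  rewrite mulrC -ler_pdivlMr// /t truncn_le.
  by rewrite divr_ge0 ?absv_ge0 ?(ltW h0).
have tlt i : absv u i < h * (t i)%:R + h.
  rewrite -[X in _ + X]mulr1 -mulrDr natr1 mulrC -ltr_pdivrMr//.
  by rewrite truncnS_gt.
pose a i : int := (-1) ^+ (u i 0 < 0)%R * Posz (t i).
have absa i : absz (a i) = t i by rewrite /a abszMsign.
(* Natural numbers satisfy t <= t^2, so the l1 norm of the rounded vector is at most |u|^2/h^2 =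
   n. *)
have st : (\sum_i t i <= n)%N.
  rewrite -(ler_nat R) natr_sum.
  have -> : n%:R = (h ^+ 2)^-1 * sqnorm2 u.
    rewrite hE expr_div_n (sqr_sqrtr (ltW n0R)) sqr_nrm invf_div.
    by rewrite mulfVK// -sqr_nrm expf_neq0.
  rewrite ler_pdivlMl ?exprn_gt0// mulr_sumr; apply: ler_sum => i _.
  rewrite -expr2; apply: (@le_trans _ _ ((h * (t i)%:R) ^+ 2)).
    rewrite [leRHS]exprMn ler_wpM2l ?sqr_ge0// -natrX ler_nat.
    by case: (t i) => // k'; rewrite leq_pmull.
  rewrite -[leRHS]real_normK ?num_real// lerXn2r ?nnegrE ?tle ?normr_ge0//.
  by rewrite mulr_ge0// ltW.
have [|z zE] := @zvec_of_int p a.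
  by under eq_bigr => i _ do rewrite absa; rewrite (leq_trans st).
have zl : zl1 z = (\sum_i t i)%N.
  by apply: eq_bigr => i _; rewrite zE absa.
have zv i : zval R z i 0 = sgnv u i * (t i)%:R.
  by rewrite mxE zE /a rmorphM/= rmorph_sign.
pose e := u - h *: zval R z.
have eE i : absv e i = absv u i - h * (t i)%:R.
  rewrite /absv !mxE -/(zval R z i 0).
  have -> : (zcoord (z i))%:~R = sgnv u i * (t i)%:R :> R by rewrite -zv mxE.
  rewrite mulrCA (sgnv_abs u i) -mulrBr !normrM normr_sgnv !mul1r.
  by rewrite ger0_norm ?subr_ge0// [X in _ = X - _]ger0_norm ?absv_ge0.
have [pi epi] := sorts_exists e.
have k2 : 0 < k ^+ 2 <= 1 by rewrite exprn_gt0// exprn_ile1// ltW.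
have eh i : absv e i <= h by rewrite eE; have := tlt i; lra.
have eu i : absv e i <= absv u i.
  by rewrite eE gerBl mulr_ge0// ltW.
have TB' m : (0 < m <= p)%N -> k ^+ 2 * n%:R < m%:R ->
   N%:R <= B * (m%:R * lgp R p m).
  by move=> mp; exact: TB.
have T0 : 0 <= k ^+ 2 * n%:R by rewrite mulr_ge0// ltW//; case/andP: k2.
have [re rXe] := layer_remainder epi (ltW h0) T0 (ltW B0) eh TB'.
have hT : h * Num.sqrt (k ^+ 2 * n%:R) = k * nrm u.
  rewrite sqrtrM ?sqr_ge0// sqrtr_sqr gtr0_norm// hE mulrCA divfK ?gt_eqF//.
rewrite hT BN in re rXe.
set L := layer_norm e pi in re rXe.
have L0 : 0 <= L.
  by apply: sumr_ge0 => m _; rewrite mulr_ge0 ?sorts_anti ?phi_ge0.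
have [y [ay Ly]] := slope_dominated p0 pi eu.
exists y.
suff /(final _ y L0 (le_trans (layer_norm_le_slope p0 e pi) Ly)) [d0 dS] :
    Num.sqrt cl / 2 * (S * nrm u) <= nrm (X *m u) +
      (K * Num.sqrt B + Num.sqrt Cu) * L by split.
have uE : u = h *: zval R z + e by rewrite /e addrC subrK.
have hz : Num.sqrt cl * S * (h * nrm (zval R z)) <= nrm (X *m (h *: zval R z)).
  rewrite -scalemxAr nrmZ gtr0_norm// mulrCA ler_wpM2l ?(ltW h0)//.
  have [z0|z0] := posnP (zl1 z).
    have -> : zval R z = 0.
      apply/colP => i; rewrite mxE [RHS]mxE; move/eqP: z0.
      rewrite sum_nat_eq0 => /forallP/(_ i)/=; rewrite absz_eq0 => /eqP ->.
      by rewrite mulr0z.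
    by rewrite mulmx0 !nrm0 mulr0.
  have zp : (zl1 z <= n)%N by rewrite zl.
  rewrite /S -sqrtrM ?(ltW cl0)// /nrm -sqrtrM ?mulr_ge0 ?(ltW cl0)//.
  rewrite ler_wsqrtr// Xlow// ?z0 ?(leq_trans zp)//.
  by apply: le_trans nl; apply: mul_lgp_homo; rewrite // z0.
have h1 : nrm u <= h * nrm (zval R z) + nrm e.
  by rewrite {1}uE; apply: le_trans (nrmD _ _) _; rewrite nrmZ gtr0_norm.
have h2 : nrm (X *m (h *: zval R z)) <= nrm (X *m u) + nrm (X *m e).
  have -> : X *m (h *: zval R z) = X *m u - X *m e.
    by rewrite -mulmxBr /e opprB addrC subrK.
  by apply: le_trans (nrmD _ _) _; rewrite /nrm sqnorm2N.
have cS : 0 < Num.sqrt cl * S by rewrite mulr_gt0.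
have h3 : Num.sqrt cl * S * nrm u <=
   nrm (X *m u) + nrm (X *m e) + Num.sqrt cl * S * nrm e.
  have := ler_wpM2l (ltW cS) h1; lra.
have h4 : Num.sqrt cl * S * nrm e <=
   Num.sqrt cl * (k * (S * nrm u) + Num.sqrt B * L).
  have := ler_wpM2l (ltW cS) re; move=> /le_trans; apply.
  rewrite le_eqVlt; apply/orP; left; apply/eqP; field; rewrite gt_eqF//.
have h5 : nrm (X *m e) <= Num.sqrt Cu * (k * (S * nrm u) + Num.sqrt B * L + L).
  apply: le_trans rXe _.
  rewrite le_eqVlt; apply/orP; left; apply/eqP; field; rewrite gt_eqF//.
have h6 : K * (k * (S * nrm u)) = Num.sqrt cl / 2 * (S * nrm u) by rewrite -kK; ring.
rewrite /K in h6 *; lra.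
Qed.

End quadratic_lower_bound.

(** * Integrals of independent products *)

Section integral_weighted.
Local Open Scope ereal_scope.
Context d1 d2 (T1 : measurableType d1) (T2 : measurableType d2) (R : realType).
Variables (mu : {measure set T1 -> \bar R}) (nu : {measure set T2 -> \bar R}).
Variables (W : T1 -> R) (Z : T1 -> T2).
Hypotheses (W0 : forall x, (0 <= W x)%R) (mW : measurable_fun setT W).
Hypothesis mZ : measurable_fun setT Z.
Hypothesis WZ : forall B, measurable B ->
  \int[mu]_x (W x * \1_B (Z x))%:E = nu B.

Import HBNNSimple.

Let nnsfun_case (h : {nnsfun T2 >-> R}) :
  \int[mu]_x ((W x)%:E * (h (Z x))%:E) = \int[nu]_x (h x)%:E.
Proof.
under [RHS]eq_integral do rewrite fimfunE -fsumEFin//.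
rewrite [RHS]ge0_integral_fsum//; last 2 first.
  - by move=> r; exact/measurable_EFinP/measurableT_comp.
  - by move=> n x _; rewrite EFinM nnfun_muleindic_ge0.
under [LHS]eq_integral.
  move=> x xD; rewrite fimfunE -fsumEFin// ge0_mule_fsumr; last first.
    by move=> r; rewrite EFinM nnfun_muleindic_ge0.
  over.
have mi r : measurable_fun setT (fun x => \1_(h @^-1` [set r]) (Z x) : R).
  by apply: measurableT_comp => //; exact: measurable_indic.
rewrite [LHS]ge0_integral_fsum//; last 2 first.
  - move=> r; apply: emeasurable_funM; first exact/measurable_EFinP.
    by apply/measurable_EFinP; apply: measurable_funM.
  - move=> n x _; apply: mule_ge0; first by rewrite lee_fin.
    by rewrite EFinM nnfun_muleindic_ge0.
apply: eq_fsbigr => r rh.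
have r0 : (0 <= r)%R by move: rh; rewrite inE => -[t _ <-].
under [RHS]eq_integral do rewrite EFinM.
transitivity (\int[mu]_x (r%:E * (W x * \1_(h @^-1` [set r]) (Z x))%:E)).
  by apply: eq_integral => x _; rewrite !EFinM muleCA.
rewrite integralZl_indic_nnsfun// integral_indic// setIT.
rewrite ge0_integralZl//.
- by rewrite WZ.
- by apply/measurable_EFinP; apply: measurable_funM.
- by move=> x _; rewrite lee_fin mulr_ge0.
Qed.

(** Simple functions and monotone convergence. The weight [W] is a density, with [Z] the identity,
    in [ge0_integral_std_normal], and a product of the other independent factors in
    [integral_prod_independent]. *)
Lemma ge0_integral_weighted (f : T2 -> \bar R) : measurable_fun setT f ->
  (forall y, 0 <= f y) -> \int[mu]_x ((W x)%:E * f (Z x)) = \int[nu]_y f y.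
Proof.
move=> mf f0; pose h := nnsfun_approx measurableT mf.
have hE y : f y = limn (fun n => (h n y)%:E).
  by apply/esym/cvg_lim => //; exact: cvg_nnsfun_approx.
transitivity (limn (fun n => \int[nu]_x (h n x)%:E)); last first.
  rewrite -monotone_convergence//.
  - by apply: eq_integral => y _; rewrite hE.
  - by move=> n; exact/measurable_EFinP.
  - by move=> n y _; rewrite lee_fin.
  - by move=> y _ a b ab; rewrite lee_fin; exact/lefP/nd_nnsfun_approx.
have -> : (fun n => \int[nu]_x (h n x)%:E) =
    (fun n => \int[mu]_x ((W x)%:E * (h n (Z x))%:E)).
  by apply/funext => n; exact/esym/nnsfun_case.
rewrite -monotone_convergence//.
- apply: eq_integral => x _; apply/esym/cvg_lim => //.
  by apply: cvgeZl => //; exact: cvg_nnsfun_approx.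
- move=> n; apply: emeasurable_funM; first exact/measurable_EFinP.
  by apply/measurable_EFinP; exact: measurableT_comp.
- by move=> n x _; rewrite mule_ge0 ?lee_fin.
- move=> x _ a b ab; rewrite lee_wpmul2l ?lee_fin//.
  exact/lefP/nd_nnsfun_approx.
Qed.

End integral_weighted.

Section independence.
Local Open Scope ereal_scope.
Context d d' (T : measurableType d) (U : measurableType d') (R : realType).
Variables (P : probability T R) (I : finType) (Z : I -> T -> U).
Hypothesis mZ : forall i, measurable_fun setT (Z i).
Hypothesis indepZ : mutually_independent P Z.

Lemma integral_prod_independent (h : I -> U -> R) :
  (forall i u, (0 <= h i u)%R) -> (forall i, measurable_fun setT (h i)) ->
  (forall i, \int[P]_w (h i (Z i w))%:E < +oo) ->
  \int[P]_w (\prod_i h i (Z i w))%:E = \prod_i \int[P]_w (h i (Z i w))%:E.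
Proof.
move=> h0 mh hfin.
(* For indicators the claim is the definition of independence; they are turned into the [h i] one at
   a time, [S] being the set of indices already turned. In each step the other factors form the
   weight [W] of [ge0_integral_weighted], and the target measure is a multiple of the law of
   [Z i0]. *)
suff H n : forall (S : {set I}) (A : I -> set U) (g : I -> U -> R), (#|S| <= n)%N ->
    (forall i, measurable (A i)) ->
    (forall i, i \notin S -> g i = \1_(A i)) -> (forall i, i \in S -> g i = h i) ->
    \int[P]_w (\prod_i g i (Z i w))%:E = \prod_i \int[P]_w (g i (Z i w))%:E.
  apply: (H #|I| [set: I]%SET (fun=> setT)) => //.
    by rewrite cardsT.
  by move=> i; rewrite inE.
have mZB i B : measurable B -> measurable (Z i @^-1` B).
  by move=> mB; rewrite -[_ @^-1` _]setTI; exact: mZ.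
elim: n => [|n IH] S A g Sn mA gA gS.
  have gE i : g i = \1_(A i).
    by apply: gA; move: Sn; rewrite leqn0 cards_eq0 => /eqP ->; rewrite inE.
  have e1 w : (\prod_i g i (Z i w))%R =
      \1_(\bigcap_(i in [set` [set: I]%SET]) (Z i @^-1` A i)) w :> R.
    rewrite indicE; have [wA|wA] := boolP (w \in _).
      rewrite big1// => i _; rewrite gE indicE mem_set//.
      by move: wA; rewrite inE => /(_ i); apply; rewrite /= inE.
    have [i iA] : exists i, ~ A i (Z i w).
      apply/existsNP => H; move/negP: wA; apply; rewrite inE => i _; exact: H.
    by rewrite (bigD1 i)//= gE indicE memNset// mul0r.
  under eq_integral do rewrite e1.
  rewrite integral_indic//; last first.
    by apply: fin_bigcap_measurable => // i _; exact: mZB.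
  rewrite setIT; apply: (eq_trans (indepZ [set: I]%SET mA)).
  rewrite big_mkcond/=; apply: eq_bigr => i _; rewrite inE.
  transitivity (\int[P]_w (\1_(Z i @^-1` A i) w)%:E).
    by rewrite integral_indic ?setIT//; exact: mZB.
  by apply: eq_integral => w _; rewrite gE.
have [S0|/set0Pn[i0 i0S]] := eqVneq S finset.set0.
  by apply: (IH S A) => //; rewrite S0 cards0.
have g0 i u : (0 <= g i u)%R.
  by have [/gS ->//|/gA ->] := boolP (i \in S).
have mg i : measurable_fun setT (g i).
  by have [/gS ->//|/gA ->] := boolP (i \in S); exact: measurable_indic.
have gfin i : \int[P]_w (g i (Z i w))%:E \is a fin_num.
  rewrite ge0_fin_numE; last by apply: integral_ge0 => w _; rewrite lee_fin.
  have [/gS ->//|/gA ->] := boolP (i \in S).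
  apply: (@le_lt_trans _ _ (P (Z i @^-1` A i))).
    by rewrite -[X in P X]setIT -integral_indic//; exact: mZB.
  by rewrite (le_lt_trans (probability_le1 P _)) ?ltry//; exact: mZB.
pose W w := (\prod_(i | i != i0) g i (Z i w))%R.
pose c : R := (\prod_(i | i != i0) fine (\int[P]_w (g i (Z i w))%:E))%R.
have c0 : (0 <= c)%R.
  by apply: prodr_ge0 => i _; apply: fine_ge0; apply: integral_ge0 => w _; rewrite lee_fin.
have cE : \prod_(i | i != i0) \int[P]_w (g i (Z i w))%:E = c%:E.
  by rewrite /c -prodEFin; apply: eq_bigr => i _; rewrite fineK.
have W0 w : (0 <= W w)%R by apply: prodr_ge0.
have mW : measurable_fun setT W.
  rewrite /W; under eq_fun do rewrite -big_filter.
  by apply: measurable_prod => i _; exact: measurableT_comp.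
have mgZ i : measurable_fun setT (fun w => g i (Z i w)) by exact: measurableT_comp.
pose mfZ : {mfun T >-> U} := HB.pack (Z i0) (isMeasurableFun.Build _ _ _ _ (Z i0) (mZ i0)).
under eq_integral do rewrite (bigD1 i0)//= -/(W _) mulrC EFinM.
rewrite (@ge0_integral_weighted _ _ _ _ _ P (mscale (NngNum c0) (distribution P mfZ)) W
  (Z i0) W0 mW (mZ i0) _ (fun u => (g i0 u)%:E)).
- rewrite ge0_integral_mscale//; last 2 first.
    exact/measurable_EFinP.
    by move=> x _; rewrite lee_fin.
  rewrite ge0_integral_distribution; [|exact/measurable_EFinP|by move=> y; rewrite lee_fin].
  by rewrite (bigD1 i0)//= cE muleC.
- move=> B mB; pose g' i := if i == i0 then \1_B : U -> R else g i.
  pose A' i := if i == i0 then B else A i.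
  have := IH (S :\ i0) A' g'.
  have -> : (#|(S :\ i0)%SET| <= n)%N by move: Sn; rewrite (cardsD1 i0) i0S.
  move=> /(_ isT); have mA' i : measurable (A' i) by rewrite /A'; case: ifP.
  move=> /(_ mA'); rewrite /g' /A' => H.
  under eq_integral.
    move=> w _; rewrite (_ : (W w * \1_B (Z i0 w))%R =
      (\prod_i (if i == i0 then \1_B else g i) (Z i w))%R); last first.
      rewrite (bigD1 i0)//= eqxx mulrC; congr (_ * _)%R.
      by apply: eq_bigr => i /negbTE ->.
    over.
  rewrite H; first last.
  + by move=> i; rewrite !inE => /andP[/negbTE -> iS]; exact: gS.
  + move=> i; rewrite !inE negb_and negbK; case: eqP => //= _ iS; exact: gA.
  rewrite (bigD1 i0)//= eqxx /mscale/= muleC; congr (_ * _).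
    by rewrite -cE; apply: eq_bigr => i /negbTE ->.
  transitivity (\int[P]_w (\1_(Z i0 @^-1` B) w)%:E); first exact: eq_integral.
  by rewrite integral_indic ?setIT//; exact: mZB.
- exact/measurable_EFinP.
- by move=> y; rewrite lee_fin.
Qed.

Lemma integral_prod_independent_le (h : I -> U -> R) (c : I -> R) :
  (forall i u, (0 <= h i u)%R) -> (forall i, measurable_fun setT (h i)) ->
  (forall i, \int[P]_w (h i (Z i w))%:E <= (c i)%:E) ->
  \int[P]_w (\prod_i h i (Z i w))%:E <= (\prod_i c i)%:E.
Proof.
move=> h0 mh hc; rewrite integral_prod_independent//; last first.
  by move=> i; rewrite (le_lt_trans (hc i))// ltry.
have hi0 i : 0 <= \int[P]_w (h i (Z i w))%:E.
  by apply: integral_ge0 => w _; rewrite lee_fin.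
have hE i : \int[P]_w (h i (Z i w))%:E = (fine (\int[P]_w (h i (Z i w))%:E))%:E.
  by rewrite fineK// ge0_fin_numE// (le_lt_trans (hc i))// ltry.
rewrite (eq_bigr (fun i => (fine (\int[P]_w (h i (Z i w))%:E))%:E)); last first.
  by move=> i _; exact: hE.
rewrite prodEFin lee_fin; apply: ler_prod => i _.
by rewrite fine_ge0//= -lee_fin -hE.
Qed.

End independence.

(** * Gaussian measures *)

Section standard_normal.
Local Open Scope ereal_scope.
Variable R : realType.
Local Notation leb := (@lebesgue_measure R).
Local Notation gam := (normal_prob 0%R 1%R : probability (measurableTypeR R) R).
Local Notation pdf := (normal_pdf (0%R : R) 1%R).

Let one0 : (1 : R)%R != 0%R. Proof. exact: oner_neq0. Qed.

Lemma std_normal_pdfE (x : R) :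
  pdf x = (normal_peak 1 * expR (- (x ^+ 2 / 2)))%R.
Proof.
rewrite normal_pdfE// /normal_fun subr0 expr1n mulNr.
by rewrite -[in X in (_ / X)%R](mulr_natl 1) mulr1.
Qed.

Lemma ge0_integral_std_normal (f : R -> \bar R) : measurable_fun setT f ->
  (forall x, 0 <= f x) -> \int[gam]_x f x = \int[leb]_x ((pdf x)%:E * f x).
Proof.
move=> mf f0; apply/esym.
apply: (@ge0_integral_weighted _ _ _ _ R leb gam pdf idfun) => //.
- by move=> x; exact: normal_pdf_ge0.
- exact: measurable_normal_pdf.
- exact: measurable_id.
- move=> B mB; rewrite /= /normal_prob [RHS]integral_mkcond.
  apply: eq_integral => x _; rewrite patchE indicE; case: ifP => xB.
    by rewrite mulr1.
  by rewrite mulr0.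
Qed.

Lemma lebesgue_measure_translation (a : R) (A : set R) : measurable A ->
  pushforward leb ((fun x => x + a)%R : _ -> measurableTypeR R) A = leb A.
Proof.
move=> mA.
have mF : measurable_fun setT ((fun x => x + a)%R : R -> measurableTypeR R).
  exact: measurable_funD.
apply/esym/lebesgue_measure_unique => //= _ [[b c]] _ <-.
rewrite /pushforward.
have -> : (fun x : R => x + a)%R @^-1` `]b, c] = `](b - a)%R, (c - a)%R]%classic.
  by apply/seteqP; split=> x /=; rewrite !in_itv/= ltrBlDr lerBrDr.
rewrite !lebesgue_measure_itv/= !lte_fin ltrD2r.
by case: ifP => // _; rewrite -!EFinD; congr EFin; ring.
Qed.

(** The Cameron-Martin formula in dimension one: Lebesgue measure is translation invariant and the
    densities at x - a and x have ratio exp(a x - a^2/2). *)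
Lemma std_normal_shift (a : R) (f : R -> \bar R) : measurable_fun setT f ->
  (forall x, 0 <= f x) ->
  \int[gam]_x f (x + a)%R = \int[gam]_x (f x * (expR (a * x - a ^+ 2 / 2))%:E).
Proof.
move=> mf f0.
have mF : measurable_fun setT ((fun x => x + a)%R : R -> measurableTypeR R).
  exact: measurable_funD.
have mE : measurable_fun setT (fun x : R => expR (a * x - a ^+ 2 / 2)).
  by apply: measurableT_comp => //; apply: measurable_funB => //.
have mfa : measurable_fun setT (fun x : R => f (x + a)%R) by exact: measurableT_comp mF.
have mfe : measurable_fun setT (fun x : R => f x * (expR (a * x - a ^+ 2 / 2))%:E).
  by apply: emeasurable_funM => //; exact/measurable_EFinP.
have fe0 x : 0 <= f x * (expR (a * x - a ^+ 2 / 2))%:E.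
  by rewrite mule_ge0// lee_fin expR_ge0.
rewrite (ge0_integral_std_normal mfe fe0) (ge0_integral_std_normal mfa)//.
pose g x := (pdf (x - a)%R)%:E * f x.
have mg : measurable_fun setT g.
  apply: emeasurable_funM => //; apply/measurable_EFinP.
  apply: measurableT_comp; first exact: measurable_normal_pdf.
  exact: measurable_funB.
have g0 x : 0 <= g x by rewrite mule_ge0// lee_fin normal_pdf_ge0.
transitivity (\int[leb]_x g (x + a)%R).
  by apply: eq_integral => x _; rewrite /g addrK.
transitivity (\int[pushforward leb ((fun x => x + a)%R : _ -> measurableTypeR R)]_x g x).
  by rewrite ge0_integral_pushforward.
rewrite (@eq_measure_integral _ _ _ _ leb); last first.
  by move=> A mA _; exact: lebesgue_measure_translation.
apply: eq_integral => x _; rewrite /g [X in _ = _ * X]muleC muleA; congr (_ * _).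
rewrite -EFinM !std_normal_pdfE; congr EFin.
by rewrite -[RHS]mulrA -expRD; congr (_ * expR _)%R; field.
Qed.

Lemma std_normal_opp (f : R -> \bar R) : measurable_fun setT f ->
  (forall x, 0 <= f x) -> \int[gam]_x f (- x)%R = \int[gam]_x f x.
Proof.
move=> mf f0.
have mN : measurable_fun setT (-%R : R -> measurableTypeR R) by exact: oppr_measurable.
rewrite !ge0_integral_std_normal//; last exact: (measurableT_comp mf mN).
pose g x := (pdf x)%:E * f x.
have mg : measurable_fun setT g.
  apply: emeasurable_funM => //; apply/measurable_EFinP; exact: measurable_normal_pdf.
have g0 x : 0 <= g x by rewrite mule_ge0// lee_fin normal_pdf_ge0.
transitivity (\int[leb]_x g (- x)%R).
  by apply: eq_integral => x _; rewrite /g !std_normal_pdfE sqrrN.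
transitivity (\int[pushforward leb (-%R : _ -> measurableTypeR R)]_x g x).
  by rewrite ge0_integral_pushforward.
by apply: eq_measure_integral => A mA _; exact: lebesgue_measureN.
Qed.

(** The integrand times the normal density is sqrt 2 times the density of N(0,2), so the integral is
    sqrt 2. The constant 4 is what gives noise of standard deviation tau a psi_2 norm of at most 2
    tau. *)
Lemma std_normal_expR_sqr :
  \int[gam]_x (expR (x ^+ 2 / 4))%:E <= (expR 1)%:E.
Proof.
have mE : measurable_fun setT (fun x : R => (expR (x ^+ 2 / 4))%:E).
  apply/measurable_EFinP; apply: measurableT_comp => //.
  by apply: measurable_funM => //; exact: measurable_funX.
rewrite ge0_integral_std_normal//.
pose s : R := Num.sqrt 2.
have s2 : (s ^+ 2 = 2)%R by rewrite sqr_sqrtr.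
have s0 : (0 < s)%R by rewrite sqrtr_gt0.
have pk : (normal_peak 1 = s * normal_peak s :> R)%R.
  rewrite /normal_peak s2 expr1n mul1r -[X in (_ / Num.sqrt X)%R]mulrnAr.
  rewrite sqrtrM// invfM mulrA divff ?mul1r// gt_eqF//.
have -> : \int[leb]_x ((pdf x)%:E * (expR (x ^+ 2 / 4))%:E) =
    \int[leb]_x (s%:E * (normal_pdf 0%R s x)%:E).
  apply: eq_integral => x _; rewrite -!EFinM std_normal_pdfE normal_pdfE ?gt_eqF//.
  rewrite mulrA -pk -mulrA -expRD /normal_fun s2 subr0; congr (_ * expR _)%:E.
  by rewrite mulNr -mulr_natl; field.
rewrite ge0_integralZl//=; last 3 first.
- by apply/measurable_EFinP; exact: measurable_normal_pdf.
- by move=> x _; rewrite lee_fin normal_pdf_ge0.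
- by rewrite lee_fin ltW.
rewrite integral_normal_pdf mule1 lee_fin.
have := expR_ge1Dx (1%R : R); nra.
Qed.

(** Only [t, t+1] is integrated, where x^2/2 <= t^2 + 1. At t = [slp k] the exponent t^2 gives
    exp(-lgp k) = k/(ep), the proportion of coordinates wanted in [tail_prob_ge]. *)
Lemma std_normal_tail (t : R) : (0 <= t)%R ->
  (normal_peak 1 * expR (- 1) * expR (- t ^+ 2))%:E <= gam [set x | (t <= `|x|)%R].
Proof.
move=> t0.
have mI : measurable (`[t, (t + 1)%R]%classic : set R) by [].
have h : gam (`[t, (t + 1)%R]%classic : set R) <= gam [set x | (t <= `|x|)%R].
  apply: le_measure; rewrite ?inE//.
    have -> : [set x | (t <= `|x|)%R] = (@Num.norm R R : R -> R) @^-1` `[t, +oo[.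
      by apply/seteqP; split=> x /=; rewrite in_itv/= andbT.
    rewrite -[X in measurable X]setTI; exact: normr_measurable.
  by move=> x /=; rewrite in_itv/= => /andP[tx _]; rewrite (le_trans tx)// ler_norm.
apply: le_trans h; rewrite /= /normal_prob.
apply: (@le_trans _ _ (\int[leb]_(x in `[t, (t + 1)%R])
   (cst (normal_peak 1 * expR (- 1) * expR (- t ^+ 2))%R%:E x))).
  rewrite integral_cst//= lebesgue_measure_itv/= lte_fin ltrDl ltr01.
  by rewrite -EFinD addrAC subrr add0r mule1.
apply: ge0_le_integral => //.
- by move=> x _; rewrite lee_fin !mulr_ge0 ?normal_peak_ge0 ?expR_ge0.
- by apply/measurable_EFinP/measurable_funTS; exact: measurable_normal_pdf.
- move=> x /=; rewrite in_itv/= => /andP[tx xt1].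
  rewrite lee_fin std_normal_pdfE -mulrA -expRD ler_wpM2l ?normal_peak_ge0//.
  rewrite ler_expR.
  have : (x ^+ 2 <= (t + 1) ^+ 2)%R.
    by rewrite lerXn2r// nnegrE; lra.
  have := sqr_ge0 (t - 1)%R; nra.
Qed.

End standard_normal.

(** * Measurability of matrix operations *)

Section measurable_matrix_operations.
Context d (T : measurableType d) (R : realType).

Lemma measurable_mxD m n (f g : T -> 'M[R]_(m, n)) :
  measurable_fun setT f -> measurable_fun setT g ->
  measurable_fun setT (fun t => f t + g t).
Proof.
move=> /measurable_fun_mxP mf /measurable_fun_mxP mg; apply/measurable_fun_mxP => i j.
by under eq_fun do rewrite mxE; exact: measurable_funD.
Qed.

Lemma measurable_mulmx m n q (f : T -> 'M[R]_(m, n)) (g : T -> 'M[R]_(n, q)) :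
  measurable_fun setT f -> measurable_fun setT g ->
  measurable_fun setT (fun t => f t *m g t).
Proof.
move=> /measurable_fun_mxP mf /measurable_fun_mxP mg; apply/measurable_fun_mxP => i j.
under eq_fun do rewrite mxE.
by apply: measurable_sum => k; exact: measurable_funM.
Qed.

Lemma measurable_scalemx m n (c : R) (f : T -> 'M[R]_(m, n)) :
  measurable_fun setT f -> measurable_fun setT (fun t => c *: f t).
Proof.
move=> /measurable_fun_mxP mf; apply/measurable_fun_mxP => i j.
by under eq_fun do rewrite mxE; exact: measurable_funM.
Qed.

Lemma measurable_trmx m n (f : T -> 'M[R]_(m, n)) :
  measurable_fun setT f -> measurable_fun setT (fun t => (f t)^T).
Proof.
move=> /measurable_fun_mxP mf; apply/measurable_fun_mxP => i j.
by under eq_fun do rewrite mxE; exact: mf.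
Qed.

Lemma measurable_row m n (f : T -> 'M[R]_(m, n)) i :
  measurable_fun setT f -> measurable_fun setT (fun t => row i (f t)).
Proof.
move=> /measurable_fun_mxP mf; apply/measurable_fun_mxP => k j.
by under eq_fun do rewrite mxE; exact: mf.
Qed.

Lemma measurable_dotv n (f g : T -> 'cV[R]_n) :
  measurable_fun setT f -> measurable_fun setT g ->
  measurable_fun setT (fun t => dotv (f t) (g t)).
Proof.
move=> /measurable_fun_mxP mf /measurable_fun_mxP mg.
by apply: measurable_sum => k; exact: measurable_funM.
Qed.

Lemma measurable_sqnorm2 n (f : T -> 'cV[R]_n) :
  measurable_fun setT f -> measurable_fun setT (fun t => sqnorm2 (f t)).
Proof. by move=> mf; exact: measurable_dotv. Qed.

End measurable_matrix_operations.

(** * Gaussian vectors: shifts, exponential moments, coordinates *)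

Section gaussian_measure.
Variable R : realType.
Local Open Scope ereal_scope.
Local Notation gam := (normal_prob 0%R 1%R : probability (measurableTypeR R) R).

Lemma integral_std_gaussianS n (f : 'cV[R]_n.+1 -> \bar R) :
  measurable_fun setT f -> (forall z, 0 <= f z) ->
  \int[std_gaussian R n.+1]_z f z =
  \int[gam]_x \int[std_gaussian R n]_z f (cons_cV (x, z)).
Proof.
move=> mf f0; rewrite /= ge0_integral_distribution//.
rewrite -(@fubini_tonelli1 _ _ _ _ _ gam (std_gaussian R n) (fun z => f (cons_cV z)))//.
exact: measurableT_comp mf (@measurable_cons_cV R n).
Qed.

Lemma cons_cV0 n (x : R) (u : 'cV[R]_n) k : cons_cV (x, u) ord0 k = x.
Proof. by rewrite /cons_cV mxE; case: splitP => // j _; rewrite mxE. Qed.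

Lemma cons_cVS n (x : R) (u : 'cV[R]_n) i k : cons_cV (x, u) (lift ord0 i) k = u i k.
Proof.
rewrite /cons_cV mxE; case: splitP => j /=; first by rewrite ord1.
by rewrite /bump leq0n => -[] /val_inj ->.
Qed.

Lemma cons_cVK n (v : 'cV[R]_n.+1) : cons_cV (v ord0 ord0, \col_i v (lift ord0 i) ord0) = v.
Proof.
apply/colP => i; case: (unliftP ord0 i) => [j|] ->; first by rewrite cons_cVS mxE.
by rewrite cons_cV0.
Qed.

Lemma cons_cVD n (x y : R) (u v : 'cV[R]_n) :
  (cons_cV (x, u) + cons_cV (y, v) = cons_cV (x + y, u + v))%R.
Proof.
apply/colP => i; rewrite mxE; case: (unliftP ord0 i) => [j|] ->.
  by rewrite !cons_cVS mxE.
by rewrite !cons_cV0.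
Qed.

Lemma dotv_cons_cV n (x y : R) (u v : 'cV[R]_n) :
  (dotv (cons_cV (x, u)) (cons_cV (y, v)) = x * y + dotv u v)%R.
Proof.
rewrite /dotv big_ord_recl !cons_cV0; congr (_ + _)%R.
by apply: eq_bigr => i _; rewrite !cons_cVS.
Qed.

(** The Cameron-Martin formula for vectors, by induction on the dimension: Tonelli splits off the
    first coordinate, the induction hypothesis shifts the others, and [std_normal_shift] shifts the
    first. *)
Lemma std_gaussian_shift n (D : 'cV[R]_n) (f : 'cV[R]_n -> \bar R) :
  measurable_fun setT f -> (forall z, 0 <= f z) ->
  \int[std_gaussian R n]_z f (z + D)%R =
  \int[std_gaussian R n]_z (f z * (expR (dotv D z - sqnorm2 D / 2))%:E).
Proof.
elim: n D f => [|n IH] D f mf f0.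
  rewrite /=; apply: eq_integral => z _.
  rewrite (flatmx0 D) (flatmx0 z) /sqnorm2 /dotv !big_ord0 mul0r subrr expR0 mule1.
  by congr f; rewrite (flatmx0 (0 + 0)%R).
have mD k (E : 'cV[R]_k) : measurable_fun setT (fun z : 'cV[R]_k => (z + E)%R).
  by apply: measurable_mxD.
have mW k (E : 'cV[R]_k) (c : R) :
    measurable_fun setT (fun z : 'cV[R]_k => (expR (dotv E z - c))%:E).
  apply/measurable_EFinP; apply: measurableT_comp => //.
  by apply: measurable_funB => //; exact: measurable_dotv.
have W0 k (g : 'cV[R]_k -> \bar R) (E : 'cV[R]_k) c z : (forall z, 0 <= g z) ->
    0 <= g z * (expR (dotv E z - c))%:E.
  by move=> g0; rewrite mule_ge0// lee_fin expR_ge0.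
have mfD : measurable_fun setT (fun z : 'cV[R]_n.+1 => f (z + D)%R).
  exact: measurableT_comp mf (mD _ D).
have mfW : measurable_fun setT (fun z : 'cV[R]_n.+1 => f z * (expR (dotv D z - sqnorm2 D / 2))%:E).
  by apply: emeasurable_funM => //; exact: mW.
have fD0 (z : 'cV[R]_n.+1) : 0 <= f (z + D)%R by exact: f0.
have fW0 z : 0 <= f z * (expR (dotv D z - sqnorm2 D / 2))%:E by exact: W0.
rewrite (integral_std_gaussianS mfD fD0) (integral_std_gaussianS mfW fW0).
set D0 := D ord0 ord0; set D' := \col_i D (lift ord0 i) ord0.
have DE : D = cons_cV (D0, D') by rewrite cons_cVK.
have mc := @measurable_cons_cV R n.
have mcx x : measurable_fun setT (fun z => cons_cV (x, z) : 'cV[R]_n.+1).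
  exact: measurableT_comp mc (pair1_measurable x).
pose h x := \int[std_gaussian R n]_z
  (f (cons_cV (x, z)) * (expR (dotv D' z - sqnorm2 D' / 2))%:E).
have h0 x : 0 <= h x.
  by apply: integral_ge0 => z _; rewrite mule_ge0// lee_fin expR_ge0.
have mh : measurable_fun setT h.
  apply: (measurable_fun_fubini_tonelli_F (fun xz : measurableTypeR R * 'cV[R]_n =>
     f (cons_cV xz) * (expR (dotv D' xz.2 - sqnorm2 D' / 2))%:E)) => //.
  - apply: emeasurable_funM; first exact: measurableT_comp mf mc.
    exact: (measurableT_comp (mW _ D' (sqnorm2 D' / 2)%R) measurable_snd).
  - by move=> xz; rewrite mule_ge0// lee_fin expR_ge0.
transitivity (\int[gam]_x h (x + D0)%R).
  apply: eq_integral => x _; rewrite /h.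
  rewrite -(IH D' (fun z => f (cons_cV ((x + D0)%R, z)))).
  - by apply: eq_integral => z _; rewrite DE cons_cVD.
  - exact: measurableT_comp mf (mcx _).
  - by [].
apply: (eq_trans (std_normal_shift D0 mh h0)); apply: eq_integral => x _.
have mfw : measurable_fun setT (fun z : 'cV[R]_n =>
    f (cons_cV (x, z)) * (expR (dotv D' z - sqnorm2 D' / 2))%:E).
  by apply: emeasurable_funM; [exact: measurableT_comp mf (mcx _)|exact: mW].
have fw0 z : 0 <= f (cons_cV (x, z)) * (expR (dotv D' z - sqnorm2 D' / 2))%:E.
  by rewrite mule_ge0// lee_fin expR_ge0.
have e0 : 0 <= (expR (D0 * x - D0 ^+ 2 / 2))%:E by rewrite lee_fin expR_ge0.
rewrite /h -(@ge0_integralZr _ _ _ _ _ measurableT _ mfw _ (fun z _ => fw0 z) e0).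
apply: eq_integral => z _; rewrite -muleA -EFinM -expRD; congr (_ * (expR _)%:E).
by rewrite DE /sqnorm2 !dotv_cons_cV; field.
Qed.

(** The shift formula for the constant 1 says that exp(<D,z> - |D|^2/2) has integral 1. *)
Lemma std_gaussian_expR_dotv n (D : 'cV[R]_n) :
  \int[std_gaussian R n]_z (expR (dotv D z))%:E = (expR (sqnorm2 D / 2))%:E.
Proof.
have := @std_gaussian_shift n D (cst 1) (measurable_cst _) (fun _ => lee01).
rewrite integral_cst//= probability_setT mul1e => h.
have mw : measurable_fun setT (fun z : 'cV[R]_n => 1 * (expR (dotv D z - sqnorm2 D / 2))%:E).
  under eq_fun do rewrite mul1e.
  apply/measurable_EFinP; apply: measurableT_comp => //.
  by apply: measurable_funB => //; exact: measurable_dotv.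
have w0 z : setT z -> 0 <= 1 * (expR (dotv D z - sqnorm2 D / 2))%:E.
  by rewrite mul1e lee_fin expR_ge0.
have e0 : 0 <= (expR (sqnorm2 D / 2))%:E by rewrite lee_fin expR_ge0.
rewrite -[RHS]mule1 [X in _ * X]h -(@ge0_integralZl _ _ _ _ _ measurableT _ mw _ w0 e0).
apply: eq_integral => z _; rewrite mul1e -EFinM -expRD; congr (expR _)%:E; ring.
Qed.

Lemma measurable_coord n (i : 'I_n) (B : set R) : measurable B ->
  measurable [set z : 'cV[R]_n | B (z i ord0)].
Proof.
move=> mB; have := @measurable_mx_entry R n 1 i ord0 measurableT B mB.
by rewrite setTI.
Qed.

Lemma std_gaussian_box n (A : 'I_n -> set R) : (forall i, measurable (A i)) ->
  std_gaussian R n [set z | forall i, A i (z i ord0)] = \prod_i gam (A i).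
Proof.
elim: n A => [|n IH] A mA.
  by rewrite big_ord0 /= diracE mem_set// => -[].
rewrite big_ord_recl -IH//= /distribution /pushforward.
have -> : @cons_cV R n @^-1` [set z | forall i, A i (z i ord0)] =
    A ord0 `*` [set z : 'cV[R]_n | forall i, A (lift ord0 i) (z i ord0)].
  apply/seteqP; split=> -[x z] /=.
    move=> H; split; first by have := H ord0; rewrite cons_cV0.
    by move=> i; have := H (lift ord0 i); rewrite cons_cVS.
  by move=> [Ax Az] i; case: (unliftP ord0 i) => [j|] ->; rewrite ?cons_cVS ?cons_cV0.
rewrite product_measure1E//; first exact: mA.
have -> : [set z : 'cV[R]_n | forall i, A (lift ord0 i) (z i ord0)] =
    \bigcap_(i in [set: 'I_n]) [set z : 'cV[R]_n | A (lift ord0 i) (z i ord0)].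
  by apply/seteqP; split=> z /= H i; [move=> _; exact: H|exact: (H i Logic.I)].
by apply: fin_bigcap_measurable => // i _; exact: measurable_coord.
Qed.

Lemma std_gaussian_boxJ n (J : {set 'I_n}) (A : 'I_n -> set R) :
  (forall i, measurable (A i)) ->
  std_gaussian R n (\bigcap_(i in [set` J]) [set z | A i (z i ord0)]) =
  \prod_(i in J) gam (A i).
Proof.
move=> mA; have := @std_gaussian_box n (fun i => if i \in J then A i else setT).
move=> /(_ _) H; rewrite [RHS]big_mkcond/=.
have {}H := H (fun i => _).
rewrite (eq_bigr (fun i => gam (if i \in J then A i else setT))); last first.
  by move=> i _; case: ifP => // _; rewrite probability_setT.
rewrite -H; last by move=> i; case: ifP.
congr (std_gaussian R n _); apply/seteqP; split=> z /= h i.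
  by case: ifP => // iJ; exact: (h i iJ).
by move=> iJ; have := h i; rewrite iJ.
Qed.

Lemma std_gaussian_coord n (i : 'I_n) (B : set R) : measurable B ->
  std_gaussian R n [set z | B (z i ord0)] = gam B.
Proof.
move=> mB; have := @std_gaussian_boxJ n [set i]%SET (fun=> B) (fun=> mB).
rewrite big_set1 => <-; congr (std_gaussian R n _).
apply/seteqP; split=> z /= h.
  by move=> j; rewrite /= inE => /eqP ->.
by apply: (h i); rewrite /= inE.
Qed.

Lemma integral_std_gaussian_coord n (i : 'I_n) (f : R -> \bar R) :
  measurable_fun setT f -> (forall x, 0 <= f x) ->
  \int[std_gaussian R n]_z f (z i ord0) = \int[gam]_x f x.
Proof.
move=> mf f0.
have mc : measurable_fun setT ((fun z => z i ord0) : 'cV[R]_n -> measurableTypeR R).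
  exact: (measurable_mx_entry i ord0).
pose mfi : {mfun 'cV[R]_n >-> measurableTypeR R} := HB.pack (fun z : 'cV[R]_n => z i ord0)
  (isMeasurableFun.Build _ _ _ _ _ mc).
transitivity (\int[distribution (std_gaussian R n) mfi]_x f x).
  by rewrite ge0_integral_distribution.
by apply: eq_measure_integral => A mA _; exact: std_gaussian_coord.
Qed.

End gaussian_measure.

(** * Convex bodies and flat vectors *)

Section convexity.
Variables (R : realType) (p : nat).
Implicit Types (K A T : set 'cV[R]_p) (u v y : 'cV[R]_p).

Definition cvx A := convex_set (A : set (convex_lmodType 'cV[R]_p)).

Lemma cvxP A : cvx A ->
  forall x y (t : R), 0 <= t <= 1 -> A x -> A y -> A (t *: x + (1 - t) *: y).
Proof.
move=> cA x y t /andP[t0 t1] Ax Ay.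
have := cA x y (Itv01 t0 t1); rewrite !inE => /(_ Ax Ay).
by [].
Qed.

Lemma cvxI A : (forall x y (t : R), 0 <= t <= 1 -> A x -> A y ->
  A (t *: x + (1 - t) *: y)) -> cvx A.
Proof.
move=> cA x y l; rewrite !inE => Ax Ay; apply: (cA x y l%:num) => //.
by apply/andP; split.
Qed.

Lemma cvx_average A q (F : 'I_q -> 'cV[R]_p) : cvx A -> (0 < q)%N ->
  (forall i, A (F i)) -> A (q%:R^-1 *: \sum_i F i).
Proof.
move=> cA; elim: q F => // -[|q] IH F _ AF.
  by rewrite big_ord_recl big_ord0 addr0 invr1 scale1r.
rewrite big_ord_recr/=.
have := cvxP cA (t := q.+1%:R / q.+2%:R) _ (IH (fun i => F (widen_ord (leqnSn _) i)) isT (fun i => AF _)) (AF ord_max).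
have q2 : q.+2%:R != 0 :> R by [].
have q1 : q.+1%:R != 0 :> R by [].
rewrite scalerA mulrAC mulfV// mul1r.
have -> : 1 - q.+1%:R / q.+2%:R = q.+2%:R^-1 :> R.
  by rewrite -[X in X - _](divff q2) -mulrBl -(natr1 q.+1) addrAC subrr add0r mul1r.
rewrite -scalerDr; apply.
by rewrite divr_ge0// ler_pdivrMr// mul1r ler_nat leqnSn.
Qed.

Lemma sub_conv_hull T : T `<=` conv_hull T.
Proof. exact: sub_gen_smallest. Qed.

Lemma conv_hull_min T A : cvx A -> T `<=` A -> conv_hull T `<=` A.
Proof. by move=> cA TA; exact: smallest_sub. Qed.

Lemma cvx_conv_hull T : cvx (conv_hull T).
Proof.
apply: cvxI => x y t t01 hx hy A [cA TA].
by apply: (cvxP cA t01); [exact: hx|exact: hy].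
Qed.

Lemma sparse_hull_le K s s' : (s <= s')%N -> sparse_hull K s `<=` sparse_hull K s'.
Proof.
move=> ss'; apply: conv_hull_min; first exact: cvx_conv_hull.
by move=> v [Kv vs]; apply: sub_conv_hull; split=> //; exact: leq_trans ss'.
Qed.

Lemma sparse_hull_sub K s : cvx K -> sparse_hull K s `<=` K.
Proof. by move=> cK; apply: conv_hull_min => // v []. Qed.

Lemma sparse_hull_dotv_le K s y (c : R) :
  (forall v, K v -> (norm0 v <= s)%N -> dotv y v <= c) ->
  forall v, sparse_hull K s v -> dotv y v <= c.
Proof.
move=> H v; apply: (@conv_hull_min _ [set v | dotv y v <= c]).
  apply: cvxI => x z t /andP[t0 t1] /= xc zc; rewrite dotvDr !dotvZr.
  have := ler_wpM2l t0 xc; have := @ler_wpM2l _ (1 - t) _ _ _ zc.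
  by rewrite subr_ge0 t1 => /(_ isT); lra.
by move=> {}v [Kv vs] /=; exact: H.
Qed.

Lemma profile_sparse0 v (pi : 'S_p) s m : sorts v pi -> (norm0 v <= s)%N ->
  (s <= m)%N -> profile (absv v) pi m = 0.
Proof.
move=> vpi vs sm; have [pm|mp] := leqP p m; first exact: profile_ge.
apply/eqP/negPn/negP => x0.
have : (m.+1 <= norm0 v)%N.
  rewrite -(card_rank_lt pi mp); apply/subset_leq_card/fintype.subsetP => i.
  rewrite !inE ltnS => im; apply: contra_neq x0 => vi0.
  have := profile_anti (absv_ge0 v) vpi im.
  rewrite profileE permKV /absv vi0 normr0 => h.
  by apply/eqP; rewrite eq_le h profile_ge0// => j; exact: absv_ge0.
by rewrite ltnNge (leq_trans vs).
Qed.

End convexity.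

(** * Bodies invariant under signs and permutations *)

Section sign_permutation_invariant_bodies.
Variables (R : realType) (p : nat) (K : set 'cV[R]_p).
Hypotheses (cK : cvx K) (K0 : K 0) (Ksp : sign_perm_invariant K).
Implicit Types (u v y w : 'cV[R]_p).

Lemma body_perm v (pi : 'S_p) : K v -> K (\col_j v (pi j) 0).
Proof.
move=> Kv; have := Ksp (fun=> false) pi Kv.
by congr K; apply/colP => j; rewrite !mxE expr0 mul1r.
Qed.

(** On the segment from [v] to its reflection in coordinate [i], that coordinate takes every value
    between -|v_i| and |v_i| while the others stay fixed. *)
Let body_set_coord v i c : K v -> `|c| <= `|v i 0| ->
  K (\col_j (if j == i then c else v j 0)).
Proof.
move=> Kv ci; have [vi0|vi0] := eqVneq (v i 0) 0.
  suff -> : \col_j (if j == i then c else v j 0) = v by [].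
  apply/colP => j; rewrite !mxE; case: eqP => // ->; rewrite vi0.
  by apply/eqP; rewrite -normr_le0 (le_trans ci)// vi0 normr0.
pose th := c / v i 0.
have th1 : -1 <= th <= 1.
  by rewrite -ler_norml normrM normfV ler_pdivrMr ?normr_gt0// mul1r.
have Kf := Ksp (fun j => j == i) 1%g Kv.
have := cvxP cK (t := (1 + th) / 2) _ Kv Kf.
have -> : (0 <= (1 + th) / 2 <= 1).
  by case/andP: th1 => *; apply/andP; split; lra.
move=> /(_ isT); congr K; apply/colP => j; rewrite !mxE perm1.
case: eqP => [->|_]; last by rewrite expr0 mul1r -mulrDl addrC subrK mul1r.
have -> : c = th * v i 0 by rewrite /th divfK.
by rewrite expr1; field.
Qed.

(** Sign-invariant convex sets are solid: replace the coordinates of [v] by those of [y] one at a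
    time. *)
Lemma body_dominated v y : K v -> (forall i, absv y i <= absv v i) -> K y.
Proof.
move=> Kv yv.
suff H (s : seq 'I_p) : K (\col_j (if j \in s then y j 0 else v j 0)).
  have := H (enum 'I_p); congr K; apply/colP => j.
  by rewrite mxE mem_enum.
elim: s => [|i s IH].
  by have := Kv; congr K; apply/colP => j; rewrite mxE.
pose c := y i 0; have := @body_set_coord _ i c IH; rewrite mxE.
have -> : `|c| <= `|if i \in s then y i 0 else v i 0|.
  by case: ifP => // _; exact: yv.
move=> /(_ isT); congr K; apply/colP => j; rewrite !mxE inE.
by case: eqP => [->|].
Qed.

Definition boxv (t : R) (m : nat) : 'cV[R]_p := \col_j (if (j < m)%N then t else 0).

Lemma absv_boxv (t : R) m i : 0 <= t -> absv (boxv t m) i = if (i < m)%N then t else 0.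
Proof. by move=> t0; rewrite /absv mxE; case: ifP => _; rewrite ?normr0// ger0_norm. Qed.

(** Sorting moves the support of [y] into the first [j] coordinates, where the flat vector dominates
    it. *)
Lemma body_sparse y (t : R) j : K (boxv t j) -> 0 <= t -> (norm0 y <= j)%N ->
  (forall i, absv y i <= t) -> K y.
Proof.
move=> Kt t0 yj yt; have [pi ypi] := sorts_exists y.
have Kw : K (\col_i y (pi i) 0).
  apply: (body_dominated Kt) => i; rewrite absv_boxv//.
  have -> : absv (\col_i y (pi i) 0) i = absv y (pi i) by rewrite /absv mxE.
  case: ltnP => // ji; rewrite -profileE.
  by rewrite (profile_sparse0 ypi yj ji).
have := body_perm pi^-1%g Kw; congr K; apply/colP => i.
by rewrite !mxE permKV.
Qed.

Lemma card_divn_eq j b : (0 < j)%N -> (#|[set i : 'I_p | (i %/ j == b)%N]%SET| <= j)%N.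
Proof.
move=> j0; pose g (i : 'I_p) : 'I_j := Ordinal (ltn_pmod i j0).
rewrite -[leqRHS]card_ord -(@card_in_imset _ _ g); first exact: max_card.
move=> i i'; rewrite !inE => /eqP ib /eqP ib' /(congr1 val)/= e.
by apply/val_inj; rewrite /= (divn_eq i j) (divn_eq i' j) ib ib' e.
Qed.

(* Average of [q] flat vectors supported on consecutive blocks of length [j]. *)
Lemma sparse_hull_block (t : R) j q m (eps : 'I_p -> bool) : K (boxv t j) -> 0 <= t ->
  (0 < j)%N -> (0 < q)%N -> (m <= q * j)%N ->
  sparse_hull K j (\col_i (if (i < m)%N then (-1) ^+ eps i * (t / q%:R) else 0)).
Proof.
move=> Kt t0 j0 q0 mqj.
pose F (b : 'I_q) : 'cV[R]_p :=
  \col_i (if (i < m)%N && (i %/ j == b)%N then (-1) ^+ eps i * t else 0).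
have FK b : sparse_hull K j (F b).
  have Fj : (norm0 (F b) <= j)%N.
    apply: leq_trans (card_divn_eq b j0); apply/subset_leq_card/fintype.subsetP => i.
    rewrite !inE mxE; case: (_ == _ :> nat) => //; rewrite ?andbF ?eqxx//.
  apply: sub_conv_hull; split=> //; apply: (body_sparse Kt t0 Fj) => i.
  rewrite /absv mxE; case: ifP => _; last by rewrite normr0.
  by rewrite normrM normrX normrN1 expr1n mul1r ger0_norm.
have := cvx_average (@cvx_conv_hull _ _ _) q0 FK; congr sparse_hull.
apply/colP => i; rewrite !mxE summxE.
have [im|im] := ltnP i m; last first.
  by rewrite big1 ?mulr0// => b _; rewrite mxE ltnNge im.
have ib : (i %/ j < q)%N by rewrite ltn_divLR// (leq_trans im).
rewrite (bigD1 (Ordinal ib))//= mxE im eqxx/= big1 ?addr0; first by rewrite mulrC mulrA.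
by move=> b; rewrite -val_eqE/= mxE eq_sym => /negbTE ->; rewrite andbF.
Qed.

Hypothesis p0 : (0 < p)%N.
Hypothesis Kbd : exists B, forall v, K v -> forall i, absv v i <= B.

Definition flat_height (m : nat) : R := sup [set t | 0 <= t /\ K (boxv t m)].

Lemma boxv0 m : boxv 0 m = 0.
Proof. by apply/colP => i; rewrite !mxE if_same. Qed.

Lemma has_sup_flat m : (0 < m)%N -> has_sup [set t | 0 <= t /\ K (boxv t m)].
Proof.
move=> m0; split; first by exists 0; split=> //; rewrite boxv0.
have [B HB] := Kbd; exists B => t [t0 Kt].
have := HB _ Kt (Ordinal p0); rewrite absv_boxv//=.
by rewrite m0.
Qed.

Lemma flat_height_ub (t : R) m : (0 < m)%N -> 0 <= t -> K (boxv t m) -> t <= flat_height m.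
Proof. by move=> m0 t0 Kt; apply: ub_le_sup => //; case: (has_sup_flat m0). Qed.

Lemma flat_height_ge0 m : (0 < m)%N -> 0 <= flat_height m.
Proof. by move=> m0; apply: flat_height_ub => //; rewrite boxv0. Qed.

Lemma flat_height_lt (t : R) m : (0 < m)%N -> 0 <= t -> t < flat_height m -> K (boxv t m).
Proof.
move=> m0 t0 tf; have e0 : 0 < flat_height m - t by rewrite subr_gt0.
have [t' [t'0 Kt']] := sup_adherent e0 (has_sup_flat m0).
rewrite subKr => tt'; apply: (body_dominated Kt') => i; rewrite !absv_boxv//.
by case: ifP => // _; exact: ltW.
Qed.

Lemma flat_height_le (c : R) m : (0 < m)%N ->
  (forall t, 0 <= t -> K (boxv t m) -> t <= c) -> flat_height m <= c.
Proof.
move=> m0 H; apply: ge_sup; first by case: (has_sup_flat m0).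
by move=> t [t0 Kt]; exact: H.
Qed.

(** The first [m.+1] sorted entries are at least the one of rank m, so the sorted vector dominates a
    flat vector of that height. *)
Lemma profile_le_flat_height v (pi : 'S_p) (m : nat) : K v -> sorts v pi ->
  profile (absv v) pi m <= flat_height m.+1.
Proof.
move=> Kv vpi; have x0 : 0 <= profile (absv v) pi m.
  by apply: profile_ge0 => i; exact: absv_ge0.
apply: flat_height_ub => //; apply: (body_dominated (body_perm pi Kv)) => i.
rewrite absv_boxv// ltnS.
have -> : absv (\col_i v (pi i) 0) i = profile (absv v) pi i.
  by rewrite profileE /absv mxE.
case: leqP => im; last by apply: profile_ge0 => j; exact: absv_ge0.
by apply: profile_anti => // j; exact: absv_ge0.
Qed.

Lemma absv_le_flat_height v i : K v -> absv v i <= flat_height 1.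
Proof.
move=> Kv; have [pi vpi] := sorts_exists v.
apply: le_trans (profile_le_flat_height 0 Kv vpi).
rewrite -{1}(permKV pi i) -profileE.
by apply: profile_anti => // j; exact: absv_ge0.
Qed.

End sign_permutation_invariant_bodies.

Section convex_bodies.
Variables (R : realType) (p : nat) (K : set 'cV[R]_p).
Hypotheses (cbK : convex_body K) (Ks : centrally_symmetric K).
Hypotheses (Ksp : sign_perm_invariant K) (p0 : (0 < p)%N).

Lemma convex_body_cvx : cvx K. Proof. by case: cbK. Qed.

Lemma convex_body0 : K 0.
Proof.
case: cbK => _ cK [v iv]; have Kv : K v by exact: interior_subset.
have h : 0 <= (2^-1 : R) <= 1 by rewrite invr_ge0 ler0n invf_le1// ler1n.
have := cvxP cK h Kv (Ks Kv); congr K.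
by rewrite scalerN -scalerBl; apply/colP => i; rewrite !mxE; field.
Qed.

Lemma convex_body_bounded : exists B, forall v, K v -> forall i, absv v i <= B.
Proof.
case: cbK => Kc _ _.
have H i : exists B, forall v, K v -> absv v i <= B.
  have cc : continuous (fun v : 'cV[R]_p => v i 0) by exact: coord_continuous.
  have : compact ((fun v : 'cV[R]_p => v i 0) @` K).
    by apply: continuous_compact => //; exact: continuous_subspaceT.
  move=> /compact_bounded[M [_ HM]].
  exists (M + 1) => v Kv; apply: (HM (M + 1)); first by rewrite ltrDl.
  by exists v.
have [B HB] := fin_all_exists H.
exists (\sum_i `|B i|) => v Kv i.
apply: le_trans (HB i v Kv) _; apply: le_trans (ler_norm _) _.
by rewrite (bigD1 i)//= lerDl sumr_ge0.
Qed.

Lemma flat_height1_gt0 : 0 < flat_height K 1.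
Proof.
have cK := convex_body_cvx; have K0 := convex_body0.
have Kbd := convex_body_bounded.
case: cbK => _ _ [v iv]; have Kv : K v by exact: interior_subset.
pose i0 := Ordinal p0.
(* Any point of [K] with a nonzero first coordinate bounds the height from below. If the interior
   point has a zero there, it is moved slightly along that axis. *)
have [vi|vi] := eqVneq (v i0 0) 0; last first.
  by apply: lt_le_trans (absv_le_flat_height cK K0 Ksp p0 Kbd i0 Kv); rewrite normr_gt0.
pose g (t : R) : 'cV[R]_p := v + t *: delta_mx i0 0.
have cg : continuous g.
  move=> t; apply: cvgD; first exact: cvg_cst.
  exact: scalel_continuous.
have : nbhs (0 : R) (g @^-1` K).
  apply: cg; rewrite /g scale0r addr0; exact: iv.
move=> /nbhs_ballP[e /= e0 He].
have Kg : K (g (e / 2)).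
  apply: He; rewrite /ball/= sub0r normrN gtr0_norm ?divr_gt0//.
  by rewrite ltr_pdivrMr// mulr_natr mulr2n ltrDl.
apply: lt_le_trans (absv_le_flat_height cK K0 Ksp p0 Kbd i0 Kg).
by rewrite /absv /g !mxE vi add0r !eqxx mulr1 normr_gt0 mulf_neq0// ?invr_eq0 gt_eqF.
Qed.

End convex_bodies.

(** * Bounds on the Gaussian width *)

(** The integral of a nonnegative function is a supremum over simple functions below it, hence
    monotone for arbitrary functions. This serves for suprema over hulls and for the loss of the
    estimator. *)
Lemma ge0_le_integral_nonmeasurable d (T : measurableType d) (R : realType)
    (mu : {measure set T -> \bar R}) (f g : T -> \bar R) :
  (forall x, 0 <= f x)%E -> (forall x, f x <= g x)%E ->
  (\int[mu]_x f x <= \int[mu]_x g x)%E.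
Proof.
move=> f0 fg; have g0 x : (0 <= g x)%E by exact: le_trans (fg x).
rewrite !ge0_integralTE//; apply: le_ereal_sup => _ [h /= hf <-].
by exists h => //= x; exact: le_trans (fg x).
Qed.

Section ge0_integral_EFin.
Context d (T : measurableType d) (R : realType) (mu : {measure set T -> \bar R}).
Local Open Scope ereal_scope.
Implicit Types f g : T -> R.

Lemma ge0_integralZ_EFin (k : R) f : measurable_fun setT f -> (forall x, 0 <= f x)%R ->
  (0 <= k)%R -> \int[mu]_x (k * f x)%:E = k%:E * \int[mu]_x (f x)%:E.
Proof.
move=> mf f0 k0; rewrite -ge0_integralZl//; first exact/measurable_EFinP.
by move=> x _; rewrite lee_fin.
Qed.

Lemma ge0_integralD_EFin f g : measurable_fun setT f -> (forall x, 0 <= f x)%R ->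
  measurable_fun setT g -> (forall x, 0 <= g x)%R ->
  \int[mu]_x (f x + g x)%:E = \int[mu]_x (f x)%:E + \int[mu]_x (g x)%:E.
Proof.
move=> mf f0 mg g0; rewrite -ge0_integralD//.
- by move=> x _; rewrite lee_fin.
- exact/measurable_EFinP.
- by move=> x _; rewrite lee_fin.
- exact/measurable_EFinP.
Qed.

Lemma ge0_integral_sum_EFin (I : Type) (s : seq I) (Q : pred I) (f : I -> T -> R) :
  (forall i, measurable_fun setT (f i)) -> (forall i x, 0 <= f i x)%R ->
  \int[mu]_x (\sum_(i <- s | Q i) f i x)%:E = \sum_(i <- s | Q i) \int[mu]_x (f i x)%:E.
Proof.
move=> mf f0; under eq_integral do rewrite -sumEFin -big_filter.
rewrite ge0_integral_sum//; last 2 first.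
- by move=> i; apply/measurable_EFinP.
- by move=> i x _; rewrite lee_fin.
by rewrite big_filter.
Qed.

End ge0_integral_EFin.

(** * Sub-Gaussian vectors as multiples of admissible ones *)

Section sign_vector_sum.
Variables (R : realType) (p : nat).
Hypothesis p0 : (0 < p)%N.

Lemma sqnorm2_sign_zvec (z : zvec p) : sign_zvec z -> sqnorm2 (zval R z) = (zl1 z)%:R.
Proof.
move=> /forallP zs; rewrite natr_sum; apply: eq_bigr => i _; rewrite !mxE.
move: (zs i); case: (zcoord (z i)) => [[|[|k]]|[|k]] //= _.
- by rewrite mulr0.
- by rewrite mulr1.
- by rewrite mulrNN mulr1.
Qed.

Lemma zvec_of_set (J : {set 'I_p}) (V : 'cV[R]_p) : exists z : zvec p,
  [/\ sign_zvec z, zl1 z = #|J| & dotv V (zval R z) = \sum_(i in J) `|V i 0|].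
Proof.
pose a (i : 'I_p) : int := if i \in J then (-1) ^+ (V i 0 < 0)%R else 0.
have a1 i : absz (a i) = (i \in J) by rewrite /a; case: (i \in J) => //; case: (V i 0 < 0).
have sa : (\sum_i absz (a i))%N = #|J|.
  rewrite -sum1_card [RHS]big_mkcond; apply: eq_bigr => i _.
  by rewrite a1; case: (i \in J).
have [|z zE] := @zvec_of_int p a.
  by rewrite sa -[leqRHS]card_ord max_card.
exists z; split.
- by apply/forallP => i; rewrite zE a1; case: (_ \in _).
- by rewrite -sa; apply: eq_bigr => i _; rewrite zE.
- rewrite [RHS]big_mkcond; apply: eq_bigr => i _; rewrite mxE zE /a.
  case: ifP => _; last by rewrite mulr0.
  by rewrite rmorph_sign mulrC -normrEsign.
Qed.

(* Exponential moment witnessing admissibility: each term dominates the constraint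
   of one support [J] with one sign pattern, see [adm_sign_sum]. *)
Definition sign_sum (V : 'cV[R]_p) : R :=
  \sum_(z : zvec p | sign_zvec z && (0 < zl1 z <= p)%N)
    expR (slp R p (zl1 z) * dotv V (zval R z) - 7 * ((zl1 z)%:R * lgp R p (zl1 z))).

Lemma sign_sum_ge0 V : 0 <= sign_sum V.
Proof. by apply: sumr_ge0 => z _; exact: expR_ge0. Qed.

(** Take the term given by the signs of [V] on [J], with m = [#|J|]. As x <= exp x, [slp m] times
    the sum of |V_i| over [J] is at most 7 m lgp m + c <= (7 + c) m lgp m = (7 + c) [slp m] [phi m].
    The scaling is linear in [c], so it can be integrated. *)
Lemma adm_sign_sum V (c : R) : sign_sum V <= c -> adm ((7 + c)^-1 *: V).
Proof.
move=> Vc J; have c0 := le_trans (sign_sum_ge0 V) Vc.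
have c7 : 0 < 7 + c by lra.
have -> : \sum_(i in J) `|((7 + c)^-1 *: V) i 0| = (7 + c)^-1 * \sum_(i in J) `|V i 0|.
  rewrite mulr_sumr; apply: eq_bigr => i _.
  by rewrite mxE normrM [X in X * _]gtr0_norm// invr_gt0.
rewrite ler_pdivrMl//; have [z [zs z1 <-]] := zvec_of_set J V.
have [J0|J0] := posnP #|J|.
  have -> : dotv V (zval R z) = 0.
    apply: big1 => i _; rewrite mxE; move/eqP: (etrans z1 J0).
    rewrite sum_nat_eq0 => /forallP/(_ i)/=; rewrite absz_eq0 => /eqP ->.
    by rewrite mulr0z mulr0.
  by rewrite mulr_ge0 ?phi_ge0 ?(ltW c7).
have mp : (0 < #|J| <= p)%N by rewrite J0 -[leqRHS]card_ord max_card.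
have h : slp R p #|J| * dotv V (zval R z) - 7 * (#|J|%:R * lgp R p #|J|) <= c.
  apply: le_trans Vc.
  apply: (@le_trans _ _ (expR (slp R p #|J| * dotv V (zval R z) - 7 * (#|J|%:R * lgp R p #|J|)))).
    by apply: le_trans (expR_ge1Dx _); rewrite lerDr.
  rewrite /sign_sum (bigD1 z) ?zs ?z1//= lerDl.
  by apply: sumr_ge0 => ? _; exact: expR_ge0.
have l1 := lgp_ge1 R p0 mp; have s1 := slp_ge1 R p0 mp.
have m1 : 1 <= #|J|%:R :> R by rewrite ler1n.
have ml1 : 1 <= #|J|%:R * lgp R p #|J| by rewrite -[leLHS]mulr1 ler_pM.
have h2 : slp R p #|J| * dotv V (zval R z) <= slp R p #|J| * ((7 + c) * phi R p #|J|).
  have -> : slp R p #|J| * ((7 + c) * phi R p #|J|) = (7 + c) * (#|J|%:R * lgp R p #|J|).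
    by rewrite /phi -(sqr_slp R p0 mp); ring.
  have : c <= c * (#|J|%:R * lgp R p #|J|) by rewrite ler_peMr.
  lra.
by rewrite ler_pM2l in h2 => //; lra.
Qed.

Lemma measurable_sign_sum d (T : measurableType d) (V : T -> 'cV[R]_p) :
  measurable_fun setT V -> measurable_fun setT (fun t => sign_sum (V t)).
Proof.
move=> mV; rewrite /sign_sum; under eq_fun do rewrite -big_filter.
apply: measurable_sum => z; apply: measurableT_comp => //.
apply: measurable_funB => //; apply: measurable_funM => //.
exact: measurable_dotv.
Qed.

Local Open Scope ereal_scope.

Lemma integral_sum_expR_le d (T : measurableType d) (P : {measure set T -> \bar R})
    (Q : pred (zvec p)) (F : zvec p -> T -> R) :
  (forall z, measurable_fun setT (F z)) -> (forall z t, 0 <= F z t)%R ->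
  (forall z, Q z -> (0 < zl1 z <= p)%N) ->
  (forall z, Q z -> \int[P]_t (F z t)%:E <=
     (expR (- (6 * ((zl1 z)%:R * lgp R p (zl1 z)))))%:E) ->
  \int[P]_t (\sum_(z | Q z) F z t)%:E <= (expR (- (2 * lgp R p 1)))%:E.
Proof.
move=> mF F0 Qz HF.
rewrite ge0_integral_sum_EFin//.
apply: (@le_trans _ _ (\sum_(z | Q z)
   (expR (- (6 * ((zl1 z)%:R * lgp R p (zl1 z)))))%:E)).
  by apply: lee_sum => z /HF.
rewrite sumEFin lee_fin; apply: le_trans (zl1_union_bound R p0).
rewrite [leRHS](bigID Q)/= -[leLHS]addr0 lerD//.
  rewrite le_eqVlt; apply/orP; left; apply/eqP; apply: eq_bigl => z.
  by apply/idP/andP => [Qz'|[]//]; rewrite Qz.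
by apply: sumr_ge0 => z _; exact: expR_ge0.
Qed.

(** For a sign vector with n nonzero entries the exponential moment costs exp(n lgp n / 2), so of
    the 7 in [sign_sum] at least the 6 wanted by the union bound remains. *)
Lemma integral_sign_sum_le d (T : measurableType d) (P : {measure set T -> \bar R})
    (V : T -> 'cV[R]_p) : measurable_fun setT V ->
  (forall y, \int[P]_t (expR (dotv (V t) y))%:E <= (expR (sqnorm2 y / 2))%:E) ->
  \int[P]_t (sign_sum (V t))%:E <= (expR (- (2 * lgp R p 1)))%:E.
Proof.
move=> mV HV; apply: integral_sum_expR_le => [z|z t|z /andP[]//|z /andP[zs zp]].
- apply: measurableT_comp => //.
  apply: measurable_funB => //; apply: measurable_funM => //.
  exact: measurable_dotv.
- exact: expR_ge0.
have mE : measurable_fun setT (fun t => expR (dotv (V t) (slp R p (zl1 z) *: zval R z))).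
  apply: measurableT_comp => //; exact: measurable_dotv.
under eq_integral do rewrite expRD -dotvZr mulrC.
rewrite ge0_integralZ_EFin ?expR_ge0//.
apply: (@le_trans _ _ ((expR (- (7 * ((zl1 z)%:R * lgp R p (zl1 z)))))%:E *
   (expR (sqnorm2 (slp R p (zl1 z) *: zval R z) / 2))%:E)).
  by rewrite lee_wpmul2l ?lee_fin ?expR_ge0.
rewrite -EFinM -expRD lee_fin ler_expR sqnorm2Z sqr_slp// sqnorm2_sign_zvec//.
have := @mul_lgp_homo R p p0 (zl1 z) (zl1 z).
have [z0 z1] := andP zp.
have l1 := lgp_ge1 R p0 zp.
have : (0 <= (zl1 z)%:R * lgp R p (zl1 z))%R by rewrite mulr_ge0// (le_trans _ l1).
lra.
Qed.

End sign_vector_sum.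

Section gaussian_width_bounds.
Variables (R : realType) (p : nat) (K : set 'cV[R]_p).
Hypotheses (cK : cvx K) (K0 : K 0) (Ksp : sign_perm_invariant K).
Hypothesis p0 : (0 < p)%N.
Hypothesis Kbd : exists B, forall v, K v -> forall i, absv v i <= B.
Local Notation f := (flat_height K).

Let hsup r (g : 'cV[R]_p) : \bar R :=
  ereal_sup [set (dotv g v)%:E | v in sparse_hull K r].

Let hsup_ub r g v : sparse_hull K r v -> ((dotv g v)%:E <= hsup r g)%E.
Proof. by move=> Kv; apply: ereal_sup_ubound; exists v. Qed.

Let hull0 r : sparse_hull K r 0.
Proof.
apply: sub_conv_hull; split=> //.
rewrite /norm0 (eq_card0 (A := [pred j | _]))// => j.
by rewrite !inE mxE eqxx.
Qed.

Let hsup_ge0 r g : (0 <= hsup r g)%E.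
Proof. by have := hsup_ub g (@hull0 r); rewrite dotv0r. Qed.

Lemma sparse_slope_le v (pi : 'S_p) s : K v -> (norm0 v <= s)%N -> sorts v pi ->
  slope v pi <= \sum_(m < s) f m.+1 * slp R p m.+1.
Proof.
move=> Kv vs vpi; set F := fun m => f m.+1 * slp R p m.+1.
have F0 m : 0 <= F m by rewrite mulr_ge0 ?slp_ge0 ?flat_height_ge0.
pose x := profile (absv v) pi.
have xF m : x m * slp R p m.+1 <= F m.
  by rewrite ler_wpM2r ?slp_ge0//; exact: profile_le_flat_height.
have [ps|sp] := leqP p s.
  rewrite /slope -(big_mkord predT (fun m => x m * slp R p m.+1)).
  rewrite -(big_mkord predT F) [leRHS](@big_cat_nat _ _ _ p)//=.
  rewrite -[leLHS]addr0 lerD ?sumr_ge0//; exact: ler_sum.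
rewrite /slope -(big_mkord predT (fun m => x m * slp R p m.+1)).
rewrite -(big_mkord predT F) [leLHS](@big_cat_nat _ _ _ s) ?(ltnW sp)//=.
rewrite [X in _ + X]big_nat_cond [X in _ + X]big1 ?addr0; first exact: ler_sum.
by move=> m /andP[/andP[sm _] _]; rewrite /x (profile_sparse0 vpi vs sm) mul0r.
Qed.

(** Dividing [g] by 7 + [sign_sum g] makes it admissible, so the supremum is at most that number
    times S pointwise. The expectation of [sign_sum] is at most 1, hence the factor 8. *)
Let width_le_aux s :
  (\int[std_gaussian R p]_g hsup s g <= (8 * \sum_(m < s) f m.+1 * slp R p m.+1)%:E)%E.
Proof.
set S := \sum_(m < s) _.
have S0 : 0 <= S by apply: sumr_ge0 => m _; rewrite mulr_ge0 ?slp_ge0 ?flat_height_ge0.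
apply: (@le_trans _ _ (\int[std_gaussian R p]_g ((7 + sign_sum g) * S)%:E)%E).
  apply: ge0_le_integral_nonmeasurable => g; first exact: hsup_ge0.
  apply: ge_ereal_sup => _ [v Kv <-]; rewrite lee_fin.
  apply: sparse_hull_dotv_le Kv => {}v Kv vs.
  have c7 : 0 < 7 + sign_sum g by have := sign_sum_ge0 g; lra.
  have ay := adm_sign_sum p0 (lexx (sign_sum g)).
  have [pi vpi] := sorts_exists v.
  have := adm_dotv_le ay vpi; rewrite dotvZl ler_pdivrMl// => /le_trans; apply.
  rewrite ler_wpM2l ?(ltW c7)//; apply: le_trans (sparse_slope_le Kv vs vpi).
  exact: layer_norm_le_slope.
have mS : measurable_fun setT (fun g : 'cV[R]_p => sign_sum g) by exact: measurable_sign_sum.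
under eq_integral do rewrite mulrC mulrDr.
have sS0 g : 0 <= S * sign_sum g by rewrite mulr_ge0// sign_sum_ge0.
have mSs : measurable_fun setT (fun g : 'cV[R]_p => S * sign_sum g).
  exact: measurable_funM.
rewrite ge0_integralD_EFin//; last by move=> g; rewrite mulr_ge0.
rewrite integral_cst//= probability_setT mule1.
rewrite ge0_integralZ_EFin//; last by move=> g; exact: sign_sum_ge0.
apply: (@le_trans _ _ ((S * 7)%:E + S%:E * 1)%E); last first.
  by rewrite mule1 -EFinD lee_fin; lra.
rewrite leeD2l// lee_wpmul2l ?lee_fin//.
apply: le_trans (integral_sign_sum_le p0 (V := id) _ _) _ => //.
  move=> y; rewrite le_eqVlt -std_gaussian_expR_dotv.
  by under [X in (X == _)]eq_integral do rewrite dotvC; rewrite eqxx.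
rewrite lee_fin -[leRHS]expR0 ler_expR oppr_le0 mulr_ge0//.
by rewrite (le_trans _ (@lgp_ge1 R p p0 1 _)).
Qed.

Lemma gaussian_widthE r :
  (gaussian_width (sparse_hull K r))%:E = (\int[std_gaussian R p]_g hsup r g)%E.
Proof.
rewrite /gaussian_width fineK// ge0_fin_numE; last by apply: integral_ge0 => g _; exact: hsup_ge0.
exact: le_lt_trans (width_le_aux r) (ltry _).
Qed.

Lemma gaussian_width_le s :
  gaussian_width (sparse_hull K s) <= 8 * \sum_(m < s) f m.+1 * slp R p m.+1.
Proof. by rewrite -lee_fin gaussian_widthE; exact: width_le_aux. Qed.

Lemma gaussian_width_ge0 s : 0 <= gaussian_width (sparse_hull K s).
Proof. by rewrite -lee_fin gaussian_widthE; apply: integral_ge0 => g _; exact: hsup_ge0. Qed.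

End gaussian_width_bounds.

(** * Order statistics of Gaussian vectors *)

Section order_statistics.
Variables (R : realType) (p : nat).
Implicit Types g : 'cV[R]_p.

(** Restricting the count to the first [M] coordinates allows its mean to be tuned, see
    [thinning]. *)
Definition exceed (t : R) (M : nat) g : R :=
  \sum_(i < p | (i < M)%N) \1_[set x : R | t <= `|x|] (g i 0).

Lemma exceed_ge0 t M g : 0 <= exceed t M g.
Proof. by apply: sumr_ge0 => i _; rewrite indicE. Qed.

(** With n exceedances the top [k.+1] entries sum to at least t min(k+1, n), and n - n^2/(4(k+1))
    lies below both n and k+1, the latter because (n - 2(k+1))^2 >= 0. The resulting bound involves
    just two moments of n. *)
Lemma top_sum_ge_exceed (t : R) (M k : nat) g (rho : 'S_p) : 0 <= t -> sorts g rho ->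
  t * (exceed t M g - exceed t M g ^+ 2 / (4 * k.+1%:R)) <=
  \sum_(j < k.+1) profile (absv g) rho j.
Proof.
move=> t0 grho; set a := profile _ _; set n := exceed t M g.
pose J := [set i : 'I_p | t <= absv g i]%SET.
have nJ : n <= #|J|%:R.
  rewrite /n /exceed -sum1_card natr_sum [leRHS]big_mkcond [leLHS]big_mkcond.
  apply: ler_sum => i _; rewrite inE; case: (i < M)%N; last by case: ifP.
  rewrite indicE; case: ifPn => [_|/negP nt]; first by case: (_ \in _).
  by rewrite memNset.
have aJ j : (j < #|J|)%N -> t <= a j.
  move=> jJ; rewrite leNgt; apply/negP => ajt.
  have jp : (j < p)%N by rewrite (leq_trans jJ)// -[leqRHS]card_ord max_card.
  have : (#|J| <= j)%N.
    rewrite -[leqRHS](card_rank_lt rho (ltnW jp)).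
    apply/subset_leq_card/fintype.subsetP => i; rewrite !inE => ti.
    rewrite ltnNge; apply/negP => ji.
    have := profile_anti (absv_ge0 g) grho ji; rewrite profileE permKV -/(a j) => h.
    by have := le_lt_trans (le_trans ti h) ajt; rewrite ltxx.
  by rewrite leqNgt jJ.
have a0 j : 0 <= a j by apply: profile_ge0 => i; exact: absv_ge0.
set l := minn k.+1 #|J|.
have h1 : t * l%:R <= \sum_(j < k.+1) a j.
  have -> : t * l%:R = \sum_(j < l) t by rewrite sumr_const card_ord mulr_natr.
  rewrite -(big_mkord predT a) (@big_cat_nat _ _ _ l)//= ?geq_minl//.
  rewrite big_mkord -[leLHS]addr0 lerD ?sumr_ge0//.
  by apply: ler_sum => j _; apply: aJ; rewrite (leq_trans (ltn_ord j)) ?geq_minr.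
apply: le_trans h1; apply: ler_wpM2l => //.
have n0 : 0 <= n := exceed_ge0 t M g.
have k0 : 0 < 4 * k.+1%:R :> R by rewrite mulr_gt0.
rewrite /l; case: (leqP k.+1 #|J|) => kJ.
  have kk : k.+1%:R != 0 :> R by [].
  rewrite -subr_ge0.
  have -> : k.+1%:R - (n - n ^+ 2 / (4 * k.+1%:R)) = (n - 2 * k.+1%:R) ^+ 2 / (4 * k.+1%:R).
    by field; rewrite nat1r.
  by rewrite divr_ge0 ?sqr_ge0// ltW.
apply: le_trans nJ; rewrite gerBl divr_ge0 ?sqr_ge0// ltW//.
Qed.

Local Open Scope ereal_scope.
Local Notation gam := (normal_prob 0%R 1%R : probability (measurableTypeR R) R).

Lemma measurable_tail (t : R) : measurable [set x : R | (t <= `|x|)%R].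
Proof.
have -> : [set x | (t <= `|x|)%R] = (@Num.norm R R : R -> R) @^-1` `[t, +oo[.
  by apply/seteqP; split=> x /=; rewrite in_itv/= andbT.
by rewrite -[X in measurable X]setTI; exact: normr_measurable.
Qed.

Lemma measurable_exceed t M : measurable_fun setT (exceed t M).
Proof.
rewrite /exceed; under eq_fun do rewrite -big_filter.
apply: measurable_sum => i; apply: measurableT_comp (measurable_mx_entry i 0%R).
by apply: measurable_indic; exact: measurable_tail.
Qed.

Definition tail_prob (t : R) : R := fine (gam [set x : R | (t <= `|x|)%R]).

Lemma tail_probE t : gam [set x : R | (t <= `|x|)%R] = (tail_prob t)%:E.
Proof. by rewrite fineK// fin_num_measure//; exact: measurable_tail. Qed.

Lemma tail_prob01 t : (0 <= tail_prob t <= 1)%R.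
Proof.
rewrite -!lee_fin -tail_probE measure_ge0 probability_le1//; exact: measurable_tail.
Qed.

Lemma integral_coord_tail t (i : 'I_p) :
  \int[std_gaussian R p]_g (\1_[set x : R | t <= `|x|] (g i 0))%:E = (tail_prob t)%:E.
Proof.
have mt := measurable_tail t.
rewrite (@integral_std_gaussian_coord R p i (fun x => (\1_[set x : R | t <= `|x|] x)%:E))//.
  by rewrite integral_indic ?setIT// -tail_probE.
by apply/measurable_EFinP; exact: measurable_indic.
Qed.

Lemma integral_exceed t M : (M <= p)%N ->
  \int[std_gaussian R p]_g (exceed t M g)%:E = (M%:R * tail_prob t)%:E.
Proof.
move=> Mp; rewrite /exceed ge0_integral_sum_EFin; last 2 first.
- move=> i; apply: measurableT_comp (measurable_mx_entry i 0%R).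
  by apply: measurable_indic; exact: measurable_tail.
- by move=> i x; rewrite indicE.
under eq_bigr do rewrite integral_coord_tail.
rewrite sumEFin; congr EFin; rewrite sumr_const mulr_natl; congr (_ *+ _)%R.
by rewrite -[RHS](card_ord_lt Mp) cardsE.
Qed.

(** When the square is expanded, the diagonal contributes the mean and, by independence, the pairs
    of distinct coordinates contribute at most its square. *)
Lemma integral_exceed_sqr t M : (M <= p)%N ->
  \int[std_gaussian R p]_g (exceed t M g ^+ 2)%:E <=
  (M%:R * tail_prob t + (M%:R * tail_prob t) ^+ 2)%:E.
Proof.
move=> Mp; set q := tail_prob t; pose A := [set x : R | (t <= `|x|)%R].
have mA : measurable A by exact: measurable_tail.
have q0 : (0 <= q)%R by case/andP: (tail_prob01 t).
pose I (i : 'I_p) (g : 'cV[R]_p) : R := \1_A (g i 0%R).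
have mI i : measurable_fun setT (I i).
  apply: measurableT_comp (measurable_mx_entry i 0%R); exact: measurable_indic.
have I0 i g : (0 <= I i g)%R by rewrite /I indicE.
have I1 i g : (I i g <= 1)%R by rewrite /I indicE; case: (_ \in _).
have cardM : #|[pred i : 'I_p | (i < M)%N]| = M by rewrite -[RHS](card_ord_lt Mp) cardsE.
have e1 g : (exceed t M g ^+ 2 = \sum_(i < p | (i < M)%N) \sum_(j < p | (j < M)%N) I i g * I j g)%R.
  by rewrite expr2 {1}/exceed mulr_suml; apply: eq_bigr => i _; rewrite mulr_sumr.
under eq_integral do rewrite e1.
rewrite ge0_integral_sum_EFin; last 2 first.
- move=> i; under eq_fun do rewrite -big_filter.
  by apply: measurable_sum => j; exact: measurable_funM.
- by move=> i g; apply: sumr_ge0 => j _; rewrite mulr_ge0.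
apply: (@le_trans _ _ (\sum_(i < p | (i < M)%N) (q + M%:R * q ^+ 2)%:E)).
  apply: lee_sum => i iM.
  rewrite ge0_integral_sum_EFin; last 2 first.
  - by move=> j; exact: measurable_funM.
  - by move=> j g; rewrite mulr_ge0.
  apply: (@le_trans _ _ (\sum_(j < p | (j < M)%N) ((j == i)%:R * q + q ^+ 2)%:E)).
    apply: lee_sum => j jM; have [->|ji] := eqVneq j i.
      apply: (@le_trans _ _ (\int[std_gaussian R p]_g (I i g)%:E)).
        apply: ge0_le_integral_nonmeasurable => g; rewrite lee_fin ?mulr_ge0//.
        by rewrite ler_piMr.
      by rewrite integral_coord_tail lee_fin mul1r lerDl sqr_ge0.
    rewrite mul0r add0r.
    have -> : \int[std_gaussian R p]_g (I i g * I j g)%:E =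
      \int[std_gaussian R p]_g (\1_(\bigcap_(k in [set` [set i; j]%SET])
         [set z : 'cV[R]_p | A (z k ord0)]) g)%:E.
      apply: eq_integral => g _; congr EFin; rewrite /I !indicE -natrM mulnb.
      congr ((nat_of_bool _)%:R); apply/andP/idP.
        rewrite !inE => -[gi gj] k /=; rewrite !inE => /orP[] /eqP ->//.
      rewrite !inE => H; split; first by apply: (H i); rewrite /= !inE eqxx.
      by apply: (H j); rewrite /= !inE eqxx orbT.
    rewrite integral_indic// ?setIT; last first.
      by apply: fin_bigcap_measurable => // k _; exact: measurable_coord.
    apply: (@le_trans _ _ (\prod_(k in [set i; j]%SET) gam A)).
      rewrite le_eqVlt; apply/orP; left; apply/eqP.
      exact: (@std_gaussian_boxJ R p [set i; j]%SET (fun=> A) (fun=> mA)).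
    rewrite big_setU1/= ?inE; last by rewrite eq_sym.
    by rewrite big_set1 tail_probE -EFinM expr2.
  rewrite sumEFin lee_fin big_split/= lerD//.
    rewrite -mulr_suml ler_piMl//.
    rewrite big_mkcond (bigD1 i)//= eqxx big1 ?addr0; first by case: ifP.
    by move=> j /negbTE ->; case: ifP.
  by rewrite sumr_const -[leLHS]mulr_natl ler_wpM2r ?sqr_ge0// ler_nat cardM.
rewrite sumEFin lee_fin sumr_const -[leLHS]mulr_natl cardM.
by rewrite exprMn mulrDr mulrA -expr2.
Qed.

End order_statistics.

Section gaussian_width_lower_bound.
Variables (R : realType).

(** One factor 1/e comes from [std_normal_tail], the other from exp(-lgp k) = k/(ep). *)
Definition gap_const : R := normal_peak 1 * expR (- 1) * expR (- 1).

Lemma gap_const_gt0 : 0 < gap_const.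
Proof. by rewrite /gap_const !mulr_gt0 ?expR_gt0// normal_peak_gt0// oner_neq0. Qed.

Lemma gap_const_le1 : gap_const <= 1.
Proof.
have e1 : expR (-1) <= 1 :> R by rewrite expR_le1; lra.
have e0 : 0 <= expR (-1) :> R by exact: expR_ge0.
have pk : normal_peak 1 <= 1 :> R.
  rewrite /normal_peak expr1n mul1r invf_le1; last by rewrite sqrtr_gt0 mulrn_wgt0// pi_gt0.
  rewrite -[leLHS]sqrtr1 ler_wsqrtr// mulr2n.
  by have := pi_ge2 R; lra.
have pk0 : 0 <= normal_peak 1 :> R by exact: normal_peak_ge0.
by rewrite /gap_const -[leRHS]mulr1 -[X in _ <= X * _]mulr1 !ler_pM ?mulr_ge0.
Qed.

Variable p : nat.
Hypothesis p0 : (0 < p)%N.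

Lemma tail_prob_ge k : (0 < k <= p)%N -> gap_const * k%:R <= p%:R * tail_prob (slp R p k).
Proof.
move=> kp; have [k0 _] := andP kp.
have s0 := slp_ge0 R p k.
have := std_normal_tail s0; rewrite tail_probE lee_fin (sqr_slp R p0 kp) => h.
have kR : 0 < k%:R :> R by rewrite ltr0n.
have pR : 0 < p%:R :> R by rewrite ltr0n.
have e : expR (- lgp R p k) = k%:R / (expR 1 * p%:R).
  rewrite expRN /lgp lnK ?invf_div// posrE divr_gt0// mulr_gt0// expR_gt0.
have := ler_wpM2l (ltW pR) h; rewrite e => /(le_trans _); apply.
rewrite le_eqVlt; apply/orP; left; apply/eqP; rewrite /gap_const [X in _ * X * _]expRN.
by field; rewrite !gt_eqF ?expR_gt0.
Qed.

(** The second moment argument needs a mean of order k from both sides. If all p coordinates give a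
    mean above k + 1, only floor((k+1)/q) of them are kept; as q <= 1, rounding down loses at most
    1. *)
Lemma thinning k : (0 < k <= p)%N -> exists M, [/\ (M <= p)%N,
  gap_const * k%:R <= M%:R * tail_prob (slp R p k) &
  M%:R * tail_prob (slp R p k) <= k%:R + 1].
Proof.
move=> kp; set q := tail_prob _; have kpq := tail_prob_ge kp.
have [pq|pq] := leP (p%:R * q) (k%:R + 1); first by exists p.
have /andP[q0 q1] : 0 <= q <= 1 by exact: tail_prob01.
have qp : 0 < q.
  rewrite lt_def q0 andbT; apply: contraTneq pq => ->.
  by rewrite mulr0 -leNgt addr_ge0.
pose M := Num.truncn ((k%:R + 1) / q).
have k1 : 0 <= (k%:R + 1) / q by rewrite divr_ge0// addr_ge0.
have Mle : M%:R * q <= k%:R + 1.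
  by rewrite -ler_pdivlMr// /M truncn_le.
have Mlt : k%:R + 1 < (M%:R + 1) * q.
  by rewrite -ltr_pdivrMr//; apply: lt_le_trans (truncnS_gt _) _; rewrite -/M -natr1.
exists M; split=> //.
- rewrite -(ler_nat R); apply: ltW.
  by rewrite -(ltr_pM2r qp); exact: le_lt_trans Mle pq.
- have := gap_const_le1; have := gap_const_gt0.
  have : 0 <= k%:R :> R by [].
  nra.
Qed.

Local Open Scope ereal_scope.

(** [F] is the positive part of the quadratic bound of [top_sum_ge_exceed]: a measurable minorant
    that does not mention the permutation sorting [g]. *)
Lemma top_sum_expectation k : (0 < k <= p)%N -> exists F : 'cV[R]_p -> R,
  [/\ measurable_fun setT F, forall g, (0 <= F g)%R,
     forall g (rho : 'S_p), sorts g rho -> (F g <= \sum_(j < k) profile (absv g) rho j)%R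
   & ((gap_const / 4 * phi R p k)%R)%:E <= \int[std_gaussian R p]_g (F g)%:E].
Proof.
move=> kp; have [M [Mp Mlo Mhi]] := thinning kp.
case: k kp Mlo Mhi => // k kp Mlo Mhi.
set t := slp R p k.+1 in Mlo Mhi *; have t0 : (0 <= t)%R by exact: slp_ge0.
pose W (g : 'cV[R]_p) := (exceed t M g - exceed t M g ^+ 2 / (4 * k.+1%:R))%R : R.
pose F (g : 'cV[R]_p) : R := (t * Num.max 0 (W g))%R.
have mE := @measurable_exceed R p t M.
have mW : measurable_fun setT W.
  apply: measurable_funB => //; apply: measurable_funM => //.
  exact: measurable_funX.
have mm : measurable_fun setT (fun g => Num.max 0%R (W g)).
  by apply: measurable_maxr.
have m0 g : (0 <= Num.max 0 (W g))%R by rewrite le_max lexx.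
exists F; split.
- exact: measurable_funM.
- by move=> g; rewrite mulr_ge0.
- move=> g rho grho; rewrite /F maxr_pMr// mulr0 ge_max.
  rewrite top_sum_ge_exceed// andbT; apply: sumr_ge0 => j _.
  by apply: profile_ge0 => i; exact: absv_ge0.
set mu := (M%:R * tail_prob t)%R in Mlo Mhi.
rewrite ge0_integralZ_EFin// /phi [(_ * (_ * t))%R]mulrA mulrC EFinM lee_wpmul2l ?lee_fin//.
set A := \int[_]__ _.
have k4 : (0 < 4 * k.+1%:R :> R)%R by rewrite mulr_gt0.
have h1 : mu%:E <= A + ((mu + mu ^+ 2) / (4 * k.+1%:R))%:E.
  rewrite -(integral_exceed t Mp).
  apply: (@le_trans _ _ (\int[std_gaussian R p]_g
     (Num.max 0 (W g) + (4 * k.+1%:R)^-1 * exceed t M g ^+ 2)%:E)).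
    apply: ge0_le_integral_nonmeasurable => g; rewrite lee_fin ?exceed_ge0//.
    have : (W g <= Num.max 0 (W g))%R by rewrite le_max lexx orbT.
    set mx := Num.max _ _ => h; rewrite -lerBlDr; apply: le_trans h.
    by rewrite [((_^-1) * _)%R]mulrC lexx.
  rewrite ge0_integralD_EFin//; last 2 first.
  - by apply: measurable_funM => //; exact: measurable_funX.
  - by move=> g; rewrite mulr_ge0 ?sqr_ge0// invr_ge0 ltW.
  rewrite leeD2l// ge0_integralZ_EFin ?invr_ge0 ?(ltW k4)//; last 2 first.
  - exact: measurable_funX.
  - by move=> g; exact: sqr_ge0.
  apply: (@le_trans _ _ (((4 * k.+1%:R)^-1)%:E * (mu + mu ^+ 2)%:E)); last first.
    by rewrite -EFinM mulrC.
  rewrite lee_wpmul2l ?lee_fin ?invr_ge0 ?(ltW k4)//; exact: integral_exceed_sqr.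
have h2 : (gap_const / 4 * k.+1%:R <= mu - (mu + mu ^+ 2) / (4 * k.+1%:R))%R.
  have mu0 : (0 <= mu)%R.
    by apply: le_trans Mlo; rewrite mulr_ge0// ltW// gap_const_gt0.
  have k1 : (1 <= k.+1%:R :> R)%R by rewrite ler1n.
  have kk : (k.+1%:R != 0 :> R)%R by [].
  (* The choice of [M] gives mu <= k + 2, hence 3(k+1) - 1 - mu >= 0. *)
  have : (mu / 4 <= mu - (mu + mu ^+ 2) / (4 * k.+1%:R))%R.
    rewrite -subr_ge0.
    have -> : (mu - (mu + mu ^+ 2) / (4 * k.+1%:R) - mu / 4 =
      mu * (3 * k.+1%:R - 1 - mu) / (4 * k.+1%:R))%R by field; rewrite nat1r.
    rewrite divr_ge0 ?(ltW k4)// mulr_ge0//; lra.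
  by move=> h; apply: le_trans h; rewrite mulrAC ler_wpM2r.
case: A h1 => [A| |] //=; last by move=> _; rewrite leey.
by rewrite -EFinD !lee_fin => h1; apply: le_trans h2 _; rewrite lerBlDr.
Qed.

End gaussian_width_lower_bound.

(** * The width bounds admissible functionals *)

Section gaussian_width_dual_bound.
Variables (R : realType) (p : nat) (K : set 'cV[R]_p).
Hypotheses (cK : cvx K) (K0 : K 0) (Ksp : sign_perm_invariant K).
Hypothesis p0 : (0 < p)%N.
Hypothesis Kbd : exists B, forall v, K v -> forall i, absv v i <= B.
Local Notation width r := (gaussian_width (sparse_hull K r)).

(** Permute [v] so that its entries are ranked like those of [g], and give them the signs of [g].
    Invariance keeps the result in [K], and the value of the pairing is an Abel summation. *)
Lemma rearrangement v (pi : 'S_p) (g : 'cV[R]_p) (rho : 'S_p) s :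
  K v -> (norm0 v <= s)%N ->
  let x := profile (absv v) pi in
  exists w, [/\ K w, (norm0 w <= s)%N &
    dotv g w = \sum_(m < p) (x m - x m.+1) * \sum_(j < m.+1) profile (absv g) rho j].
Proof.
move=> Kv vs x; pose h i := pi ((rho^-1)%g i).
have hinj : injective h by move=> i j /perm_inj/perm_inj.
pose w : 'cV[R]_p := \col_i (sgnv g i * absv v (h i)).
have aw i : absv w i = absv v (h i).
  by rewrite {1}/absv mxE normrM normr_sgnv mul1r ger0_norm// absv_ge0.
exists w; split.
- have /(body_perm Ksp) Kp := Kv.
  apply: (body_dominated cK Ksp (Kp ((rho^-1) * pi)%g)) => i.
  by rewrite aw /absv mxE permM.
- apply: leq_trans vs; rewrite /norm0 -[leqLHS]cardsE -[leqRHS]cardsE.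
  rewrite -(card_preimset [set j | v j 0 != 0]%SET hinj).
  apply/subset_leq_card/fintype.subsetP => i; rewrite !inE.
  by rewrite -normr_gt0 -/(absv w i) aw normr_gt0.
- rewrite -(@abel_sum R p x (profile (absv g) rho)); last exact: profile_ge.
  rewrite /dotv (reindex_inj (@perm_inj _ rho))/=; apply: eq_bigr => i _.
  rewrite mxE /h permK /x !profileE {1}(sgnv_abs g) /sgnv.
  by rewrite mulrACA -expr2 sqrr_sign mul1r mulrC.
Qed.

(** Integrate [rearrangement] over Gaussian [g]: the weights are nonnegative, and the top [m.+1]
    entries have a mean sum of at least a constant times [phi m.+1]. *)
Lemma layer_norm_le_width v (pi : 'S_p) s : K v -> (norm0 v <= s)%N -> sorts v pi ->
  gap_const R / 4 * layer_norm v pi <= width s.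
Proof.
move=> Kv vs vpi; rewrite -lee_fin (gaussian_widthE cK K0 Ksp p0 Kbd).
have /fin_all_exists[F HF] (m : 'I_p) := @top_sum_expectation R p p0 m.+1 (ltn_ord m).
pose x := profile (absv v) pi.
have xd m : 0 <= x m - x m.+1 by exact: sorts_anti.
have F0 m g : 0 <= F m g by have [_ + _ _] := HF m; apply.
have mF m : measurable_fun setT (F m) by have [+ _ _ _] := HF m.
apply: (@le_trans _ _ (\int[std_gaussian R p]_g (\sum_(m < p) (x m - x m.+1) * F m g)%:E)%E); last first.
  apply: ge0_le_integral_nonmeasurable => g.
    by rewrite lee_fin; apply: sumr_ge0 => m _; rewrite mulr_ge0.
  have [rho grho] := sorts_exists g.
  have [w [Kw ws gw]] := rearrangement pi g rho Kv vs.
  apply: (@le_trans _ _ (dotv g w)%:E); last first.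
    by apply: ereal_sup_ubound; exists w => //; apply: sub_conv_hull.
  rewrite lee_fin gw; apply: ler_sum => m _; rewrite ler_wpM2l//.
  by have [_ _ + _] := HF m; apply.
rewrite ge0_integral_sum_EFin; last 2 first.
- by move=> m; exact: measurable_funM.
- by move=> m g; rewrite mulr_ge0.
rewrite /layer_norm mulr_sumr -sumEFin; apply: lee_sum => m _.
rewrite ge0_integralZ_EFin// mulrCA EFinM lee_wpmul2l ?lee_fin//.
by have [_ _ _ +] := HF m; apply.
Qed.

Lemma adm_dotv_le_width y u s : adm y -> sparse_hull K s u ->
  dotv y u <= 4 / gap_const R * width s.
Proof.
move=> ay; apply: sparse_hull_dotv_le => v Kv vs.
have [pi vpi] := sorts_exists v.
apply: le_trans (adm_dotv_le ay vpi) _.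
have := layer_norm_le_width Kv vs vpi; have c0 := gap_const_gt0 R.
rewrite mulrAC ler_pdivrMr// mulrC => h.
by rewrite mulrAC ler_pdivlMr// [X in _ <= X]mulrC.
Qed.

(** The first basis vector is admissible, since 1 <= [slp 1] = [phi 1] <= [phi m]; pair it with
    [boxv t 1]. *)
Lemma flat_height1_le_width s : (0 < s)%N -> flat_height K 1 <= 4 / gap_const R * width s.
Proof.
move=> s0; apply: flat_height_le => // t t0 Kt.
pose i0 : 'I_p := Ordinal p0.
have ay : adm (boxv p (1 : R) 1).
  move=> J; apply: (@le_trans _ _ (if i0 \in J then 1 else 0)).
    rewrite big_mkcond (bigD1 i0)//= big1 ?addr0.
      by case: ifP => // _; rewrite mxE/= normr1.
    by move=> [[|i] ip]// _; case: ifP => // _; rewrite mxE/= normr0.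
  case: ifP => [iJ|_]; last exact: phi_ge0.
  have J0 : (0 < #|J| <= p)%N.
    by rewrite card_gt0; apply/andP; split; [apply/set0Pn; exists i0|rewrite -[leqRHS]card_ord max_card].
  by apply: le_trans (phi1_le R p0 J0); rewrite /phi mul1r slp_ge1.
have : sparse_hull K s (boxv p t 1).
  apply: sub_conv_hull; split=> //; apply: leq_trans s0.
  apply: (@leq_trans #|[set i0]%SET|); last by rewrite cards1.
  apply/subset_leq_card/fintype.subsetP => i.
  rewrite !inE mxE; case: ltnP => // i1; last by rewrite eqxx.
  by move=> _; rewrite -val_eqE/=; rewrite ltnS leqn0 in i1.
move/(adm_dotv_le_width ay); apply: le_trans.
rewrite /dotv (bigD1 i0)//= !mxE/= mul1r lerDl; apply: sumr_ge0 => i _.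
by rewrite !mxE; case: ifP => _; rewrite ?mul1r ?mulr0.
Qed.

End gaussian_width_dual_bound.

(** * The design matrix *)

Section subgaussian_vector.
Context d (T : measurableType d) (R : realType) (P : probability T R).
Variables (p : nat) (L : R) (Z : T -> 'cV[R]_p).
Hypotheses (L0 : 0 < L) (mZ : measurable_fun setT Z).
Local Open Scope ereal_scope.
Hypothesis sgZ : forall (delta : R) v, sqnorm2 v = 1%R ->
  \int[P]_w (expR (delta * dotv v (Z w)))%:E <= (expR (delta ^+ 2 * L ^+ 2 / 2))%:E.

Let mdot v : measurable_fun setT (fun w => dotv v (Z w)).
Proof. exact: measurable_dotv. Qed.

Let mexp (delta : R) v : measurable_fun setT (fun w => expR (delta * dotv v (Z w))).
Proof. by apply: measurableT_comp => //; exact: measurable_funM. Qed.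

Lemma subgaussian_expR_dotv (v : 'cV[R]_p) :
  \int[P]_w (expR (dotv v (Z w)))%:E <= (expR (L ^+ 2 * sqnorm2 v / 2))%:E.
Proof.
have [v0|v0] := eqVneq (nrm v) 0%R.
  have -> : v = 0%R by apply: sqnorm2_eq0; rewrite -sqr_nrm v0 expr0n.
  rewrite /sqnorm2 dotv0r mulr0 mul0r expR0.
  under eq_integral do rewrite dotvC dotv0r expR0.
  by rewrite integral_cst//= probability_setT mule1.
have := @sgZ (nrm v) ((nrm v)^-1 *: v).
rewrite sqnorm2Z -sqr_nrm -exprMn mulVf// expr1n => /(_ erefl) h.
rewrite [(L ^+ 2 * _)%R]mulrC; apply: le_trans h; rewrite le_eqVlt; apply/orP; left; apply/eqP.
by apply: eq_integral => w _; rewrite dotvZl mulrA mulfV// mul1r.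
Qed.

(** Apply y^4 <= 24 (exp y + exp(-y)) to y = <u,Z>/L; each exponential has mean at most exp(1/2) <=
    2. *)
Lemma subgaussian_fourth_moment u : sqnorm2 u = 1%R ->
  \int[P]_w (dotv u (Z w) ^+ 4)%:E <= (96 * L ^+ 4)%:E.
Proof.
move=> u1; have x4 (y : R) : (y ^+ 4 <= 24 * (expR y + expR (- y)))%R.
  have h (z : R) : (0 <= z -> z ^+ 4 <= 24 * expR z)%R.
    by move=> z0; have := expR_ge1Dxn 3 z0; rewrite (_ : 4`! = 24%N)//; lra.
  have [y0|y0] := leP 0%R y.
    by apply: le_trans (h _ y0) _; have := expR_ge0 (- y)%R; lra.
  have -> : (y ^+ 4 = (- y) ^+ 4)%R by rewrite exprNn -signr_odd mul1r.
  by apply: le_trans (h _ _) _; rewrite ?oppr_ge0 ?(ltW y0)//; have := expR_ge0 y; lra.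
have c0 : (0 <= 24 * L ^+ 4)%R by rewrite mulr_ge0// exprn_ge0// ltW.
apply: (@le_trans _ _ (\int[P]_w (24 * L ^+ 4 *
   (expR (L^-1 * dotv u (Z w)) + expR (- L^-1 * dotv u (Z w))))%:E)).
  apply: ge0_le_integral_nonmeasurable => w; rewrite lee_fin.
    by rewrite -[4%N]/(2 * 2)%N exprM sqr_ge0.
  have := x4 (L^-1 * dotv u (Z w))%R; rewrite exprMn exprVn mulNr.
  rewrite ler_pdivrMl ?exprn_gt0// => /le_trans; apply.
  by rewrite mulrA [(L ^+ 4 * _)%R]mulrC.
have ee0 (t : R) : (0 <= expR t)%R by exact: expR_ge0.
have mD : measurable_fun setT (fun w =>
    expR (L^-1 * dotv u (Z w)) + expR (- L^-1 * dotv u (Z w)))%R.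
  exact: measurable_funD.
have D0 w : (0 <= expR (L^-1 * dotv u (Z w)) + expR (- L^-1 * dotv u (Z w)))%R.
  by rewrite addr_ge0.
rewrite (ge0_integralZ_EFin _ mD D0 c0).
rewrite ge0_integralD_EFin => //.
have e2 : (expR (1 / 2) <= 2 :> R)%R.
  have := expR_ge1Dx (- (1 / 2) : R)%R; rewrite expRN.
  have := expR_gt0 (1 / 2 : R)%R => e0 h.
  by rewrite -[leRHS]invrK -[leLHS]invrK lef_pV2 ?posrE ?invr_gt0//; lra.
apply: (@le_trans _ _ ((24 * L ^+ 4)%:E * (2%:E + 2%:E))); last first.
  by rewrite -EFinD -EFinM lee_fin; lra.
rewrite lee_wpmul2l ?lee_fin// leeD//.
  apply: le_trans (sgZ _ u1) _; rewrite lee_fin exprVn mulVf//.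
  by rewrite expf_neq0// gt_eqF.
apply: le_trans (sgZ _ u1) _; rewrite lee_fin sqrrN exprVn mulVf//.
by rewrite expf_neq0// gt_eqF.
Qed.

(** The square is linearized by an independent standard normal x: exp(y^2/(8 L^2)) is the mean of
    exp(x y/(2 L)). Tonelli and the sub-Gaussian bound at x/(2 L) leave the mean of exp(x^2/8). *)
Lemma subgaussian_square_upper u : sqnorm2 u = 1%R ->
  \int[P]_w (expR (dotv u (Z w) ^+ 2 / (8 * L ^+ 2)))%:E <= (expR 1)%:E.
Proof.
move=> u1; set c := (2 * L)^-1%R.
have c0 : (0 < c)%R by rewrite invr_gt0 mulr_gt0.
pose gam := normal_prob 0%R 1%R : probability (measurableTypeR R) R.
have mgf (a : R) : \int[gam]_x (expR (a * x))%:E = (expR (a ^+ 2 / 2))%:E.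
  have := @std_normal_shift R a (cst 1) (measurable_cst _) (fun _ => lee01).
  rewrite integral_cst//= probability_setT mul1e => h.
  rewrite -[RHS]mule1 [X in _ * X]h.
  under [X in _ * X]eq_integral do rewrite mul1e.
  have mg : measurable_fun [set: measurableTypeR R] (fun x => expR (a * x - a ^+ 2 / 2))%R.
    by apply: measurableT_comp => //; apply: measurable_funB.
  rewrite -ge0_integralZ_EFin ?expR_ge0//.
  by apply: eq_integral => x _; rewrite -expRD; congr (expR _)%:E; ring.
have -> : \int[P]_w (expR (dotv u (Z w) ^+ 2 / (8 * L ^+ 2)))%:E =
  \int[P]_w \int[gam]_x (expR ((c * x) * dotv u (Z w)))%:E.
  apply: eq_integral => w _; under eq_integral do rewrite mulrAC.
  rewrite mgf; congr (expR _)%:E; rewrite /c; field.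
  by rewrite gt_eqF.
pose F (wx : T * measurableTypeR R) := (expR ((c * wx.2) * dotv u (Z wx.1)))%:E.
have mF : measurable_fun setT F.
  apply/measurable_EFinP; apply: measurableT_comp => //.
  apply: measurable_funM.
    by apply: measurable_funM => //; exact: measurable_snd.
  exact: (measurableT_comp (mdot u) measurable_fst).
have F0 wx : 0 <= F wx by rewrite lee_fin expR_ge0.
rewrite (@fubini_tonelli _ _ _ _ _ P gam F mF F0).
apply: (@le_trans _ _ (\int[gam]_x (expR (x ^+ 2 / 4))%:E)); last exact: std_normal_expR_sqr.
apply: ge0_le_integral_nonmeasurable => x.
  by apply: integral_ge0 => w _.
apply: le_trans (sgZ (c * x)%R u1) _; rewrite lee_fin ler_expR.
have -> : ((c * x) ^+ 2 * L ^+ 2 / 2 = x ^+ 2 / 8)%R by rewrite /c; field; rewrite gt_eqF.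
by have := sqr_ge0 x; lra.
Qed.

Variables (lam : R) (lam0 : (0 < lam)%R).

(** Integrate exp(-y) <= 1 - y + y^2 at y = delta <u,Z>^2. The choice of [delta] makes the quadratic
    term at most 96 L^4 delta^2 = delta lam / 2, half of the linear gain; then 1 - x <= exp(-x). *)
Lemma subgaussian_square_lower u (delta : R) : sqnorm2 u = 1%R ->
  lam%:E <= \int[P]_w (dotv u (Z w) ^+ 2)%:E ->
  delta = (lam / (192 * L ^+ 4))%R ->
  \int[P]_w (expR (- (delta * dotv u (Z w) ^+ 2)))%:E <= (expR (- (delta * lam / 2)))%:E.
Proof.
move=> u1 lamE deltaE.
have L4 : (0 < L ^+ 4)%R by rewrite exprn_gt0.
have d0 : (0 < delta)%R by rewrite deltaE divr_gt0 ?mulr_gt0 ?ltr0n ?L4.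
(* Since exp y >= (1 + y/2)^2, it suffices that (1 + y^2 - y)(1 + y/2)^2 >= 1, which is seen by
   expanding. *)
have key (y : R) : (0 <= y -> expR (- y) + y <= 1 + y ^+ 2)%R.
  move=> y0; have := expR_ge1Dx (y / 2)%R => h1.
  have h3 : ((1 + y / 2) ^+ 2 <= expR y)%R.
    have -> : expR y = (expR (y / 2) ^+ 2)%R by rewrite expr2 -expRD; congr expR; lra.
    by rewrite lerXn2r ?nnegrE ?expR_ge0//; lra.
  have e0 : (0 < expR y)%R by exact: expR_gt0.
  have pos : (0 <= 1 + y ^+ 2 - y)%R by have := sqr_ge0 (y - 1)%R; lra.
  rewrite -lerBrDr expRN -[leLHS]mul1r ler_pdivrMr//.
  apply: le_trans (ler_wpM2l pos h3).
  have -> : ((1 + y ^+ 2 - y) * (1 + y / 2) ^+ 2 =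
    1 + (y ^+ 2 / 4 + 3 / 4 * y ^+ 3 + y ^+ 4 / 4))%R by field.
  by rewrite lerDl !addr_ge0// ?divr_ge0 ?mulr_ge0 ?exprn_ge0.
set I := \int[P]_w _.
have mx n : measurable_fun setT (fun w => dotv u (Z w) ^+ n)%R by exact: measurable_funX.
have me : measurable_fun setT (fun w => expR (- (delta * dotv u (Z w) ^+ 2)))%R.
  apply: measurableT_comp => //; apply: measurableT_comp => //; exact: measurable_funM.
have h : I + (delta * lam)%:E <= (1 + delta ^+ 2 * (96 * L ^+ 4))%:E.
  apply: (@le_trans _ _ (I + delta%:E * \int[P]_w (dotv u (Z w) ^+ 2)%:E)).
    by rewrite leeD2l// EFinM lee_wpmul2l// lee_fin ltW.
  rewrite -ge0_integralZ_EFin ?(ltW d0)//; last by move=> w; exact: sqr_ge0.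
  have e0 w : (0 <= expR (- (delta * dotv u (Z w) ^+ 2)))%R by exact: expR_ge0.
  have md2 : measurable_fun setT (fun w => delta * dotv u (Z w) ^+ 2)%R.
    exact: measurable_funM.
  have d20 w : (0 <= delta * dotv u (Z w) ^+ 2)%R by rewrite mulr_ge0 ?sqr_ge0// ltW.
  rewrite -(ge0_integralD_EFin P me e0 md2 d20).
  apply: (@le_trans _ _ (\int[P]_w (1 + delta ^+ 2 * dotv u (Z w) ^+ 4)%:E)).
    apply: ge0_le_integral_nonmeasurable => w; rewrite lee_fin.
      by rewrite addr_ge0.
    have := @key (delta * dotv u (Z w) ^+ 2)%R; rewrite mulr_ge0 ?sqr_ge0 ?(ltW d0)//.
    by move=> /(_ isT)/le_trans; apply; rewrite exprMn -exprM.
  have dd : (0 <= delta ^+ 2)%R by exact: sqr_ge0.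
  have x40 w : (0 <= dotv u (Z w) ^+ 4)%R by rewrite -[4%N]/(2 * 2)%N exprM sqr_ge0.
  have mdx : measurable_fun setT (fun w => delta ^+ 2 * dotv u (Z w) ^+ 4)%R.
    exact: measurable_funM.
  rewrite ge0_integralD_EFin//; last by move=> w; rewrite mulr_ge0.
  rewrite integral_cst//= probability_setT mule1 EFinD leeD2l//.
  rewrite ge0_integralZ_EFin// (EFinM (delta ^+ 2)) lee_wpmul2l ?lee_fin//.
  exact: subgaussian_fourth_moment.
have h2 : (1 + delta ^+ 2 * (96 * L ^+ 4) - delta * lam = 1 - delta * lam / 2)%R.
  by rewrite deltaE; field; rewrite gt_eqF.
have e1 := expR_ge1Dx (- (delta * lam / 2))%R.
have I0 : 0 <= I by apply: integral_ge0 => w _; rewrite lee_fin expR_ge0.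
case: I I0 h => [I I0| |]//; rewrite -EFinD !lee_fin => h; lra.
Qed.

End subgaussian_vector.

(** * Second moments from the covariance matrix *)

Section covariance_form.
Context d (T : measurableType d) (R : realType) (P : probability T R).
Variables (p : nat) (Z : T -> 'cV[R]_p) (Sigma : 'M[R]_p).
Hypothesis mZ : measurable_fun setT Z.
Hypotheses (Z0 : mean_zero P Z) (covZ : covariance_matrix P Z Sigma).
Local Open Scope ereal_scope.

Let mZj j : measurable_fun setT (fun w => Z w j 0%R).
Proof. exact: (proj1 (measurable_fun_mxP _) mZ j ord0). Qed.

Lemma integral_coord_product j k :
  \int[P]_w (Z w j 0%R * Z w k 0%R)%:E = (Sigma j k)%:E.
Proof.
rewrite -covZ covariance.unlock.
have E0 i : fine 'E_P[fun w => Z w i 0%R] = 0%R by rewrite (Z0 i).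
rewrite !E0 expectation.unlock; apply: eq_integral => w _.
by rewrite !fctE /= !subr0.
Qed.

(** Linearity with signed coefficients requires integrability; it follows from |ab| <= a^2 + b^2 and
    the finite diagonal second moments. *)
Let integrable_coord_product j k :
  P.-integrable setT (fun w => (Z w j 0%R * Z w k 0%R)%:E).
Proof.
apply/integrableP; split.
  by apply/measurable_EFinP; exact: measurable_funM.
apply: (@le_lt_trans _ _ (\int[P]_w (Z w j 0%R * Z w j 0%R + Z w k 0%R * Z w k 0%R)%:E)).
  apply: ge0_le_integral_nonmeasurable => w; first exact: abse_ge0.
  rewrite lee_fin ler_norml; apply/andP; split.
    by have := sqr_ge0 (Z w j 0%R + Z w k 0%R)%R; have := sqr_ge0 (Z w j 0%R - Z w k 0%R)%R; nra.
  by have := sqr_ge0 (Z w j 0%R - Z w k 0%R)%R; nra.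
rewrite ge0_integralD_EFin; last 4 first.
- exact: measurable_funM.
- by move=> w; rewrite -expr2 sqr_ge0.
- exact: measurable_funM.
- by move=> w; rewrite -expr2 sqr_ge0.
by rewrite !integral_coord_product -EFinD ltry.
Qed.

Lemma integral_sqr_dotv (v : 'cV[R]_p) :
  \int[P]_w (dotv v (Z w) ^+ 2)%:E = ((v^T *m Sigma *m v) 0%R 0%R)%:E.
Proof.
have -> : ((v^T *m Sigma *m v) 0 0 = \sum_j \sum_k v j 0 * v k 0 * Sigma j k)%R.
  rewrite mxE exchange_big/=; apply: eq_bigr => k _; rewrite mxE mulr_suml.
  by apply: eq_bigr => j _; rewrite mxE; ring.
have e w : (dotv v (Z w) ^+ 2)%:E =
   \sum_j \sum_k ((v j 0 * v k 0)%R%:E * (Z w j 0 * Z w k 0)%R%:E).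
  rewrite expr2 /dotv mulr_suml -sumEFin; apply: eq_bigr => j _.
  rewrite mulr_sumr -sumEFin; apply: eq_bigr => k _.
  by rewrite -EFinM; congr EFin; ring.
under eq_integral do rewrite e.
have ik j k : P.-integrable setT (fun w => (v j 0 * v k 0)%R%:E * (Z w j 0 * Z w k 0)%R%:E).
  exact: integrableZl.
rewrite integral_sum//; last by move=> j; exact: integrable_sum.
rewrite -sumEFin; apply: eq_bigr => j _.
rewrite integral_sum// -sumEFin; apply: eq_bigr => k _.
by rewrite integralZl// integral_coord_product -EFinM.
Qed.

End covariance_form.

Lemma sqnorm2_zval_gt0 (R : realType) (p : nat) (z : zvec p) :
  (0 < zl1 z)%N -> 0 < sqnorm2 (zval R z).
Proof.
move=> z0; rewrite lt_neqAle sqnorm2_ge0 andbT eq_sym; apply/eqP => /sqnorm2_eq0 zv0.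
move: z0; rewrite lt0n => /eqP; apply; apply: big1 => i _.
have := congr1 (fun v : 'cV[R]_p => v i 0) zv0; rewrite !mxE => /eqP.
by rewrite intr_eq0 => /eqP ->.
Qed.

Lemma dotv_trmx_mul (R : realType) (N p : nat) (A : 'M[R]_(N, p)) (z : 'cV[R]_N) (y : 'cV[R]_p) :
  dotv (A^T *m z) y = dotv z (A *m y).
Proof.
rewrite /dotv; under eq_bigr => j _ do rewrite mxE mulr_suml.
rewrite exchange_big/=; apply: eq_bigr => i _; rewrite mxE mulr_sumr.
by apply: eq_bigr => j _; rewrite mxE mulrCA mulrA.
Qed.

Lemma mulmx_rowE (R : realType) (N p : nat) (A : 'M[R]_(N, p)) (y : 'cV[R]_p) i :
  (A *m y) i 0 = dotv y (row i A)^T.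
Proof. by rewrite mxE /dotv; apply: eq_bigr => j _; rewrite !mxE mulrC. Qed.

(** * Exponential sums controlling the noise and the isometry *)

Section design_sums.
Context d (T : measurableType d) (R : realType) (P : probability T R).
Variables (N p : nat) (X : {RV P >-> 'M[R]_(N, p)}) (L lam : R).
Hypotheses (p0 : (0 < p)%N) (L0 : 0 < L) (lam0 : 0 < lam).
Local Notation Xr := (fun i w => (row i (X w))^T).
Hypothesis indX : mutually_independent P Xr.
Local Open Scope ereal_scope.
Hypothesis sgX : forall i (delta : R) v, sqnorm2 v = 1%R ->
  \int[P]_w (expR (delta * dotv v (row i (X w))^T))%:E <= (expR (delta ^+ 2 * L ^+ 2 / 2))%:E.
Hypothesis loX : forall i u, sqnorm2 u = 1%R ->
  lam%:E <= \int[P]_w (dotv u (row i (X w))^T ^+ 2)%:E.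

Let mX : measurable_fun setT X. Proof. exact: measurable_funPT. Qed.

Let mXr i : measurable_fun setT (fun w => (row i (X w))^T).
Proof. by apply: measurable_trmx; exact: measurable_row. Qed.

Let mXv v : measurable_fun setT (fun w => sqnorm2 (X w *m v)).
Proof. by apply: measurable_sqnorm2; exact: measurable_mulmx. Qed.

Let integral_expR_rows_le (g : 'I_N -> 'cV[R]_p -> R) (c : 'I_N -> R) :
  (forall i, measurable_fun setT (g i)) ->
  (forall i, \int[P]_w (expR (g i (row i (X w))^T))%:E <= (expR (c i))%:E) ->
  \int[P]_w (expR (\sum_i g i (row i (X w))^T))%:E <= (expR (\sum_i c i))%:E.
Proof.
move=> mg gc; under eq_integral do rewrite expR_sum.
rewrite expR_sum; apply: (integral_prod_independent_le mXr indX
  (h := fun i u => expR (g i u)) (c := fun i => expR (c i))) => //.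
by move=> i; exact: measurableT_comp.
Qed.

Definition noise_sum (tau : R) (z : 'cV[R]_N) w : R := sign_sum (tau^-1 *: ((X w)^T *m z)).

Lemma measurable_noise_sum tau z : measurable_fun setT (noise_sum tau z).
Proof.
apply: measurable_sign_sum; apply: measurable_scalemx => //.
by apply: measurable_mulmx => //; exact: measurable_trmx.
Qed.

(** As the rows are independent, [X^T z / tau] is sub-Gaussian with variance factor L^2 |z|^2 /
    tau^2 <= 1. *)
Lemma integral_noise_sum_le tau z : (0 < tau)%R -> (L ^+ 2 * sqnorm2 z <= tau ^+ 2)%R ->
  \int[P]_w (noise_sum tau z w)%:E <= (expR (- (2 * lgp R p 1)))%:E.
Proof.
move=> t0 zt; apply: (integral_sign_sum_le p0) => [|y].
  apply: measurable_scalemx => //.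
  by apply: measurable_mulmx => //; exact: measurable_trmx.
have e w : dotv (tau^-1 *: ((X w)^T *m z)) y =
    (\sum_i dotv ((tau^-1 * z i 0) *: y) (row i (X w))^T)%R.
  rewrite dotvZl dotv_trmx_mul /dotv mulr_sumr; apply: eq_bigr => i _.
  by rewrite mulmx_rowE -[RHS]/(dotv _ _) dotvZl mulrA.
under eq_integral do rewrite e.
apply: (@le_trans _ _ (expR (\sum_i (L ^+ 2 * sqnorm2 ((tau^-1 * z i 0) *: y) / 2)))%:E).
  apply: (integral_expR_rows_le (g := fun i u => dotv ((tau^-1 * z i 0) *: y)%R u)
    (c := fun i => (L ^+ 2 * sqnorm2 ((tau^-1 * z i 0) *: y) / 2)%R)) => [i|i].
    by apply: measurable_dotv => //; exact: measurable_id.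
  exact: (subgaussian_expR_dotv (sgX i)).
rewrite lee_fin ler_expR.
have -> : (\sum_i (L ^+ 2 * sqnorm2 ((tau^-1 * z i 0) *: y) / 2) =
    (L ^+ 2 * sqnorm2 z / tau ^+ 2) * (sqnorm2 y / 2))%R.
  under eq_bigr do rewrite sqnorm2Z; move: (sqnorm2 y) => q.
  rewrite /sqnorm2 /dotv mulr_sumr !mulr_suml; apply: eq_bigr => i _.
  by field; rewrite gt_eqF.
rewrite ler_piMl ?divr_ge0 ?sqnorm2_ge0//.
by rewrite ler_pdivrMr ?exprn_gt0// mul1r.
Qed.

Let delta := (lam / (192 * L ^+ 4))%R.
Let delta0 : (0 < delta)%R.
Proof. by rewrite divr_gt0 ?mulr_gt0 ?ltr0n ?exprn_gt0 ?L0 ?lam0. Qed.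

(** With delta = lam/(192 L^4) this is delta lam / 24, so that 6 n lgp n <= delta lam N / 4 up to
    this level. *)
Definition sparse_radius : R := (lam / (192 * L ^+ 4) * lam / 24)%R.

(** A Chernoff sum for the failure of |Xz|^2 >= (lam/4) N |z|^2. Each term has mean at most
    exp(delta lam N/4 - delta lam N/2) = exp(-delta lam N/4), which [sparse_radius] compares with
    the weights of the union bound. *)
Definition lower_sum w : R := (\sum_(z : zvec p | (0 < zl1 z <= p)%N &&
    ((zl1 z)%:R * lgp R p (zl1 z) <= sparse_radius * N%:R))
  expR (- (lam / (192 * L ^+ 4) * (sqnorm2 (X w *m zval R z) / sqnorm2 (zval R z)))
    + lam / (192 * L ^+ 4) * lam / 4 * N%:R))%R.

(** A Chernoff sum for large |Xz|^2. Each row contributes a factor of mean at most e, so subtracting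
    [N] cancels the rows and leaves the weights of the union bound. *)
Definition upper_sum w : R := (\sum_(z : zvec p | sign_zvec z && (0 < zl1 z <= p)%N)
  expR (sqnorm2 (X w *m zval R z) / (8 * L ^+ 2 * (zl1 z)%:R)
    - N%:R - 6 * ((zl1 z)%:R * lgp R p (zl1 z))))%R.

Lemma lower_sum_ge0 w : (0 <= lower_sum w)%R.
Proof. by apply: sumr_ge0 => z _; exact: expR_ge0. Qed.

Lemma upper_sum_ge0 w : (0 <= upper_sum w)%R.
Proof. by apply: sumr_ge0 => z _; exact: expR_ge0. Qed.

Let mlow z : measurable_fun setT (fun w =>
  expR (- (lam / (192 * L ^+ 4) * (sqnorm2 (X w *m zval R z) / sqnorm2 (zval R z)))
    + lam / (192 * L ^+ 4) * lam / 4 * N%:R))%R.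
Proof.
apply: measurableT_comp => //; apply: measurable_funD => //; apply: measurableT_comp => //.
by apply: measurable_funM => //; exact: measurable_funM.
Qed.

Let mup z : measurable_fun setT (fun w =>
  expR (sqnorm2 (X w *m zval R z) / (8 * L ^+ 2 * (zl1 z)%:R)
    - N%:R - 6 * ((zl1 z)%:R * lgp R p (zl1 z))))%R.
Proof.
apply: measurableT_comp => //; apply: measurable_funB => //; apply: measurable_funB => //.
exact: measurable_funM.
Qed.

Lemma measurable_lower_sum : measurable_fun setT lower_sum.
Proof.
by rewrite /lower_sum; under eq_fun do rewrite -big_filter; exact: measurable_sum.
Qed.

Lemma measurable_upper_sum : measurable_fun setT upper_sum.
Proof.
by rewrite /upper_sum; under eq_fun do rewrite -big_filter; exact: measurable_sum.
Qed.

Let unit_zval (z : zvec p) : (0 < zl1 z)%N -> sqnorm2 ((nrm (zval R z))^-1 *: zval R z) = 1%R.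
Proof.
move=> /(sqnorm2_zval_gt0 R) z0.
by rewrite sqnorm2Z exprVn sqr_nrm mulVf// gt_eqF.
Qed.

Let sqnorm2_rows (z : zvec p) w : (0 < zl1 z)%N ->
  (sqnorm2 (X w *m zval R z) / sqnorm2 (zval R z) =
   \sum_i dotv ((nrm (zval R z))^-1 *: zval R z) (row i (X w))^T ^+ 2)%R.
Proof.
move=> /(sqnorm2_zval_gt0 R) z0.
rewrite {1}/sqnorm2 /dotv mulr_suml; apply: eq_bigr => i _.
rewrite mulmx_rowE -[in RHS]/(dotv _ _) dotvZl exprMn exprVn sqr_nrm -expr2.
by rewrite mulrC.
Qed.

Lemma integral_lower_sum_le : \int[P]_w (lower_sum w)%:E <= (expR (- (2 * lgp R p 1)))%:E.
Proof.
apply: (integral_sum_expR_le p0) => [z|z w|z /andP[]//|z /andP[zp zeps]] //.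
have [z0 _] := andP zp; pose u := (nrm (zval R z))^-1 *: zval R z.
under eq_integral do rewrite sqnorm2_rows// -/u expRD [(expR _ * _)%R]mulrC.
rewrite ge0_integralZ_EFin ?expR_ge0//; last first.
  apply: measurableT_comp => //; apply: measurableT_comp => //.
  apply: measurable_funM => //; apply: measurable_sum => i.
  by apply: measurable_funX; exact: measurable_dotv.
apply: (@le_trans _ _ ((expR (delta * lam / 4 * N%:R))%:E *
   (expR (\sum_(i < N) - (delta * lam / 2)))%:E)).
  rewrite lee_wpmul2l ?lee_fin ?expR_ge0//.
  have e w : (- (lam / (192 * L ^+ 4) * \sum_i dotv u (row i (X w))^T ^+ 2) =
      \sum_i - (delta * dotv u (row i (X w))^T ^+ 2))%R.
    by rewrite mulr_sumr sumrN.
  under eq_integral do rewrite e.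
  apply: (integral_expR_rows_le (g := fun i v => (- (delta * dotv u v ^+ 2))%R)
    (c := fun=> (- (delta * lam / 2))%R)) => [i|i].
    apply: measurableT_comp => //; apply: measurable_funM => //; apply: measurable_funX.
    by apply: measurable_dotv => //; exact: measurable_id.
  apply: (subgaussian_square_lower L0 (mXr i) (sgX i) lam0 (unit_zval z0) _ erefl).
  exact: loX (unit_zval z0).
rewrite -EFinM lee_fin -expRD ler_expR sumr_const card_ord -mulr_natr.
by move: zeps; rewrite /sparse_radius -/delta; lra.
Qed.

Lemma integral_upper_sum_le : \int[P]_w (upper_sum w)%:E <= (expR (- (2 * lgp R p 1)))%:E.
Proof.
apply: (integral_sum_expR_le p0) => [z|z w|z /andP[]//|z /andP[zs zp]] //.
have [z0 _] := andP zp; pose u := (nrm (zval R z))^-1 *: zval R z.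
have zR : (0 < (zl1 z)%:R :> R)%R by rewrite ltr0n.
have e w : (expR (sqnorm2 (X w *m zval R z) / (8 * L ^+ 2 * (zl1 z)%:R)
    - N%:R - 6 * ((zl1 z)%:R * lgp R p (zl1 z))) =
    expR (- N%:R - 6 * ((zl1 z)%:R * lgp R p (zl1 z))) *
    expR (\sum_i dotv u (row i (X w))^T ^+ 2 / (8 * L ^+ 2)))%R.
  rewrite -expRD -mulr_suml -sqnorm2_rows// sqnorm2_sign_zvec//; congr expR.
  by field; rewrite !gt_eqF.
under eq_integral do rewrite e.
rewrite ge0_integralZ_EFin ?expR_ge0//; last first.
  apply: measurableT_comp => //; apply: measurable_sum => i; apply: measurable_funM => //.
  by apply: measurable_funX; exact: measurable_dotv.
apply: (@le_trans _ _ ((expR (- N%:R - 6 * ((zl1 z)%:R * lgp R p (zl1 z))))%:E *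
   (expR (\sum_(i < N) 1))%:E)).
  rewrite lee_wpmul2l ?lee_fin ?expR_ge0//.
  apply: (integral_expR_rows_le (g := fun i v => (dotv u v ^+ 2 / (8 * L ^+ 2))%R)
    (c := fun=> 1%R)) => [i|i].
    apply: measurable_funM => //; apply: measurable_funX.
    by apply: measurable_dotv => //; exact: measurable_id.
  exact: (subgaussian_square_upper L0 (mXr i) (sgX i) (unit_zval z0)).
by rewrite -EFinM lee_fin -expRD ler_expR sumr_const card_ord; lra.
Qed.

Local Open Scope ring_scope.

(** When a sum of exponentials is at most 1, each exponent is at most 0. *)
Lemma lower_isometry w (z : zvec p) : lower_sum w <= 1 -> (0 < zl1 z <= p)%N ->
  (zl1 z)%:R * lgp R p (zl1 z) <= sparse_radius * N%:R ->
  lam / 4 * N%:R * sqnorm2 (zval R z) <= sqnorm2 (X w *m zval R z).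
Proof.
move=> w1 zp zeps; have [/(sqnorm2_zval_gt0 R) z0 _] := andP zp.
have : expR (- (delta * (sqnorm2 (X w *m zval R z) / sqnorm2 (zval R z)))
    + delta * lam / 4 * N%:R) <= 1.
  apply: le_trans w1; rewrite /lower_sum (bigD1 z) ?zp ?zeps//= lerDl.
  by apply: sumr_ge0 => y _; exact: expR_ge0.
rewrite -ler_pdivlMr//; set q := _ / _; rewrite expR_le1 => h.
by rewrite -(ler_pM2l delta0); lra.
Qed.

Lemma upper_isometry w (z : zvec p) : upper_sum w <= 1 -> sign_zvec z -> (0 < zl1 z <= p)%N ->
  sqnorm2 (X w *m zval R z) <=
    48 * L ^+ 2 * (zl1 z)%:R * (N%:R + (zl1 z)%:R * lgp R p (zl1 z)).
Proof.
move=> w1 zs zp; have [z0 _] := andP zp.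
have : expR (sqnorm2 (X w *m zval R z) / (8 * L ^+ 2 * (zl1 z)%:R)
    - N%:R - 6 * ((zl1 z)%:R * lgp R p (zl1 z))) <= 1.
  apply: le_trans w1; rewrite /upper_sum (bigD1 z) ?zs ?zp//= lerDl.
  by apply: sumr_ge0 => y _; exact: expR_ge0.
have c0 : 0 < 8 * L ^+ 2 * (zl1 z)%:R by rewrite !mulr_gt0// ?exprn_gt0// ltr0n.
rewrite expR_le1 => h; set n := (_ * lgp _ _ _) in h *.
have {}h : sqnorm2 (X w *m zval R z) / (8 * L ^+ 2 * (zl1 z)%:R) <= N%:R + 6 * n by lra.
rewrite ler_pdivrMr// in h; apply: le_trans h _.
have -> : 48 * L ^+ 2 * (zl1 z)%:R * (N%:R + n) = (6 * (N%:R + n)) * (8 * L ^+ 2 * (zl1 z)%:R) by ring.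
rewrite ler_wpM2r ?(ltW c0)//.
by have : 0 <= N%:R :> R by []; lra.
Qed.

End design_sums.

(** * Oracle inequality and risk of the estimator *)

Lemma adm_opp (R : realType) (p : nat) (y : 'cV[R]_p) : adm y -> adm (- y).
Proof. by move=> ay J; under eq_bigr do rewrite mxE normrN; exact: ay. Qed.

Lemma ell_ge (R : realType) s : 7 <= ell (7 : R) s.
Proof.
rewrite /ell ler_peMr// -[leLHS](@expRK R) ler_ln ?posrE ?expR_gt0 ?lerDl//.
Qed.

Section penalty_bounds.
Variables (R : realType) (N p : nat) (K : set 'cV[R]_p) (sigma : R).
Hypotheses (cbK : convex_body K) (Ks : centrally_symmetric K) (Ksp : sign_perm_invariant K).
Hypotheses (p0 : (0 < p)%N) (N0 : (0 < N)%N) (sigma0 : 0 < sigma).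
Local Notation w r := (gaussian_width (sparse_hull K r)).
Local Notation pn := (pen N 7 sigma K).

Let cK := convex_body_cvx cbK.
Let K0 := convex_body0 cbK Ks.
Let Kbd := convex_body_bounded cbK.
Let w_ge0 r : 0 <= w r. Proof. exact: gaussian_width_ge0. Qed.
Let NR : 0 < N%:R :> R. Proof. by rewrite ltr0n. Qed.
Let ell1 s : 1 <= ell (7 : R) s. Proof. by have := ell_ge R s; lra. Qed.
Let ell0 s : 0 <= ell (7 : R) s. Proof. by have := ell1 s; lra. Qed.

Lemma pen_ge_linear r : sigma * (w r / Num.sqrt N%:R) <= pn r.
Proof.
rewrite /pen -[leLHS]addr0 lerD//; last by rewrite divr_ge0// mulr_ge0// sqr_ge0.
rewrite ler_pM2l// -[leLHS]addr0 lerD//; last by rewrite divr_ge0// mulr_ge0.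
rewrite ler_wpM2r ?invr_ge0 ?sqrtr_ge0// ler_peMr//.
by rewrite -[leLHS]sqrtr1 ler_wsqrtr.
Qed.

Lemma pen_ge_square r : w r ^+ 2 / N%:R <= pn r.
Proof.
rewrite /pen -[leLHS]add0r lerD//; last first.
  by rewrite ler_wpM2r ?invr_ge0// ler_peMr// sqr_ge0.
apply: mulr_ge0; first exact: ltW.
by apply: addr_ge0; apply: divr_ge0 => //; apply: mulr_ge0 => //; exact: sqrtr_ge0.
Qed.

Lemma pen_ge0 r : 0 <= pn r.
Proof. by apply: le_trans (pen_ge_square r); rewrite divr_ge0// sqr_ge0. Qed.

End penalty_bounds.

(** The constant [C] of [quadratic_lower_bound]. *)
Definition iso_const (R : realType) (Cu cl eps b : R) : R :=
  let K := Num.sqrt Cu + Num.sqrt cl in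
  let B := (2 / eps + b) / (Num.sqrt cl / (2 * K)) ^+ 2 in
  2 / Num.sqrt cl * (1 + 2 * (K * Num.sqrt B + Num.sqrt Cu)).

Lemma iso_const_ge0 (R : realType) (Cu cl eps b : R) : 0 <= iso_const Cu cl eps b.
Proof. by rewrite /iso_const !(mulr_ge0, addr_ge0, invr_ge0, sqrtr_ge0). Qed.

(** * Deterministic bounds on the loss *)

Section oracle_inequality.
Variables (R : realType) (N p : nat) (K : set 'cV[R]_p) (sigma b lambda : R).
Hypotheses (cbK : convex_body K) (Ks : centrally_symmetric K) (Ksp : sign_perm_invariant K).
Hypotheses (p0 : (0 < p)%N) (N0 : (0 < N)%N) (sigma0 : 0 < sigma).
Hypotheses (b0 : 0 < b) (Nbp : N%:R <= b * p%:R).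
Variables (Cu cl eps : R).
Hypotheses (Cu0 : 0 < Cu) (cl0 : 0 < cl) (eps0 : 0 < eps).
Variables (r s : nat) (beta bh : 'cV[R]_p) (z : 'cV[R]_N) (X : 'M[R]_(N, p)).
Hypotheses (betas : sparse_hull K s beta) (bhr : sparse_hull K r bh).
Local Notation w r := (gaussian_width (sparse_hull K r)).
Local Notation pn := (pen N 7 sigma K).
Local Notation u := (bh - beta).
Local Notation G := (4 / gap_const R).
Local Notation CI := (iso_const Cu cl eps b).
Hypothesis opt : objective 7 sigma K lambda (X, X *m beta + z) r bh <=
  objective 7 sigma K lambda (X, X *m beta + z) s beta.

Let cK := convex_body_cvx cbK.
Let K0 := convex_body0 cbK Ks.
Let Kbd := convex_body_bounded cbK.
Let w_ge0 r' : 0 <= w r'. Proof. exact: gaussian_width_ge0. Qed.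
Let NR : 0 < N%:R :> R. Proof. by rewrite ltr0n. Qed.
Let G0 : 0 < G. Proof. by rewrite divr_gt0// gap_const_gt0. Qed.

Lemma adm_dotv_difference_le y : adm y -> dotv y u <= G * (w r + w s).
Proof.
move=> ay; rewrite dotvDr mulrDr lerD//; first exact: adm_dotv_le_width.
by rewrite dotvNr -dotvNl; apply: adm_dotv_le_width => //; exact: adm_opp.
Qed.

Lemma basic_inequality :
  sqnorm2 (X *m u) / N%:R + lambda * pn r <= lambda * pn s + 2 / N%:R * dotv z (X *m u).
Proof.
move: opt; rewrite /objective/=.
have -> : X *m beta + z - X *m bh = z - X *m u.
  by rewrite mulmxBr opprB [X *m beta + z]addrC -addrA.
have -> : X *m beta + z - X *m beta = z by rewrite addrC addKr.
rewrite [sqnorm2 (z - _)]sqnorm2D sqnorm2N dotvNr => h; move: h.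
set q := N%:R^-1; set Z := sqnorm2 z; set D := dotv _ _; set Q := sqnorm2 _.
by rewrite mulrDr mulrDr mulrN mulrN; move=> h; rewrite [Q * q]mulrC -mulrA; lra.
Qed.

Section isometry.
Hypothesis Xup : forall z : zvec p, sign_zvec z -> (0 < zl1 z <= p)%N ->
  sqnorm2 (X *m zval R z) <= Cu * (zl1 z)%:R * (N%:R + (zl1 z)%:R * lgp R p (zl1 z)).
Hypothesis Xlow : forall z : zvec p, (0 < zl1 z <= p)%N ->
  (zl1 z)%:R * lgp R p (zl1 z) <= eps * N%:R ->
  cl * N%:R * sqnorm2 (zval R z) <= sqnorm2 (X *m zval R z).

(** This is [quadratic_lower_bound], with its admissible functional bounded by the widths of the two
    hulls containing [bh] and [beta]. *)
Lemma sqnorm2_difference_le (m1 m2 : R) : 0 <= m1 -> 0 <= m2 ->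
  sqnorm2 (X *m u) / N%:R <= m1 -> w r ^+ 2 / N%:R <= m2 -> w s ^+ 2 / N%:R <= m2 ->
  sqnorm2 u <= CI ^+ 2 * (2 * m1 + 8 * G ^+ 2 * m2).
Proof.
move=> m10 m20 h1 h2 h3.
have [y [ay y0 hy]] := quadratic_lower_bound N0 p0 Cu0 cl0 eps0 b0 Nbp Xup Xlow u.
have hy2 := adm_dotv_difference_le ay.
have S0 : 0 < Num.sqrt (N%:R : R) by rewrite sqrtr_gt0.
have S2 : Num.sqrt (N%:R : R) ^+ 2 = N%:R by rewrite sqr_sqrtr.
have C0 := iso_const_ge0 Cu cl eps b.
have GW0 : 0 <= G * (w r + w s) by rewrite mulr_ge0 ?(ltW G0)// addr_ge0.
rewrite -(ler_pM2l NR) -S2 -sqr_nrm -exprMn.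
apply: (@le_trans _ _ ((CI * (nrm (X *m u) + G * (w r + w s))) ^+ 2)).
  have l1 : 0 <= Num.sqrt (N%:R : R) * nrm u by rewrite mulr_ge0 ?nrm_ge0 ?sqrtr_ge0.
  have l2 : 0 <= CI * (nrm (X *m u) + G * (w r + w s)).
    by rewrite mulr_ge0// addr_ge0// nrm_ge0.
  rewrite lerXn2r ?nnegrE//.
  by apply: le_trans hy _; rewrite ler_wpM2l// lerD2l.
rewrite exprMn [leRHS]mulrCA ler_wpM2l ?sqr_ge0// S2.
have a1 : nrm (X *m u) ^+ 2 <= N%:R * m1.
  by rewrite sqr_nrm mulrC -ler_pdivrMr.
have a2 : w r ^+ 2 <= N%:R * m2 by rewrite mulrC -ler_pdivrMr.
have a3 : w s ^+ 2 <= N%:R * m2 by rewrite mulrC -ler_pdivrMr.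
have sq2 (t t' : R) : (t + t') ^+ 2 <= 2 * t ^+ 2 + 2 * t' ^+ 2.
  by have := sqr_ge0 (t - t'); rewrite sqrrB sqrrD; lra.
apply: le_trans (sq2 _ _) _; rewrite exprMn mulrDr lerD//; first lra.
have := sq2 (w r) (w s) => h4.
have h5 : (w r + w s) ^+ 2 <= 4 * (N%:R * m2) by lra.
have := ler_wpM2l (sqr_ge0 G) h5; lra.
Qed.

(** Admissibility bounds the multiplier term of [basic_inequality] by B (pen r + pen s), where 16 in
    [B] is 2 times the scaling 8. Since [lambda >= 2 B], half of lambda pen r absorbs it, whence pen
    r <= 3 pen s and |Xu|^2/N <= (3/2) lambda pen s. *)
Lemma oracle_small_noise (L : R) : 0 < L ->
  adm (8^-1 *: ((L * (sigma * Num.sqrt (12 * N%:R)))^-1 *: (X^T *m z))) ->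
  2 * (16 * G * L * Num.sqrt 12) <= lambda ->
  sqnorm2 u <= CI ^+ 2 * (3 * lambda + 24 * G ^+ 2) * pn s.
Proof.
move=> L0 ay lamB; set B := 16 * G * L * Num.sqrt 12 in lamB.
have S0 : 0 < Num.sqrt (N%:R : R) by rewrite sqrtr_gt0.
have S12 : 0 < Num.sqrt (12 : R) by rewrite sqrtr_gt0.
have S2 : Num.sqrt (N%:R : R) ^+ 2 = N%:R by rewrite sqr_sqrtr.
have B0 : 0 < B by rewrite /B; do 3![apply: mulr_gt0 => //].
have l0 : 0 < lambda by lra.
have := adm_dotv_difference_le ay; rewrite !dotvZl dotv_trmx_mul => hd.
have hB : 2 / N%:R * dotv z (X *m u) <= B * (pn r + pn s).
  apply: (@le_trans _ _ (B * (sigma * (w r / Num.sqrt N%:R) + sigma * (w s / Num.sqrt N%:R)))); last first.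
    by rewrite ler_pM2l// lerD// pen_ge_linear.
  rewrite sqrtrM// in hd.
  have t0 : 0 < 8 * (L * (sigma * (Num.sqrt 12 * Num.sqrt N%:R))) * (2 / N%:R).
    by rewrite !mulr_gt0// invr_gt0.
  have := ler_wpM2l (ltW t0) hd.
  set D := dotv _ _ => h5.
  have e1 : 8 * (L * (sigma * (Num.sqrt 12 * Num.sqrt N%:R))) * (2 / N%:R) *
     (8^-1 * ((L * (sigma * (Num.sqrt 12 * Num.sqrt N%:R)))^-1 * D)) = 2 / N%:R * D.
    by field; rewrite !gt_eqF.
  rewrite e1 in h5; apply: le_trans h5 _; rewrite le_eqVlt; apply/orP; left; apply/eqP.
  have e2 : 2 / N%:R = 2 / Num.sqrt N%:R ^+ 2 :> R by rewrite S2.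
  have g0 := gap_const_gt0 R.
  by rewrite e2 /B; field; rewrite !gt_eqF.
have hb := basic_inequality.
have ps0 := pen_ge0 N cbK Ks Ksp p0 sigma0 s.
have pr0 := pen_ge0 N cbK Ks Ksp p0 sigma0 r.
have hl : B * (pn r + pn s) <= lambda / 2 * (pn r + pn s).
  have lB : B <= lambda / 2 by lra.
  by rewrite ler_wpM2r// addr_ge0.
have Q0 : 0 <= sqnorm2 (X *m u) / N%:R by rewrite divr_ge0// sqnorm2_ge0.
have h1 : sqnorm2 (X *m u) / N%:R <= 3 / 2 * lambda * pn s.
  have : 0 <= lambda * pn r by rewrite mulr_ge0// ltW.
  by lra.
have h2 : pn r <= 3 * pn s.
  by rewrite -(ler_pM2l l0); lra.
have := @sqnorm2_difference_le (3 / 2 * lambda * pn s) (3 * pn s).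
have -> : 2 * (3 / 2 * lambda * pn s) + 8 * G ^+ 2 * (3 * pn s) =
  (3 * lambda + 24 * G ^+ 2) * pn s by lra.
rewrite mulrA; apply => //.
- by rewrite !mulr_ge0// ltW.
- by rewrite mulr_ge0.
- by apply: le_trans h2; exact: pen_ge_square.
- by apply: (@le_trans _ _ (pn s)); [exact: pen_ge_square|lra].
Qed.

(** The multiplier term is split as |Xu|^2/(2N) + 2|z|^2/N, which is valid for every [z] at the
    price of the noise energy. *)
Lemma oracle_large_noise : 0 < lambda ->
  sqnorm2 u <= CI ^+ 2 * (4 + 8 * G ^+ 2 / lambda) * (lambda * pn s + 2 * (sqnorm2 z / N%:R)).
Proof.
move=> l0; set M := lambda * _ + _.
have cs : 2 / N%:R * dotv z (X *m u) <=
    sqnorm2 (X *m u) / N%:R / 2 + 2 * (sqnorm2 z / N%:R).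
  have := sqnorm2_ge0 (2^-1 *: (X *m u) - z).
  rewrite sqnorm2D sqnorm2Z sqnorm2N dotvNr dotvZl [dotv _ z]dotvC => h.
  have h' : 2 * dotv z (X *m u) <= sqnorm2 (X *m u) / 2 + 2 * sqnorm2 z by lra.
  have := ler_wpM2r (ltW (eqbRL (invr_gt0 _) NR)) h'; lra.
have hb := basic_inequality.
have ps0 := pen_ge0 N cbK Ks Ksp p0 sigma0 s.
have pr0 := pen_ge0 N cbK Ks Ksp p0 sigma0 r.
have lr0 : 0 <= lambda * pn r by rewrite mulr_ge0// ltW.
have ls0 : 0 <= lambda * pn s by rewrite mulr_ge0// ltW.
have Q0 : 0 <= sqnorm2 (X *m u) / N%:R by rewrite divr_ge0// sqnorm2_ge0.
have z0 : 0 <= sqnorm2 z / N%:R by rewrite divr_ge0// sqnorm2_ge0.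
have M0 : 0 <= M by rewrite /M; lra.
have h1 : sqnorm2 (X *m u) / N%:R <= 2 * M by rewrite /M; lra.
have h2 : pn r <= M / lambda by rewrite ler_pdivlMr// mulrC /M; lra.
have h3 : pn s <= M / lambda by rewrite ler_pdivlMr// mulrC /M; lra.
have := @sqnorm2_difference_le (2 * M) (M / lambda).
have -> : 2 * (2 * M) + 8 * G ^+ 2 * (M / lambda) = (4 + 8 * G ^+ 2 / lambda) * M by ring.
rewrite mulrA; apply => //.
- by rewrite mulr_ge0.
- by rewrite divr_ge0// ltW.
- by apply: le_trans h2; exact: pen_ge_square.
- by apply: le_trans h3; exact: pen_ge_square.
Qed.

End isometry.

Lemma sqnorm2_difference_body : (0 < s)%N ->
  sqnorm2 u <= p%:R * (4 * (G * w s) ^+ 2).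
Proof.
move=> s0; have f1 := flat_height1_le_width cK K0 Ksp p0 Kbd s0.
have f0 := flat_height_ge0 K0 p0 Kbd (ltn0Sn 0).
have hi i : u i 0 * u i 0 <= 4 * (G * w s) ^+ 2.
  have a1 := absv_le_flat_height cK K0 Ksp p0 Kbd i (sparse_hull_sub cK betas).
  have a2 := absv_le_flat_height cK K0 Ksp p0 Kbd i (sparse_hull_sub cK bhr).
  have : `|u i 0| <= 2 * (G * w s).
    by rewrite !mxE; apply: le_trans (ler_normB _ _) _; rewrite /absv in a1 a2; lra.
  move=> h; have -> : u i 0 * u i 0 = `|u i 0| ^+ 2 by rewrite real_normK ?num_real.
  have -> : 4 * (G * w s) ^+ 2 = (2 * (G * w s)) ^+ 2 by ring.
  by rewrite lerXn2r ?nnegrE//; apply: le_trans h.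
rewrite /sqnorm2 /dotv; apply: le_trans (ler_sum _ (fun i _ => hi i)) _.
by rewrite sumr_const card_ord -[leLHS]mulr_natl.
Qed.

End oracle_inequality.

(** The psi_2 norm is an infimum, so [2 * sigma] is used to find some [a] below it that satisfies
    the moment bound. Independence multiplies the N bounds e. *)
Lemma admissible_noise_expR_le (R : realType) (N : nat) (sigma : R)
    (Q : probability 'cV[R]_N R) : 0 < sigma -> admissible_noise sigma Q ->
  (\int[Q]_z (expR (sqnorm2 z / (4 * sigma ^+ 2)))%:E <= (expR N%:R)%:E)%E.
Proof.
move=> s0 [ind _ hQ].
have s4 : 0 < 4 * sigma ^+ 2 by rewrite mulr_gt0// exprn_gt0.
have e z : expR (sqnorm2 z / (4 * sigma ^+ 2)) =
    \prod_(i < N) expR (z i 0 ^+ 2 / (4 * sigma ^+ 2)).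
  by rewrite -expR_sum /sqnorm2 /dotv mulr_suml.
under eq_integral do rewrite e.
have eN : expR N%:R = \prod_(i < N) expR (1 : R).
  by rewrite -expR_sum sumr_const card_ord.
have me : measurable_fun setT (fun x : R => expR (x ^+ 2 / (4 * sigma ^+ 2))).
  apply: measurableT_comp => //; apply: measurable_funM => //; exact: measurable_funX.
have mz (i : 'I_N) : measurable_fun setT (fun z : 'cV[R]_N => z i 0).
  exact: measurable_mx_entry.
rewrite eN; apply: (integral_prod_independent_le mz ind
  (h := fun i (x : R) => expR (x ^+ 2 / (4 * sigma ^+ 2))) (c := fun=> expR 1)) => // i.
have [_ psi] := hQ i.
have : (psi2_norm Q (fun z => z i ord0) < (2 * sigma)%:E)%E.
  by apply: le_lt_trans psi _; rewrite lte_fin; lra.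
move=> /ereal_inf_lt[_ [a [a0 ha] <-]]; rewrite lte_fin => a2.
apply: le_trans ha; rewrite expectation.unlock.
apply: ge0_le_integral_nonmeasurable => z; rewrite lee_fin ?expR_ge0// ler_expR.
rewrite ler_wpM2l ?sqr_ge0// lef_pV2 ?posrE ?exprn_gt0//.
have -> : 4 * sigma ^+ 2 = (2 * sigma) ^+ 2 by ring.
by rewrite lerXn2r ?nnegrE ?mulr_ge0 ?(ltW s0) ?(ltW a0) ?(ltW a2).
Qed.

(** Because x <= 3 exp(x/3) and x/3 <= x - 2n for x >= 3n. At x = |z|^2/(4 sigma^2) and n = N the
    right side has mean at most 3 exp(-N), which pays for noise energy above 12 sigma^2 N. *)
Lemma le_expR_excess (R : realType) (x n : R) : 3 * n < x -> x <= 3 * expR (x - 2 * n).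
Proof.
move=> nx; have h : expR (x / 3) <= expR (x - 2 * n) by rewrite ler_expR; lra.
by have := expR_ge1Dx (x / 3); lra.
Qed.

(** * Expected loss of the penalized estimator *)

Section estimator_risk.
Context d (T : measurableType d) (R : realType) (P : probability T R).
Variables (N p : nat) (X : {RV P >-> 'M[R]_(N, p)}) (L lam : R).
Hypotheses (p0 : (0 < p)%N) (N0 : (0 < N)%N) (L0 : 0 < L) (lam0 : 0 < lam).
Hypothesis indX : mutually_independent P (fun i w => (row i (X w))^T).
Hypothesis sgX : forall i (delta : R) v, sqnorm2 v = 1%R ->
  (\int[P]_w (expR (delta * dotv v (row i (X w))^T))%:E <= (expR (delta ^+ 2 * L ^+ 2 / 2))%:E)%E.
Hypothesis loX : forall i u, sqnorm2 u = 1%R ->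
  (lam%:E <= \int[P]_w (dotv u (row i (X w))^T ^+ 2)%:E)%E.
Variables (K : set 'cV[R]_p) (sigma b lambda : R).
Hypotheses (cbK : convex_body K) (Ks : centrally_symmetric K) (Ksp : sign_perm_invariant K).
Hypotheses (sigma0 : 0 < sigma) (b0 : 0 < b) (Nbp : N%:R <= b * p%:R).
Local Notation w r := (gaussian_width (sparse_hull K r)).
Local Notation pn := (pen N 7 sigma K).
Local Notation G := (4 / gap_const R).
Local Notation CI := (iso_const (48 * L ^+ 2) (lam / 4) (sparse_radius L lam) b).
Hypothesis lambdaG : 2 * (16 * G * L * Num.sqrt 12) <= lambda.
Variables (shat : data R N p -> nat) (bhat : data R N p -> 'cV[R]_p).
Hypothesis opt : penalized_argmin 7 sigma K lambda shat bhat.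
Variables (s : nat) (beta : 'cV[R]_p).
Hypotheses (sp : (1 <= s <= p)%N) (betas : sparse_hull K s beta).
Variable Q : probability 'cV[R]_N R.
Hypothesis admQ : admissible_noise sigma Q.

Let A1 := CI ^+ 2 * (3 * lambda + 24 * G ^+ 2).
Let A2 := CI ^+ 2 * (4 + 8 * G ^+ 2 / lambda).
Let D := p%:R * (4 * (G * w s) ^+ 2).
Let tau := L * (sigma * Num.sqrt (12 * N%:R)).
Let B := [set z : 'cV[R]_N | sqnorm2 z <= 12 * sigma ^+ 2 * N%:R].
(* Truncating the noise makes the bound on the integral of [noise_sum] valid for every [z]. *)
Let tz (z : 'cV[R]_N) := (\1_B z : R) *: z.

Let NR : 0 < N%:R :> R. Proof. by rewrite ltr0n. Qed.
Let G0 : 0 < G. Proof. by rewrite divr_gt0// gap_const_gt0. Qed.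
Let l0 : 0 < lambda.
Proof. by apply: lt_le_trans lambdaG; rewrite !mulr_gt0 ?invr_gt0 ?gap_const_gt0// sqrtr_gt0. Qed.
Let D0 : 0 <= D. Proof. by rewrite /D mulr_ge0// mulr_ge0// sqr_ge0. Qed.
Let A10 : 0 <= A1.
Proof.
apply: mulr_ge0; first exact: sqr_ge0.
by apply: addr_ge0; apply: mulr_ge0; rewrite ?sqr_ge0// ltW.
Qed.
Let A20 : 0 <= A2.
Proof. by rewrite mulr_ge0 ?sqr_ge0// addr_ge0// divr_ge0 ?(ltW l0)// mulr_ge0 ?sqr_ge0. Qed.
Let tau0 : 0 < tau.
Proof. by rewrite !mulr_gt0// sqrtr_gt0 mulr_gt0. Qed.

Let tz_le z : L ^+ 2 * sqnorm2 (tz z) <= tau ^+ 2.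
Proof.
have -> : tau ^+ 2 = L ^+ 2 * (12 * sigma ^+ 2 * N%:R).
  by rewrite /tau !exprMn sqr_sqrtr ?mulr_ge0//; ring.
rewrite ler_pM2l ?exprn_gt0// /tz indicE; have [|_] := boolP (z \in B).
  by rewrite inE scale1r.
by rewrite scale0r /sqnorm2 dotv0r mulr_ge0// mulr_ge0// sqr_ge0.
Qed.

Let mtz : measurable_fun setT tz.
Proof.
have mB : measurable B.
  have := @measurable_sqnorm2 _ _ R N id (@measurable_id _ _ setT) measurableT
    `]-oo, (12 * sigma ^+ 2 * N%:R)]%classic (measurable_itv _).
  rewrite setTI; congr measurable; apply/seteqP; split=> z /=; by rewrite in_itv.
apply/measurable_fun_mxP => i j; under eq_fun do rewrite mxE.
apply: measurable_funM; first exact: measurable_indic.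
exact: measurable_mx_entry.
Qed.

Let c1 := A1 * pn s + A2 * (lambda * pn s).
Let c2 := A2 * (24 * sigma ^+ 2 / N%:R).
(** A measurable majorant of the loss: [c1] is the oracle bound, the term with [c2] pays for large
    noise, and [D] bounds the loss over the whole body. Where an estimate on [X] or on moderate
    noise fails, the three exponential sums add up to more than 1. *)
Let F (wz : T * 'cV[R]_N) : R :=
  (c1 + c2 * expR (sqnorm2 wz.2 / (4 * sigma ^+ 2) - 2 * N%:R)) +
  D * (noise_sum X tau (tz wz.2) wz.1 + lower_sum X L lam wz.1 + upper_sum X L wz.1).

Let pn0 : 0 <= pn s. Proof. exact: pen_ge0. Qed.
Let c10 : 0 <= c1.
Proof.
apply: addr_ge0; first exact: mulr_ge0.
by apply: mulr_ge0 => //; apply: mulr_ge0 => //; exact: ltW.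
Qed.
Let c20 : 0 <= c2. Proof. by rewrite mulr_ge0// divr_ge0// mulr_ge0// sqr_ge0. Qed.

Let loss_le wz :
  sqnorm2 (bhat (X wz.1, X wz.1 *m beta + wz.2) - beta) <= F wz.
Proof.
case: wz => om z; rewrite /F [(om, z).1]/= [(om, z).2]/=.
set dat := (X om, _); have [hs hb ho] := opt dat.
have {ho} := ho s beta sp betas; move: hs hb.
set r := shat dat; set bh := bhat dat => hs hb ho.
set E := c2 * _; have E0 : 0 <= E by rewrite mulr_ge0// expR_ge0.
have n0 : 0 <= noise_sum X tau (tz z) om by exact: sign_sum_ge0.
have lo0 := lower_sum_ge0 X L lam om; have up0 := upper_sum_ge0 X L om.
have s0 : (0 < s)%N by case/andP: sp.
have bad c : 0 <= c -> 1 < c -> sqnorm2 (bh - beta) <= D * c.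
  move=> _ c1'; apply: (@le_trans _ _ D); last by rewrite ler_peMr// ltW.
  exact: (sqnorm2_difference_body cbK Ks Ksp p0 betas hb s0).
have good0 : 0 <= D * (noise_sum X tau (tz z) om + lower_sum X L lam om + upper_sum X L om).
  by rewrite mulr_ge0// !addr_ge0.
have [n1|n1] := leP (noise_sum X tau (tz z) om + lower_sum X L lam om + upper_sum X L om) 1; last first.
  apply: le_trans (bad _ _ n1) _; first by rewrite !addr_ge0.
  by rewrite lerDr addr_ge0.
have lo1 : lower_sum X L lam om <= 1 by lra.
have up1 : upper_sum X L om <= 1 by lra.
have Cu0 : 0 < 48 * L ^+ 2 by rewrite mulr_gt0// exprn_gt0.
have cl0 : 0 < lam / 4 by rewrite divr_gt0.
have ep0 : 0 < sparse_radius L lam 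
  by rewrite /sparse_radius !(divr_gt0, mulr_gt0) ?ltr0n ?exprn_gt0 ?L0 ?lam0.
have [zB|zB] := boolP (z \in B).
  have ez : tz z = z by rewrite /tz indicE zB scale1r.
  have ay : adm (8^-1 *: (tau^-1 *: ((X om)^T *m z))).
    have -> : 8^-1 = (7 + 1)^-1 :> R by congr (_^-1); ring.
    by apply: adm_sign_sum => //; move: n1; rewrite ez /noise_sum; lra.
  have := oracle_small_noise cbK Ks Ksp p0 N0 sigma0 b0 Nbp Cu0 cl0 ep0 betas hb ho
    (fun z => upper_isometry L0 up1) (fun z => lower_isometry L0 lam0 lo1) L0 ay lambdaG.
  rewrite -/A1 => /le_trans; apply.
  apply: (@le_trans _ _ c1); last by rewrite -addrA lerDl addr_ge0.
  by rewrite /c1 lerDl; apply: mulr_ge0 => //; apply: mulr_ge0 => //; exact: ltW.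
have := oracle_large_noise cbK Ks Ksp p0 N0 sigma0 b0 Nbp Cu0 cl0 ep0 betas hb ho
  (fun z => upper_isometry L0 up1) (fun z => lower_isometry L0 lam0 lo1) l0.
rewrite -/A2 => /le_trans; apply.
apply: (@le_trans _ _ (c1 + E)); last by rewrite lerDl.
rewrite mulrDr lerD//; first by rewrite /c1 lerDr mulr_ge0.
rewrite /E /c2 -mulrA ler_wpM2l//.
have zbig : 3 * N%:R < sqnorm2 z / (4 * sigma ^+ 2).
  rewrite ltr_pdivlMr ?mulr_gt0 ?exprn_gt0//.
  have : ~~ (sqnorm2 z <= 12 * sigma ^+ 2 * N%:R).
    by apply: contra zB => h; rewrite inE.
  by rewrite -ltNge; lra.
have := le_expR_excess zbig; rewrite ler_pdivrMr ?mulr_gt0 ?exprn_gt0//.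
set ex := expR _ => h.
have -> : 24 * sigma ^+ 2 / N%:R * ex = 2 * (3 * ex * (4 * sigma ^+ 2) / N%:R) by ring.
by rewrite ler_pM2l// ler_pM2r ?invr_gt0.
Qed.

Lemma estimator_risk_le :
  (risk P X Q beta bhat <= (c1 + c2 + D * (3 * expR (- (2 * lgp R p 1))))%:E)%E.
Proof.
apply: (@le_trans _ _ (\int[(P \x Q)%E]_z (F z)%:E)%E).
  by apply: ge0_le_integral_nonmeasurable => z; rewrite lee_fin ?sqnorm2_ge0// loss_le.
pose e (z : 'cV[R]_N) := expR (sqnorm2 z / (4 * sigma ^+ 2) - 2 * N%:R).
have me : measurable_fun setT e.
  apply: measurableT_comp => //; apply: measurable_funB => //; apply: measurable_funM => //.
  by apply: measurable_sqnorm2; exact: measurable_id.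
have e0 z : 0 <= e z by exact: expR_ge0.
have mns : measurable_fun setT (fun wz : T * 'cV[R]_N => noise_sum X tau (tz wz.2) wz.1).
  apply: measurable_sign_sum; apply: measurable_scalemx; apply: measurable_mulmx.
    apply: measurable_trmx; exact: (measurableT_comp (@measurable_funPT _ _ _ _ X) measurable_fst).
  exact: (measurableT_comp mtz measurable_snd).
have ml := measurable_lower_sum X L lam; have mu := measurable_upper_sum X L.
have mF : measurable_fun setT (fun wz => (F wz)%:E).
  apply/measurable_EFinP; apply: measurable_funD.
    apply: measurable_funD => //; apply: measurable_funM => //.
    exact: (measurableT_comp me measurable_snd).
  apply: measurable_funM => //; apply: measurable_funD; last first.
    exact: (measurableT_comp mu measurable_fst).
  by apply: measurable_funD => //; exact: (measurableT_comp ml measurable_fst).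
have ns0 om z : 0 <= noise_sum X tau z om by exact: sign_sum_ge0.
have lo0 om := lower_sum_ge0 X L lam om; have up0 om := upper_sum_ge0 X L om.
have F0 wz : (0 <= (F wz)%:E)%E.
  rewrite lee_fin; apply: addr_ge0; first by rewrite addr_ge0// mulr_ge0.
  by rewrite mulr_ge0// !addr_ge0.
rewrite fubini_tonelli1// fubini_tonelli//.
set eta := expR (- (2 * lgp R p 1)).
have eta0 : 0 <= eta by exact: expR_ge0.
apply: (@le_trans _ _ (\int[Q]_z (c1 + D * (3 * eta) + c2 * e z)%:E)%E).
  apply: ge0_le_integral_nonmeasurable => z.
    by apply: integral_ge0 => om _; exact: F0.
  rewrite /fubini_G /F/= -/(e z).
  have mn := measurable_noise_sum X tau (tz z).
  rewrite ge0_integralD_EFin//; last 3 first.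
  - by move=> om; rewrite addr_ge0// mulr_ge0.
  - by apply: measurable_funM => //; apply: measurable_funD => //; exact: measurable_funD.
  - by move=> om; rewrite mulr_ge0// !addr_ge0.
  rewrite integral_cst//= probability_setT mule1 -/c1.
  have -> : c1 + D * (3 * eta) + c2 * e z = (c1 + c2 * e z) + D * (3 * eta) by ring.
  rewrite [X in (_ <= X)%E]EFinD; apply: leeD => //.
  rewrite ge0_integralZ_EFin//; last 2 first.
  - by apply: measurable_funD => //; exact: measurable_funD.
  - by move=> om; rewrite !addr_ge0.
  rewrite (EFinM D) lee_wpmul2l ?lee_fin//.
  rewrite ge0_integralD_EFin//; last 2 first.
  - exact: measurable_funD.
  - by move=> om; rewrite addr_ge0.
  rewrite ge0_integralD_EFin//.
  have -> : 3 * eta = eta + eta + eta by ring.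
  rewrite !EFinD !leeD//.
  - exact: (integral_noise_sum_le p0 indX sgX tau0 (tz_le z)).
  - exact: (integral_lower_sum_le p0 L0 lam0 indX sgX loX).
  - exact: (integral_upper_sum_le p0 L0 indX sgX).
rewrite ge0_integralD_EFin//; last 3 first.
- by move=> z; rewrite addr_ge0// mulr_ge0// mulr_ge0.
- exact: measurable_funM.
- by move=> z; rewrite mulr_ge0.
rewrite integral_cst//= probability_setT mule1 -/c1.
have -> : c1 + c2 + D * (3 * eta) = (c1 + D * (3 * eta)) + c2 by ring.
rewrite [X in (_ <= X)%E]EFinD; apply: leeD => //.
rewrite ge0_integralZ_EFin// -[leRHS]mule1 lee_wpmul2l ?lee_fin//.
rewrite /e; under eq_integral do rewrite expRD mulrC.
rewrite ge0_integralZ_EFin ?expR_ge0//; last first.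
  apply: measurableT_comp => //; apply: measurable_funM => //.
  by apply: measurable_sqnorm2; exact: measurable_id.
apply: (@le_trans _ _ ((expR (- (2 * N%:R)))%:E * (expR N%:R)%:E)%E).
  by rewrite lee_wpmul2l ?lee_fin ?expR_ge0// admissible_noise_expR_le.
by rewrite -EFinM lee_fin -expRD expR_le1; have : 0 <= N%:R :> R by []; lra.
Qed.

End estimator_risk.

(** * Comparison of the error terms with the rate *)

Section rate.
Variables (R : realType) (N p s : nat) (K : set 'cV[R]_p) (sigma a b : R).
Hypotheses (cbK : convex_body K) (Ks : centrally_symmetric K) (Ksp : sign_perm_invariant K).
Hypotheses (p0 : (0 < p)%N) (sp : (1 <= s <= p)%N) (sigma0 : 0 < sigma).
Hypotheses (a0 : 0 < a) (b0 : 0 < b) (Nbp : N%:R <= b * p%:R).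
Local Notation w := (gaussian_width (sparse_hull K s)).
Local Notation l := (ell (7 : R) s).
Hypothesis Na : a * Num.max (Num.max
        ((sigma * s%:R * ln (expR 1 * p%:R / s%:R) / w) ^+ 2)
        (w ^+ 2 * l / sigma ^+ 2)) l <= N%:R.

Lemma gaussian_width_gt0 : 0 < w.
Proof.
have cK := convex_body_cvx cbK; have Kbd := convex_body_bounded cbK.
have K0 := convex_body0 cbK Ks; have [s0 _] := andP sp.
have := flat_height1_le_width cK K0 Ksp p0 Kbd s0.
have G0 : 0 < 4 / gap_const R by rewrite divr_gt0// gap_const_gt0.
have f0 := flat_height1_gt0 cbK Ks Ksp p0.
by move=> /(lt_le_trans f0); rewrite pmulr_rgt0.
Qed.

Let w0 := gaussian_width_gt0.
Let l7 : 7 <= l. Proof. exact: ell_ge. Qed.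

Lemma sample_size_gt0 : (0 < N)%N.
Proof.
rewrite -(ltr0n R); apply: lt_le_trans Na; rewrite mulr_gt0// lt_max.
by rewrite (lt_le_trans _ l7) ?orbT.
Qed.

Let NR : 0 < N%:R :> R. Proof. by rewrite ltr0n sample_size_gt0. Qed.
Let A := Num.sqrt a.
Let S := Num.sqrt (N%:R : R).
Let q := Num.sqrt l.
Let A0 : 0 < A. Proof. by rewrite sqrtr_gt0. Qed.
Let S0 : 0 < S. Proof. by rewrite sqrtr_gt0. Qed.
Let q1 : 1 <= q. Proof. by rewrite -[leLHS]sqrtr1 ler_wsqrtr//; move: l7; lra. Qed.
Let q0 : 0 < q. Proof. exact: lt_le_trans q1. Qed.
Let A2 : A ^+ 2 = a. Proof. by rewrite sqr_sqrtr// ltW. Qed.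
Let S2 : S ^+ 2 = N%:R. Proof. by rewrite sqr_sqrtr. Qed.
Let q2 : q ^+ 2 = l. Proof. by rewrite sqr_sqrtr//; move: l7; lra. Qed.

Lemma sample_size_ell : A * q <= S.
Proof.
have h0 : 0 <= A * q by exact/ltW/mulr_gt0.
rewrite -(@ler_pXn2r _ 2) ?nnegrE ?(ltW S0)// exprMn A2 q2 S2.
by apply: le_trans Na; rewrite ler_pM2l// le_max lexx orbT.
Qed.

Lemma sample_size_width : A * (w * q) <= sigma * S.
Proof.
have h1 : 0 <= A * (w * q) by apply/ltW/mulr_gt0 => //; exact: mulr_gt0.
have h2 : 0 <= sigma * S by exact/ltW/mulr_gt0.
rewrite -(@ler_pXn2r _ 2) ?nnegrE// !exprMn A2 q2 S2.
have := Na; rewrite -ler_pdivlMl// !ge_max => /andP[/andP[_ h] _].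
rewrite ler_pdivrMr ?exprn_gt0// in h.
have -> : sigma ^+ 2 * N%:R = a * (a^-1 * N%:R * sigma ^+ 2) by field; rewrite gt_eqF.
by rewrite ler_pM2l.
Qed.

Lemma sample_size_noise : A * (sigma * s%:R) <= w * S.
Proof.
have sR : 0 < s%:R :> R by rewrite ltr0n; case/andP: sp.
have h1 : 0 <= A * (sigma * s%:R) by apply/ltW/mulr_gt0 => //; exact: mulr_gt0.
have h0 : 0 <= w * S by exact/ltW/mulr_gt0.
rewrite -(@ler_pXn2r _ 2) ?nnegrE// !exprMn -exprMn A2 S2.
have := Na; rewrite -ler_pdivlMl// !ge_max => /andP[/andP[h _] _].
have h2 : sigma * s%:R / w <= sigma * s%:R * ln (expR 1 * p%:R / s%:R) / w.
  rewrite ler_pM2r ?invr_gt0// ler_peMr// ?mulr_ge0 ?(ltW sigma0)//.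
  by rewrite -/(lgp R p s) lgp_ge1.
have h3 : 0 <= sigma * s%:R / w by rewrite divr_ge0 ?mulr_ge0// ltW.
have h4 := le_trans h3 h2.
have h5 : (sigma * s%:R / w) ^+ 2 <= a^-1 * N%:R by apply: le_trans h; rewrite lerXn2r ?nnegrE.
rewrite expr_div_n ler_pdivrMr ?exprn_gt0// in h5.
have -> : w ^+ 2 * N%:R = a * (a^-1 * N%:R * w ^+ 2) by field; rewrite gt_eqF.
by rewrite ler_pM2l.
Qed.

(** The leading term of the penalty; its factor [q] is the sqrt(ell) of the theorem. *)
Definition rate : R := sigma * w * q / S.

Lemma rate_gt0 : 0 < rate.
Proof. by rewrite /rate divr_gt0// !mulr_gt0. Qed.

Lemma pen_le_rate : pen N 7 sigma K s <= (1 + 2 / A) * rate.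
Proof.
rewrite /pen -/q -/S -q2 -S2.
have h1 := sample_size_ell; have h2 := sample_size_width.
have e1 : sigma * (w * q ^+ 2 / S ^+ 2) <= rate / A.
  rewrite ler_pdivlMr//.
  have -> : sigma * (w * q ^+ 2 / S ^+ 2) * A = rate * ((A * q) / S).
    by rewrite /rate; field; rewrite gt_eqF.
  by rewrite ler_piMr ?(ltW rate_gt0)// ler_pdivrMr// mul1r.
have e2 : w ^+ 2 * q ^+ 2 / S ^+ 2 <= rate / A.
  rewrite ler_pdivlMr//.
  have -> : w ^+ 2 * q ^+ 2 / S ^+ 2 * A = w * q / S ^+ 2 * (A * (w * q)) by ring.
  have -> : rate = w * q / S ^+ 2 * (sigma * S) by rewrite /rate; field; rewrite gt_eqF.
  by rewrite ler_wpM2l// divr_ge0 ?sqr_ge0// mulr_ge0 ?ltW.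
have e3 : sigma * (w * q / S) = rate by rewrite /rate; ring.
have e4 : (1 + 2 / A) * rate = rate + rate / A + rate / A by ring.
by rewrite mulrDr e3 e4 !lerD.
Qed.

Lemma noise_le_rate : sigma ^+ 2 / N%:R <= A^-1 * rate.
Proof.
rewrite -S2 mulrC ler_pdivlMl//.
have -> : A * ((S ^+ 2)^-1 * sigma ^+ 2) = sigma / S ^+ 2 * (A * sigma) by ring.
apply: (@le_trans _ _ (sigma / S ^+ 2 * (w * S))).
  rewrite ler_wpM2l//; first by rewrite divr_ge0 ?sqr_ge0// ltW.
  apply: le_trans sample_size_noise; rewrite ler_pM2l// ler_peMr ?(ltW sigma0)//.
  by rewrite ler1n; case/andP: sp.
have -> : sigma / S ^+ 2 * (w * S) = sigma * w / S by field; rewrite gt_eqF.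
by rewrite /rate ler_pM2r ?invr_gt0// ler_peMr// mulr_ge0 ?ltW.
Qed.

Lemma expR_lgp1_le : expR (- (2 * lgp R p 1)) <= (p%:R ^+ 2)^-1.
Proof.
have pR : 0 < p%:R :> R by rewrite ltr0n.
have e1 : 1 <= expR 1 :> R by rewrite -[leLHS]expR0 ler_expR.
have ep : 0 < expR 1 * p%:R :> R by rewrite mulr_gt0// expR_gt0.
have e2 : expR (2 * ln (expR 1 * p%:R)) = (expR 1 * p%:R) ^+ 2 :> R.
  by rewrite mulr2n mulrDl mul1r expRD lnK ?posrE// expr2.
rewrite lgp1 expRN e2 lef_pV2 ?posrE ?exprn_gt0//.
by rewrite lerXn2r ?nnegrE ?(ltW ep)// ler_peMl// ltW.
Qed.

(** The factor (ep)^-2 turns p w^2 into w^2/p <= b w^2/N, and [sample_size_width] replaces one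
    factor w by sigma sqrt(N)/A. *)
Lemma bad_event_le_rate (G : R) :
  p%:R * (4 * (G * w) ^+ 2) * (3 * expR (- (2 * lgp R p 1))) <= 12 * G ^+ 2 * b / A * rate.
Proof.
have pR : 0 < p%:R :> R by rewrite ltr0n.
have G2 : 0 <= G ^+ 2 by exact: sqr_ge0.
have w2 : 0 <= w ^+ 2 by exact: sqr_ge0.
apply: (@le_trans _ _ (p%:R * (4 * (G * w) ^+ 2) * (3 * (p%:R ^+ 2)^-1))).
  by rewrite ler_wpM2l ?ler_pM2l ?expR_lgp1_le// mulr_ge0// mulr_ge0// sqr_ge0.
have -> : p%:R * (4 * (G * w) ^+ 2) * (3 * (p%:R ^+ 2)^-1) = 12 * G ^+ 2 * (w ^+ 2 / p%:R).
  by field; rewrite gt_eqF.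
have g0 : 0 <= 12 * G ^+ 2 by rewrite mulr_ge0.
rewrite -[leRHS]mulrA -[leRHS]mulrA ler_wpM2l//.
have h1 : (p%:R)^-1 <= b / S ^+ 2.
  by rewrite S2 -div1r ler_pdivrMr// mulrAC ler_pdivlMr// mul1r.
apply: (@le_trans _ _ (w ^+ 2 * (b / S ^+ 2))); first by rewrite ler_wpM2l.
have -> : b * (A^-1 * rate) = b / S ^+ 2 * (A^-1 * (w * (sigma * S * q))).
  by rewrite /rate; field; rewrite !gt_eqF.
rewrite mulrC ler_wpM2l ?divr_ge0 ?sqr_ge0 ?(ltW b0)//.
rewrite ler_pdivlMl// expr2 [leLHS]mulrCA ler_pM2l//.
apply: (@le_trans _ _ (sigma * S)); last by rewrite ler_peMr// mulr_ge0 ?(ltW sigma0) ?(ltW S0).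
by apply: le_trans sample_size_width; rewrite ler_pM2l// ler_peMr// ltW.
Qed.

End rate.

(** * Lower bound for the minimax risk *)

Section gaussian_noise.
Variables (R : realType) (N : nat) (tau : R).
Hypothesis tau0 : 0 < tau.
Local Notation gam := (normal_prob 0%R 1%R : probability (measurableTypeR R) R).

Let scale_noise (g : 'cV[R]_N) : 'cV[R]_N := tau *: g.

Lemma measurable_scale_noise : measurable_fun setT scale_noise.
Proof. by apply: measurable_scalemx; exact: measurable_id. Qed.

HB.instance Definition _ := isMeasurableFun.Build _ _ _ _ scale_noise measurable_scale_noise.

Definition gaussian_noise : probability 'cV[R]_N R :=
  distribution (std_gaussian R N) scale_noise.

Local Open Scope ereal_scope.

Lemma integral_gaussian_noise (f : 'cV[R]_N -> \bar R) : measurable_fun setT f ->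
  (forall z, 0 <= f z) ->
  \int[gaussian_noise]_z f z = \int[std_gaussian R N]_g f (tau *: g)%R.
Proof. by move=> mf f0; rewrite ge0_integral_distribution. Qed.

Lemma integral_gaussian_noise_coord (i : 'I_N) (f : R -> \bar R) : measurable_fun setT f ->
  (forall x, 0 <= f x) ->
  \int[gaussian_noise]_z f (z i ord0) = \int[gam]_x f (tau * x)%R.
Proof.
move=> mf f0; rewrite (integral_gaussian_noise (f := fun z => f (z i ord0)))//; last first.
  exact: (measurableT_comp mf (measurable_mx_entry i ord0)).
under eq_integral do rewrite mxE.
rewrite (integral_std_gaussian_coord i (f := fun x => f (tau * x)%R))//.
by apply: (measurableT_comp mf); exact: measurable_funM.
Qed.

Let mscale (B : set R) : measurable B -> measurable [set x : R | B (tau * x)%R].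
Proof.
move=> mB; have mt : measurable_fun [set: R] (fun x : R => tau * x)%R by exact: measurable_funM.
by have := mt measurableT B mB; rewrite setTI.
Qed.

Let gaussian_noise_coord (i : 'I_N) (B : set R) : measurable B ->
  gaussian_noise [set z | B (z i ord0)] = gam [set x | B (tau * x)%R].
Proof.
move=> mB; rewrite -(std_gaussian_coord i (mscale mB)).
rewrite /gaussian_noise /distribution /pushforward; congr (std_gaussian R N _).
by apply/seteqP; split=> z /=; rewrite mxE.
Qed.

(** The positive and negative parts have the same integral by symmetry of the normal law, and it is
    finite, so the difference is 0. *)
Let mean_zero_gaussian_noise (i : 'I_N) : 'E_gaussian_noise[fun z => z i ord0] = 0.
Proof.
rewrite expectation.unlock integralE.
have mM : measurable_fun setT (fun x : R => (Num.max x 0)%:E).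
  by apply/measurable_EFinP; exact: measurable_maxr.
have mMN : measurable_fun setT (fun x : R => (Num.max (- x) 0)%:E)%R.
  by apply/measurable_EFinP; apply: measurable_maxr => //; exact: oppr_measurable.
have M0 (x : R) : 0 <= (Num.max x 0)%:E by rewrite lee_fin le_max lexx orbT.
have -> : \int[gaussian_noise]_z (fun z : 'cV[R]_N => (z i ord0)%:E)^\+ z =
    \int[gam]_x (Num.max (tau * x) 0)%:E.
  rewrite -(integral_gaussian_noise_coord i mM M0); apply: eq_integral => z _.
  by rewrite funeposE -EFin_max.
have -> : \int[gaussian_noise]_z (fun z : 'cV[R]_N => (z i ord0)%:E)^\- z =
    \int[gam]_x (Num.max (- (tau * x)) 0)%:E.
  rewrite -(integral_gaussian_noise_coord i mMN (fun x => M0 (- x)%R)); apply: eq_integral => z _.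
  by rewrite funenegE -EFinN -EFin_max.
have mMt : measurable_fun setT (fun x : R => (Num.max (tau * x) 0)%:E).
  by apply/measurable_EFinP; apply: measurable_maxr => //; exact: measurable_funM.
have -> : \int[gam]_x (Num.max (- (tau * x)) 0)%:E = \int[gam]_x (Num.max (tau * x) 0)%:E.
  rewrite -(std_normal_opp mMt (fun x => M0 _)).
  by apply: eq_integral => x _; rewrite mulrN.
rewrite subee// ge0_fin_numE; last by apply: integral_ge0.
apply: (@le_lt_trans _ _ (\int[gam]_x ((tau * 2) * expR (x ^+ 2 / 4))%:E)).
  apply: ge0_le_integral_nonmeasurable => x//; rewrite lee_fin ge_max; apply/andP; split.
    rewrite -mulrA ler_pM2l//; have := expR_ge1Dx (x ^+ 2 / 4)%R.
    by have := sqr_ge0 (x - 1)%R; have := sqr_ge0 (x - 2)%R; lra.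
  by rewrite mulr_ge0 ?expR_ge0// mulr_ge0// ltW.
have m4 : measurable_fun [set: R] (fun x : R => expR (x ^+ 2 / 4)).
  by apply: measurableT_comp => //; apply: measurable_funM => //; exact: measurable_funX.
rewrite ge0_integralZ_EFin//; last by rewrite mulr_ge0// ltW.
by rewrite lte_mul_pinfty ?lee_fin// ?mulr_ge0 ?(ltW tau0)// (le_lt_trans (std_normal_expR_sqr R))// ltry.
Qed.

Let psi2_gaussian_noise (i : 'I_N) :
  psi2_norm gaussian_noise (fun z => z i ord0) <= (2 * tau)%:E.
Proof.
apply: ereal_inf_lbound; exists (2 * tau)%R => //; split; first by rewrite mulr_gt0.
rewrite expectation.unlock.
have m4 : measurable_fun [set: R] (fun x : R => (expR (x ^+ 2 / (2 * tau) ^+ 2))%:E).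
  by apply/measurable_EFinP; apply: measurableT_comp => //; apply: measurable_funM.
rewrite (integral_gaussian_noise_coord i (f := fun x => (expR (x ^+ 2 / (2 * tau) ^+ 2))%:E))//.
rewrite [X in X <= _](_ : _ = \int[gam]_x (expR (x ^+ 2 / 4))%:E); first exact: std_normal_expR_sqr.
apply: eq_integral => x _; congr (expR _)%:E; field.
by rewrite gt_eqF.
Qed.

Lemma gaussian_noise_admissible (sigma : R) : sigma = (2 * tau)%R ->
  admissible_noise sigma gaussian_noise.
Proof.
move=> ->; split.
- move=> J A mA.
  transitivity (std_gaussian R N (\bigcap_(i in [set` J]) [set z | [set x | A i (tau * x)%R] (z i ord0)])).
    rewrite /gaussian_noise /distribution /pushforward; congr (std_gaussian R N _).
    by apply/seteqP; split=> z h i iJ; have := h i iJ; rewrite /= mxE.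
  apply: (eq_trans (std_gaussian_boxJ J (fun i => mscale (mA i)))).
  by apply: eq_bigr => i _; exact/esym/(gaussian_noise_coord i (mA i)).
- by move=> i j A mA; exact: (eq_trans (gaussian_noise_coord i mA) (esym (gaussian_noise_coord j mA))).
- by move=> i; split; [exact: mean_zero_gaussian_noise|exact: psi2_gaussian_noise].
Qed.

End gaussian_noise.

(** Minimizing the first two terms over [th] gives 4 t^2 x^2 y^2/(x^2 + y^2); the inequality of
    arithmetic and geometric means with the third term gives the left side. Multiplied by x^2 + y^2,
    the difference is a sum of two squares. *)
Lemma two_point_weights (R : realType) (th t x y : R) : 0 < x -> 0 < y ->
  2 * t ^+ 2 * (x * y) <=
  (th - t) ^+ 2 * x ^+ 2 + (th + t) ^+ 2 * y ^+ 2 + t ^+ 2 * (x ^+ 2 + y ^+ 2) / 4.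
Proof.
move=> x0 y0; have S0 : 0 < x ^+ 2 + y ^+ 2 by rewrite addr_gt0 ?exprn_gt0.
rewrite -(ler_pM2l S0) -subr_ge0.
rewrite [X in 0 <= X](_ : _ =
  ((x ^+ 2 + y ^+ 2) * th - t * (x ^+ 2 - y ^+ 2)) ^+ 2 +
  (t * (2 * (x * y) - (x ^+ 2 + y ^+ 2) / 2)) ^+ 2); last by field.
by rewrite addr_ge0 ?sqr_ge0.
Qed.

(** * Two-point bound for Gaussian shifts *)

Section two_point.
Variables (R : realType) (N : nat).
Local Open Scope ereal_scope.
Local Notation G := (std_gaussian R N).

(** The two-point method in Hellinger form: in [two_point_weights], x^2 and y^2 are the densities of
    the laws shifted by D and -D, and x y = exp(-|D|^2/2) does not depend on g. The exponential is
    linearized so that a random [D] can be averaged through its second moment. *)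
Lemma gaussian_two_point (f : 'cV[R]_N -> R) (D : 'cV[R]_N) (t : R) :
  measurable_fun setT f ->
  (3 / 2 * t ^+ 2)%:E <=
  \int[G]_g ((f (g + D) - t) ^+ 2)%R%:E + \int[G]_g ((f (g - D) + t) ^+ 2)%R%:E
  + (t ^+ 2 * sqnorm2 D)%:E.
Proof.
move=> mf; pose W (E g : 'cV[R]_N) : R := expR (dotv E g - sqnorm2 E / 2).
have W0 E g : (0 <= W E g)%R by exact: expR_ge0.
have mW E : measurable_fun setT (W E).
  apply: measurableT_comp => //; apply: measurable_funB => //.
  by apply: measurable_dotv => //; exact: measurable_id.
have iW E : \int[G]_g (W E g)%:E = 1.
  rewrite /W; under eq_integral do rewrite expRD mulrC.
  rewrite ge0_integralZ_EFin ?expR_ge0//; last first.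
    by apply: measurableT_comp => //; apply: measurable_dotv => //; exact: measurable_id.
  by rewrite std_gaussian_expR_dotv -EFinM -expRD addrC subrr expR0.
have shift E (c : R) : \int[G]_g ((f (g + E) + c) ^+ 2)%R%:E =
    \int[G]_g ((f g + c) ^+ 2 * W E g)%:E.
  have h := @std_gaussian_shift R N E (fun z => ((f z + c) ^+ 2)%:E).
  rewrite h//; last 2 first.
  - by apply/measurable_EFinP; apply: measurable_funX; exact: measurable_funD.
  - by move=> z; rewrite lee_fin sqr_ge0.
have mfc (c : R) E : measurable_fun setT (fun g => (f g + c) ^+ 2 * W E g)%R.
  by apply: measurable_funM => //; apply: measurable_funX; exact: measurable_funD.
have f0 (c : R) E g : (0 <= (f g + c) ^+ 2 * W E g)%R by rewrite mulr_ge0// sqr_ge0.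
have t0 : (0 <= t ^+ 2)%R by exact: sqr_ge0.
have q0 : (0 <= t ^+ 2 / 4)%R by rewrite divr_ge0.
rewrite (shift D (- t)%R) (shift (- D)%R t).
set I1 := \int[G]_g _; set I2 := \int[G]_g _.
have key : (2 * t ^+ 2 * expR (- (sqnorm2 D / 2)))%:E <= I1 + I2 + (t ^+ 2 / 2)%:E.
  have -> : (t ^+ 2 / 2)%:E = \int[G]_g (t ^+ 2 / 4 * (W D g + W (- D)%R g))%:E.
    rewrite ge0_integralZ_EFin//; last 2 first.
    - exact: measurable_funD.
    - by move=> g; rewrite addr_ge0.
    by rewrite ge0_integralD_EFin// !iW -EFinD -EFinM; congr EFin; field.
  rewrite /I1 /I2 -ge0_integralD_EFin// -ge0_integralD_EFin; last 4 first.
  - exact: measurable_funD.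
  - by move=> g; rewrite addr_ge0.
  - by apply: measurable_funM => //; exact: measurable_funD.
  - by move=> g; rewrite mulr_ge0// addr_ge0.
  rewrite -[leLHS]mule1 -[X in _ * X](@probability_setT _ _ _ G) -integral_cst//.
  apply: ge0_le_integral_nonmeasurable => g; rewrite lee_fin /=.
    by rewrite mulr_ge0 ?expR_ge0// mulr_ge0.
  have wE E : W E g = (expR ((dotv E g - sqnorm2 E / 2) / 2) ^+ 2)%R.
    by rewrite expr2 -expRD /W; congr expR; field.
  rewrite !wE sqnorm2N dotvNl.
  have := @two_point_weights R (f g) t _ _ (expR_gt0 ((dotv D g - sqnorm2 D / 2) / 2))
    (expR_gt0 ((- dotv D g - sqnorm2 D / 2) / 2)).
  rewrite -expRD.
  have -> : ((dotv D g - sqnorm2 D / 2) / 2 + (- dotv D g - sqnorm2 D / 2) / 2 = - (sqnorm2 D / 2))%R by field.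
  by rewrite [(t ^+ 2 * _ / 4)%R]mulrAC.
have e1 := expR_ge1Dx (- (sqnorm2 D / 2))%R.
have e2 := ler_wpM2l t0 e1.
have h3 : (3 / 2 * t ^+ 2 + t ^+ 2 / 2 <= 2 * t ^+ 2 * expR (- (sqnorm2 D / 2)) + t ^+ 2 * sqnorm2 D)%R by lra.
have I10 : 0 <= I1 by apply: integral_ge0 => g _; rewrite lee_fin.
have I20 : 0 <= I2 by apply: integral_ge0 => g _; rewrite lee_fin.
have := adde_ge0 I10 I20; move: (I1 + I2) key => -[r| |]// key _.
  by move: key; rewrite -!EFinD !lee_fin; lra.
by rewrite addye// leey.
Qed.

End two_point.

(** * Assouad's lemma in the regression model *)

Section assouad.
Context d (T : measurableType d) (R : realType) (P : probability T R).
Variables (N p : nat) (X : {RV P >-> 'M[R]_(N, p)}) (lam tau : R).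
Hypothesis tau0 : 0 < tau.
Local Open Scope ereal_scope.
Hypothesis hiX : forall i v,
  \int[P]_w (dotv v (row i (X w))^T ^+ 2)%:E <= (lam * sqnorm2 v)%:E.
Variable est : data R N p -> 'cV[R]_p.
Hypothesis mest : measurable_fun setT est.
Local Notation G := (std_gaussian R N).

Let mX : measurable_fun setT X. Proof. exact: measurable_funPT. Qed.

Definition coord_risk (beta : 'cV[R]_p) (j : 'I_p) : \bar R :=
  \int[(P \x G)%E]_z ((est (X z.1, X z.1 *m beta + tau *: z.2) - beta) j ord0 ^+ 2)%R%:E.

Let mres beta : measurable_fun setT (fun z : T * 'cV[R]_N =>
  est (X z.1, X z.1 *m beta + tau *: z.2) - beta)%R.
Proof.
apply: measurable_mxD => //; apply: (measurableT_comp mest).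
apply: measurable_fun_pair; first exact: (measurableT_comp mX measurable_fst).
apply: measurable_mxD.
  apply: measurable_mulmx => //; exact: (measurableT_comp mX measurable_fst).
by apply: measurable_scalemx; exact: measurable_snd.
Qed.

Let mres_coord beta (j : 'I_p) : measurable_fun setT (fun z : T * 'cV[R]_N =>
  (est (X z.1, X z.1 *m beta + tau *: z.2) - beta) j ord0 ^+ 2)%R.
Proof.
apply: measurable_funX; exact: (proj1 (measurable_fun_mxP _) (mres beta) j ord0).
Qed.

Lemma integral_sqnorm2_design v :
  \int[P]_w (sqnorm2 (X w *m v))%:E <= (N%:R * (lam * sqnorm2 v))%:E.
Proof.
have e w : sqnorm2 (X w *m v) = (\sum_(i < N) dotv v (row i (X w))^T ^+ 2)%R.
  by apply: eq_bigr => i _; rewrite mulmx_rowE expr2.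
under eq_integral do rewrite e.
rewrite ge0_integral_sum_EFin; last 2 first.
- move=> i; apply: measurable_funX; apply: measurable_dotv => //.
  by apply: measurable_trmx; exact: measurable_row.
- by move=> i w; exact: sqr_ge0.
apply: (@le_trans _ _ (\sum_(i < N) (lam * sqnorm2 v)%:E)); first by apply: lee_sum.
by rewrite sumEFin lee_fin sumr_const card_ord mulr_natl.
Qed.

(** Given [X], the two hypotheses correspond to shifts by D and -D with D = Xv/tau. Averaged over
    [X], the term t^2 |D|^2 is at most t^2, so 3/2 - 1 = 1/2 remains. *)
Lemma coord_risk_pair (b v : 'cV[R]_p) (j : 'I_p) : b j 0%R = 0%R ->
  (N%:R * (lam * sqnorm2 v) <= tau ^+ 2)%R ->
  (v j 0 ^+ 2 / 2)%R%:E <= coord_risk (b + v)%R j + coord_risk (b - v)%R j.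
Proof.
move=> bj vN; set t := v j 0%R.
have mv : measurable_fun setT (fun w => sqnorm2 (X w *m v)).
  by apply: measurable_sqnorm2; exact: measurable_mulmx.
have c0 : (0 <= t ^+ 2 * tau ^- 2)%R by rewrite mulr_ge0 ?sqr_ge0// invr_ge0 sqr_ge0.
pose FF beta := fubini_F G (fun z : T * 'cV[R]_N =>
  ((est (X z.1, X z.1 *m beta + tau *: z.2) - beta) j ord0 ^+ 2)%R%:E).
have m2 beta : measurable_fun setT (fun z : T * 'cV[R]_N =>
    ((est (X z.1, X z.1 *m beta + tau *: z.2) - beta) j ord0 ^+ 2)%R%:E).
  by apply/measurable_EFinP; exact: mres_coord.
have p2 beta (z : T * 'cV[R]_N) :
    0 <= ((est (X z.1, X z.1 *m beta + tau *: z.2) - beta) j ord0 ^+ 2)%R%:E.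
  by rewrite lee_fin sqr_ge0.
have mF beta : measurable_fun setT (FF beta) by exact: measurable_fun_fubini_tonelli_F.
have F0 beta w : 0 <= FF beta w by apply: integral_ge0 => z _; exact: p2.
have crE beta : coord_risk beta j = \int[P]_w FF beta w by exact: fubini_tonelli1.
have h : (3 / 2 * t ^+ 2)%:E <= coord_risk (b + v)%R j + coord_risk (b - v)%R j +
    \int[P]_w (t ^+ 2 * tau ^- 2 * sqnorm2 (X w *m v))%:E.
  have mD : measurable_fun setT (FF (b + v)%R \+ FF (b - v)%R) by exact: emeasurable_funD.
  have D0 w : 0 <= (FF (b + v)%R \+ FF (b - v)%R) w by exact: adde_ge0.
  have mS : measurable_fun setT (fun w => (t ^+ 2 * tau ^- 2 * sqnorm2 (X w *m v))%:E).
    by apply/measurable_EFinP; exact: measurable_funM.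
  have S0 w : 0 <= (t ^+ 2 * tau ^- 2 * sqnorm2 (X w *m v))%:E.
    by rewrite lee_fin mulr_ge0// sqnorm2_ge0.
  rewrite !crE -(ge0_integralD _ _ (fun w _ => F0 _ w) (mF _) (fun w _ => F0 _ w) (mF _))//.
  rewrite -(ge0_integralD _ _ (fun w _ => D0 w) mD (fun w _ => S0 w) mS)//.
  rewrite -[leLHS]mule1 -[X in _ * X](@probability_setT _ _ _ P) -integral_cst//.
  apply: ge0_le_integral_nonmeasurable => w.
    by rewrite lee_fin mulr_ge0// sqr_ge0.
  rewrite /FF /fubini_F/=.
  pose f (g : 'cV[R]_N) : R := est (X w, X w *m b + tau *: g)%R j ord0.
  have mf : measurable_fun setT f.
    apply: (measurableT_comp (measurable_mx_entry j ord0)); apply: (measurableT_comp mest).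
    apply: measurable_fun_pair; first exact: measurable_cst.
    apply: measurable_mxD => //; apply: measurable_scalemx; exact: measurable_id.
  have := @gaussian_two_point R N f (tau^-1 *: (X w *m v))%R t mf.
  rewrite sqnorm2Z exprVn mulrA => /le_trans; apply.
  rewrite le_eqVlt; apply/orP; left; apply/eqP; congr (_ + _ + _).
  - apply: eq_integral => g _; rewrite /f scalerDr scalerA mulfV ?gt_eqF// scale1r.
    rewrite mulmxDr addrA addrAC; congr (_ ^+ 2)%:E.
    by rewrite [RHS]mxE; congr (_ + _)%R; rewrite mxE mxE bj add0r.
  - apply: eq_integral => g _; rewrite /f scalerDr scalerN scalerA mulfV ?gt_eqF// scale1r.
    rewrite mulmxBr addrA addrAC; congr (_ ^+ 2)%:E.
    by rewrite [RHS]mxE; congr (_ + _)%R; rewrite !mxE bj add0r opprK.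
have h2 : \int[P]_w (t ^+ 2 * tau ^- 2 * sqnorm2 (X w *m v))%:E <= (t ^+ 2)%:E.
  rewrite ge0_integralZ_EFin//; last by move=> w; exact: sqnorm2_ge0.
  apply: (@le_trans _ _ ((t ^+ 2 * tau ^- 2)%:E * (tau ^+ 2)%:E)).
    rewrite lee_wpmul2l ?lee_fin//; apply: le_trans (integral_sqnorm2_design v) _.
    by rewrite lee_fin.
  by rewrite -EFinM lee_fin mulfVK// expf_neq0// gt_eqF.
have r0 beta : 0 <= coord_risk beta j.
  by apply: integral_ge0 => z _; rewrite lee_fin sqr_ge0.
have : (3 / 2 * t ^+ 2)%:E <= coord_risk (b + v)%R j + coord_risk (b - v)%R j + (t ^+ 2)%:E.
  by apply: le_trans h _; rewrite leeD2l.
have := adde_ge0 (r0 (b + v)%R) (r0 (b - v)%R).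
move: (coord_risk _ _ + coord_risk _ _) => -[r| |]// _; last by move=> _; exact: leey.
by rewrite -EFinD !lee_fin; lra.
Qed.

Definition cube_vertex (m : nat) (t : R) (eps : {ffun 'I_p -> bool}) : 'cV[R]_p :=
  (\col_i (if (i < m)%N then (-1) ^+ eps i * t else 0))%R.

Let flip (j : 'I_p) (eps : {ffun 'I_p -> bool}) : {ffun 'I_p -> bool} :=
  [ffun i => if i == j then ~~ eps i else eps i].

Let flipK j : involutive (flip j).
Proof. by move=> eps; apply/ffunP => i; rewrite !ffunE; case: eqP => // _; rewrite negbK. Qed.

Lemma sum_coord_risk_le_risk m beta : (m <= p)%N ->
  \sum_(j < p | (j < m)%N) coord_risk beta j <=
  risk P X (gaussian_noise N tau) beta est.
Proof.
move=> mp; have mh : measurable_fun setT (fun z : T * 'cV[R]_N =>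
    (sqnorm2 (est (X z.1, X z.1 *m beta + z.2) - beta))%:E).
  apply/measurable_EFinP; apply: measurable_sqnorm2; apply: measurable_mxD => //.
  apply: (measurableT_comp mest); apply: measurable_fun_pair.
    exact: (measurableT_comp mX measurable_fst).
  apply: measurable_mxD; last exact: measurable_snd.
  apply: measurable_mulmx => //; exact: (measurableT_comp mX measurable_fst).
have h0 (z : T * 'cV[R]_N) : 0 <= (sqnorm2 (est (X z.1, X z.1 *m beta + z.2) - beta))%:E.
  by rewrite lee_fin sqnorm2_ge0.
rewrite /risk fubini_tonelli1//.
have -> : \int[P]_w fubini_F (gaussian_noise N tau) (fun z : T * 'cV[R]_N =>
    (sqnorm2 (est (X z.1, X z.1 *m beta + z.2) - beta))%:E) w =
  \int[(P \x G)%E]_z (sqnorm2 (est (X z.1, X z.1 *m beta + tau *: z.2) - beta)%R)%:E.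
  rewrite fubini_tonelli1//; last 2 first.
  - by apply/measurable_EFinP; apply: measurable_sqnorm2; exact: mres.
  - by move=> z; rewrite lee_fin sqnorm2_ge0.
  apply: eq_integral => w _; rewrite /fubini_F.
  rewrite (integral_gaussian_noise tau (f := fun z =>
    (sqnorm2 (est (X w, X w *m beta + z) - beta))%:E))//.
  - apply/measurable_EFinP; apply: measurable_sqnorm2; apply: measurable_mxD => //.
    apply: (measurableT_comp mest); apply: measurable_fun_pair; first exact: measurable_cst.
    by apply: measurable_mxD => //; exact: measurable_id.
  - by move=> z; rewrite lee_fin sqnorm2_ge0.
rewrite /coord_risk -ge0_integral_sum_EFin//; last by move=> j z; exact: sqr_ge0.
apply: ge0_le_integral_nonmeasurable => z; rewrite lee_fin.
  by apply: sumr_ge0 => j _; exact: sqr_ge0.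
rewrite /sqnorm2 /dotv [leRHS](bigID (fun j : 'I_p => (j < m)%N))/= -[leLHS]addr0.
rewrite lerD//; last by apply: sumr_ge0 => j _; rewrite -expr2 sqr_ge0.
Qed.

(** Average over all vertices. For each j < m a vertex is paired with the one flipped at j; their
    midpoint vanishes at j, and [coord_risk_pair] bounds the two coordinate risks together. *)
Lemma assouad (B : set 'cV[R]_p) (sigma : R) m (t : R) : (m <= p)%N -> sigma = (2 * tau)%R ->
  (N%:R * (lam * t ^+ 2) <= tau ^+ 2)%R -> (forall eps, B (cube_vertex m t eps)) ->
  (m%:R * t ^+ 2 / 4)%:E <= worst_risk P X B sigma est.
Proof.
move=> mp sE tN Bt.
have r0 beta j : 0 <= coord_risk beta j.
  by apply: integral_ge0 => z _; rewrite lee_fin sqr_ge0.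
have ub eps : \sum_(j < p | (j < m)%N) coord_risk (cube_vertex m t eps) j <=
    worst_risk P X B sigma est.
  apply: le_trans (sum_coord_risk_le_risk _ mp) _.
  apply: ereal_sup_ubound; exists (cube_vertex m t eps), (gaussian_noise N tau).
  by split=> //; exact: gaussian_noise_admissible.
have pair eps (j : 'I_p) : (j < m)%N -> (t ^+ 2 / 2)%:E <=
    coord_risk (cube_vertex m t eps) j + coord_risk (cube_vertex m t (flip j eps)) j.
  move=> jm; pose v : 'cV[R]_p := (\col_i (if i == j then (-1) ^+ eps j * t else 0))%R.
  pose b := (cube_vertex m t eps - v)%R.
  have vj : (v j 0 = (-1) ^+ eps j * t)%R by rewrite mxE eqxx.
  have vj2 : (v j 0 ^+ 2 = t ^+ 2)%R by rewrite vj exprMn sqrr_sign mul1r.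
  have bj : b j 0%R = 0%R by rewrite /b mxE [X in (_ + X)%R]mxE vj mxE jm subrr.
  have vs : sqnorm2 v = (t ^+ 2)%R.
    rewrite /sqnorm2 /dotv (bigD1 j)//= big1 ?addr0; first by rewrite -expr2 vj2.
    by move=> i /negbTE ij; rewrite mxE ij mul0r.
  have e1 : cube_vertex m t eps = (b + v)%R by rewrite /b subrK.
  have e2 : cube_vertex m t (flip j eps) = (b - v)%R.
    apply/colP => i; rewrite /b !mxE ffunE.
    have [->|ij] := eqVneq i j; first by rewrite jm subrr sub0r; case: (eps j); rewrite /= ?expr1 ?expr0 ?mulN1r ?mul1r ?opprK.
    by rewrite !subr0.
  by rewrite e1 e2 -vj2; apply: coord_risk_pair => //; rewrite vs.
have [/eqP W|Wfin] := boolP (worst_risk P X B sigma est == +oo); first by rewrite W leey.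
have W0 : 0 <= worst_risk P X B sigma est.
  by apply: le_trans (ub [ffun=> false]); apply: sume_ge0.
have WE : worst_risk P X B sigma est = (fine (worst_risk P X B sigma est))%:E.
  by rewrite fineK// ge0_fin_numE// ltey.
set W := fine _ in WE; rewrite WE lee_fin.
have n0 : (0 < #|{ffun 'I_p -> bool}|%:R :> R)%R.
  by rewrite ltr0n; apply/card_gt0P; exists [ffun=> false].
have cr eps (j : 'I_p) : (j < m)%N -> coord_risk (cube_vertex m t eps) j \is a fin_num.
  move=> jm; rewrite ge0_fin_numE//; apply: (@le_lt_trans _ _ W%:E); last by rewrite ltry.
  rewrite -WE; apply: le_trans (ub eps).
  by rewrite (bigD1 j)//= leeDl//; apply: sume_ge0.
pose r eps (j : 'I_p) := fine (coord_risk (cube_vertex m t eps) j).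
have ubr eps : (\sum_(j < p | (j < m)%N) r eps j <= W)%R.
  rewrite -lee_fin -sumEFin -WE; apply: le_trans (ub eps).
  by apply: lee_sum => j jm; rewrite fineK// cr.
have pairr eps (j : 'I_p) : (j < m)%N -> (t ^+ 2 / 2 <= r eps j + r (flip j eps) j)%R.
  by move=> jm; rewrite -lee_fin EFinD !fineK ?cr//; exact: pair.
have h1 : (\sum_(eps : {ffun 'I_p -> bool}) \sum_(j < p | (j < m)%N) r eps j
    <= #|{ffun 'I_p -> bool}|%:R * W)%R.
  apply: (@le_trans _ _ (\sum_(eps : {ffun 'I_p -> bool}) W)%R); first by apply: ler_sum => eps _.
  by rewrite sumr_const mulr_natl.
have h2 : (#|{ffun 'I_p -> bool}|%:R * (m%:R * (t ^+ 2 / 4)) <=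
    \sum_(eps : {ffun 'I_p -> bool}) \sum_(j < p | (j < m)%N) r eps j)%R.
  rewrite exchange_big/=.
  have hj (j : 'I_p) : (j < m)%N -> (#|{ffun 'I_p -> bool}|%:R * (t ^+ 2 / 4) <=
      \sum_(eps : {ffun 'I_p -> bool}) r eps j)%R.
    move=> jm; set S := (\sum_eps _)%R.
    have e2 : S = (\sum_eps r (flip j eps) j)%R.
      by rewrite /S (reindex_inj (inv_inj (flipK j))).
    have : (#|{ffun 'I_p -> bool}|%:R * (t ^+ 2 / 2) <= S + S)%R.
      rewrite {2}e2 /S -big_split/=.
      apply: (@le_trans _ _ (\sum_(eps : {ffun 'I_p -> bool}) t ^+ 2 / 2)%R).
        by rewrite sumr_const mulr_natl.
      by apply: ler_sum => eps _; exact: pairr.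
    by lra.
  apply: (@le_trans _ _ (\sum_(j < p | (j < m)%N) #|{ffun 'I_p -> bool}|%:R * (t ^+ 2 / 4))%R).
    rewrite sumr_const (_ : #|_| = m); first by rewrite -[leRHS]mulr_natl mulrCA.
    by rewrite -[RHS](card_ord_lt mp); apply: eq_card => j; rewrite inE.
  by apply: ler_sum => j; exact: hj.
have := le_trans h2 h1; rewrite ler_pM2l//.
by rewrite mulrA.
Qed.

End assouad.

Lemma sum_inv_sqrt_le (R : realType) (s : nat) :
  \sum_(j < s) (Num.sqrt j.+1%:R)^-1 <= 2 * Num.sqrt s%:R :> R.
Proof.
elim: s => [|s IH]; first by rewrite big_ord0 mulr_ge0// sqrtr_ge0.
rewrite big_ord_recr/=; apply: le_trans (lerD IH (lexx _)) _.
set x := Num.sqrt s%:R; set y := Num.sqrt s.+1%:R.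
have x0 : 0 <= x by exact: sqrtr_ge0.
have y0 : 0 < y :> R by rewrite sqrtr_gt0 ltr0n.
have xy : y ^+ 2 = x ^+ 2 + 1 by rewrite !sqr_sqrtr// -natr1.
have h : 1 <= (2 * y - 2 * x) * y.
  by have := sqr_ge0 (y - x); rewrite sqrrB; nra.
rewrite -(ler_pM2r y0) mulrDl mulVf ?gt_eqF//; lra.
Qed.

(** * Flat heights and the width from cubes inside the hull *)

Section packing.
Variables (R : realType) (p s : nat) (K : set 'cV[R]_p) (rho M : R).
Hypotheses (cK : cvx K) (K0 : K 0) (Ksp : sign_perm_invariant K).
Hypothesis p0 : (0 < p)%N.
Hypothesis Kbd : exists B, forall v, K v -> forall i, absv v i <= B.
Hypotheses (sp : (1 <= s <= p)%N) (rho0 : 0 < rho).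
Hypothesis HM : forall m t, (m <= p)%N -> 0 <= t <= rho ->
  (forall eps : {ffun 'I_p -> bool}, sparse_hull K s (cube_vertex m t eps)) ->
  m%:R * t ^+ 2 / 4 <= M.
Local Notation f := (flat_height K).

(** Averaging [q] blocks of height [q * h] yields a cube of half-side [h] on [q * j] coordinates. *)
Lemma block_packing j q h : (0 < j <= s)%N -> (0 < q)%N -> (q * j <= p)%N ->
  0 <= h <= rho -> q%:R * h < f j -> (q * j)%:R * h ^+ 2 / 4 <= M.
Proof.
case/andP=> j0 js q0 qjp /andP[h0 hrho] qh.
have qR : 0 < q%:R :> R by rewrite ltr0n.
have qh0 : 0 <= q%:R * h by rewrite mulr_ge0.
have Kt := flat_height_lt cK K0 Ksp p0 Kbd j0 qh0 qh.
apply: HM => //; first by rewrite h0.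
move=> eps; apply: (sparse_hull_le js).
have := sparse_hull_block cK Ksp eps Kt qh0 j0 q0 (leqnn (q * j)).
by rewrite mulrAC mulfV ?gt_eqF// mul1r.
Qed.

Lemma packing_ge0 : 0 <= M.
Proof.
have := @HM 0 0 (leq0n _); rewrite mul0r mul0r lexx (ltW rho0); apply => // eps.
apply: sub_conv_hull; have -> : cube_vertex 0 0 eps = 0 :> 'cV[R]_p.
  by apply/colP => i; rewrite !mxE.
split=> //; rewrite /norm0 (_ : #|_| = 0%N)//; apply: eq_card0 => i.
by rewrite !inE mxE eqxx.
Qed.

(** If f(j) <= rho, one block gives f(j) of order sqrt(M/j). Otherwise q + 1 blocks with q =
    floor(f(j)/(2 rho)) bring the half-side below rho; then j f(j)^2 <= 16 (q+1) M and rho (q+1) <=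
    (3/2) f(j) give the term of order M/(rho j). *)
Lemma flat_height_packing j : (0 < j <= s)%N -> 8 * M < p%:R * rho ^+ 2 ->
  f j <= 4 * Num.sqrt M / Num.sqrt j%:R + 24 * M / (rho * j%:R).
Proof.
move=> js Mp; have [j0 js'] := andP js; have [_ sp'] := andP sp.
have jp : (j <= p)%N by exact: leq_trans sp'.
have jR : 0 < j%:R :> R by rewrite ltr0n.
have M0 := packing_ge0.
have t10 : 0 <= 4 * Num.sqrt M / Num.sqrt j%:R by rewrite divr_ge0 ?mulr_ge0 ?sqrtr_ge0.
have t20 : 0 <= 24 * M / (rho * j%:R).
  by apply: divr_ge0; apply: mulr_ge0 => //; exact: ltW.
set x := f j.
have [x0|x0] := leP x 0; first by apply: le_trans x0 _; exact: addr_ge0.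
have [xr|rx] := leP x rho.
  have := @block_packing j 1 (x / 2) js (ltn0Sn 0); rewrite mul1n mul1r => /(_ jp).
  have -> : 0 <= x / 2 <= rho by apply/andP; split; lra.
  have -> : x / 2 < f j by rewrite -/x; lra.
  move=> /(_ isT isT) h; rewrite -[leLHS]addr0 lerD//.
  rewrite ler_pdivlMr ?sqrtr_gt0// -(@ler_pXn2r _ 2) ?nnegrE ?mulr_ge0 ?sqrtr_ge0 ?(ltW x0)//.
  rewrite !exprMn !sqr_sqrtr//; lra.
set y := x / (2 * rho).
have y0 : 0 <= y by rewrite divr_ge0 ?mulr_ge0// ltW.
have /andP[qlo qhi] := truncn_itv y0.
set q := Num.truncn y in qlo qhi.
have xy : x = 2 * rho * y by rewrite /y; field; rewrite gt_eqF.
(* If these blocks do not fit, as many as fit cover at least half of the coordinates with half-side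
   rho, so p rho^2 <= 8 M, against the hypothesis. *)
have [qjp|pqj] := leqP (q.+1 * j) p; last first.
  exfalso; pose r := (p %/ j)%N.
  have r0 : (0 < r)%N by rewrite divn_gt0.
  have rq : (r <= q)%N by rewrite -ltnS /r ltn_divLR.
  have rjp : (r * j <= p)%N by exact: leq_trunc_div.
  have prj : (p <= 2 * (r * j))%N.
    rewrite {1}(divn_eq p j) -/r mul2n -addnn leq_add2l.
    by apply: leq_trans (ltnW (ltn_pmod p j0)) _; rewrite leq_pmull.
  have rR : r%:R <= y by apply: le_trans qlo; rewrite ler_nat.
  have := @block_packing j r rho js r0 rjp; rewrite lexx (ltW rho0) => /(_ isT).
  have -> : r%:R * rho < f j.
    rewrite -/x xy; apply: (@le_lt_trans _ _ (y * rho)); first by rewrite ler_pM2r.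
    have : 0 < rho * y by rewrite mulr_gt0// /y divr_gt0// mulr_gt0.
    lra.
  move=> /(_ isT) h.
  have : p%:R * rho ^+ 2 <= 2 * (r * j)%:R * rho ^+ 2.
    by rewrite ler_pM2r ?exprn_gt0// -natrM ler_nat.
  lra.
have qR : 0 < q.+1%:R :> R by rewrite ltr0n.
have h0 : 0 <= x / (2 * q.+1%:R) by rewrite divr_ge0 ?mulr_ge0// ltW.
have hr : x / (2 * q.+1%:R) <= rho.
  rewrite ler_pdivrMr ?mulr_gt0// xy.
  by have := ler_wpM2l (ltW rho0) (ltW qhi); lra.
have := @block_packing j q.+1 (x / (2 * q.+1%:R)) js (ltn0Sn _) qjp.
rewrite h0 hr => /(_ isT).
have -> : q.+1%:R * (x / (2 * q.+1%:R)) < f j.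
  have -> : q.+1%:R * (x / (2 * q.+1%:R)) = x / 2 by field; rewrite gt_eqF.
  by rewrite -/x; lra.
move=> /(_ isT) h.
have e : (q.+1 * j)%:R * (x / (2 * q.+1%:R)) ^+ 2 / 4 = j%:R * x ^+ 2 / (16 * q.+1%:R).
  by rewrite natrM; field; rewrite gt_eqF.
rewrite e ler_pdivrMr ?mulr_gt0// in h.
have q3 : rho * q.+1%:R <= 3 / 2 * x.
  rewrite -natr1; have := ler_wpM2l (ltW rho0) qlo.
  have -> : rho * y = x / 2 by rewrite xy; field.
  lra.
rewrite -[leLHS]add0r lerD// ler_pdivlMr ?mulr_gt0//.
have h4 : rho * (j%:R * x ^+ 2) <= M * 16 * (3 / 2 * x).
  have := ler_wpM2l (ltW rho0) h; move=> /le_trans; apply.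
  have -> : rho * (M * (16 * q.+1%:R)) = M * 16 * (rho * q.+1%:R) by ring.
  by rewrite ler_wpM2l// mulr_ge0.
rewrite -(ler_pM2r x0); lra.
Qed.

(** Each [slp j] is bounded by [slp 1]. The two terms of [flat_height_packing] sum to 2 sqrt s and
    to a harmonic sum, at most [lgp 1]; the logarithms in front of M amount to lgp(1)^(3/2) <=
    lgp(1)^2. *)
Lemma width_le_packing : 8 * M < p%:R * rho ^+ 2 ->
  rho * gaussian_width (sparse_hull K s) <=
  64 * slp R p 1 * Num.sqrt M * (Num.sqrt s%:R * rho) + 192 * lgp R p 1 ^+ 2 * M.
Proof.
move=> Mp; have [s0 sp'] := andP sp.
have M0 := packing_ge0.
have s1 := slp_ge0 R p 1.
have p1 : (0 < 1 <= p)%N by rewrite p0.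
have L1 := lgp_ge1 R p0 p1.
have hj (j : 'I_s) : f j.+1 * slp R p j.+1 <=
   slp R p 1 * (4 * Num.sqrt M) * (Num.sqrt j.+1%:R)^-1 + slp R p 1 * (24 * M / rho) * (j.+1%:R)^-1.
  have js : (0 < j.+1 <= s)%N by rewrite /= ltn_ord.
  have fj := flat_height_packing js Mp.
  have f0 := flat_height_ge0 K0 p0 Kbd (ltn0Sn j).
  apply: (@le_trans _ _ (f j.+1 * slp R p 1)).
    by rewrite ler_wpM2l// slp_anti.
  apply: le_trans (ler_wpM2r s1 fj) _; rewrite le_eqVlt; apply/orP; left; apply/eqP.
  by field; rewrite !gt_eqF// ?sqrtr_gt0 ltr0n.
have hw := gaussian_width_le cK K0 Ksp p0 Kbd s.
have hs : \sum_(j < s) f j.+1 * slp R p j.+1 <= \sum_(j < s)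
   (slp R p 1 * (4 * Num.sqrt M) * (Num.sqrt j.+1%:R)^-1 + slp R p 1 * (24 * M / rho) * (j.+1%:R)^-1).
  by apply: ler_sum => j _; exact: hj.
rewrite big_split/= -!mulr_sumr in hs.
have a1 := sum_inv_sqrt_le R s; have a2 := sum_inv_nat_le_ln R s0.
have a3 : 1 + ln s%:R <= lgp R p 1 :> R.
  by rewrite lgpE// ln1 subr0 lerD2l ler_ln ?posrE ?ltr0n// ler_nat.
have c1 : 0 <= slp R p 1 * (4 * Num.sqrt M) by rewrite mulr_ge0// mulr_ge0// sqrtr_ge0.
have c2 : 0 <= slp R p 1 * (24 * M / rho) by rewrite mulr_ge0// divr_ge0 ?(ltW rho0)// mulr_ge0.
have h1 := ler_wpM2l c1 a1; have h2 := ler_wpM2l c2 (le_trans a2 a3).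
have h3 : gaussian_width (sparse_hull K s) <= 8 * (slp R p 1 * (4 * Num.sqrt M) * (2 * Num.sqrt s%:R) +
   slp R p 1 * (24 * M / rho) * lgp R p 1).
  by apply: le_trans hw _; rewrite ler_pM2l//; apply: le_trans hs _; exact: lerD.
apply: le_trans (ler_wpM2l (ltW rho0) h3) _.
have e : rho * (8 * (slp R p 1 * (4 * Num.sqrt M) * (2 * Num.sqrt s%:R) +
   slp R p 1 * (24 * M / rho) * lgp R p 1)) =
   64 * slp R p 1 * Num.sqrt M * (Num.sqrt s%:R * rho) + 192 * (slp R p 1 * lgp R p 1) * M.
  by field; rewrite gt_eqF.
rewrite e lerD2l ler_wpM2r// ler_pM2l// expr2 ler_wpM2r//; first lra.
have := sqr_slp R p0 p1; have := slp_ge1 R p0 p1.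
nra.
Qed.

End packing.

(** * The width against the minimax risk *)

Section width_lower_bound.
Variables (R : realType) (N p s : nat) (K : set 'cV[R]_p) (sigma a b lam rho M : R).
Hypotheses (cbK : convex_body K) (Ks : centrally_symmetric K) (Ksp : sign_perm_invariant K).
Hypotheses (p0 : (0 < p)%N) (sp : (1 <= s <= p)%N) (sigma0 : 0 < sigma).
Hypotheses (a0 : 0 < a) (b0 : 0 < b) (Nbp : N%:R <= b * p%:R) (lam0 : 0 < lam).
Local Notation w := (gaussian_width (sparse_hull K s)).
Hypothesis Na : a * Num.max (Num.max
        ((sigma * s%:R * ln (expR 1 * p%:R / s%:R) / w) ^+ 2)
        (w ^+ 2 * ell (7 : R) s / sigma ^+ 2)) (ell (7 : R) s) <= N%:R.
Hypothesis rhoE : rho = sigma / (2 * Num.sqrt lam * Num.sqrt N%:R).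
Hypothesis HM : forall m t, (m <= p)%N -> 0 <= t <= rho ->
  (forall eps : {ffun 'I_p -> bool}, sparse_hull K s (cube_vertex m t eps)) ->
  m%:R * t ^+ 2 / 4 <= M.

Definition packing_const : R :=
  64 ^+ 2 / (2 * Num.sqrt lam * Num.sqrt a) + 384 + 16 * Num.sqrt lam * b / Num.sqrt a.

Lemma packing_const_gt0 : 0 < packing_const.
Proof.
have h1 : 0 <= 64 ^+ 2 / (2 * Num.sqrt lam * Num.sqrt a).
  by apply: divr_ge0; [exact: sqr_ge0|rewrite mulr_ge0 ?mulr_ge0 ?sqrtr_ge0].
have h2 : 0 <= 16 * Num.sqrt lam * b / Num.sqrt a.
  by rewrite divr_ge0 ?sqrtr_ge0// mulr_ge0 ?(ltW b0)// mulr_ge0 ?sqrtr_ge0.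
rewrite /packing_const; lra.
Qed.

(** In the cross term of [width_le_packing], s rho^2 <= k rho w by [sample_size_noise], so the
    inequality of means absorbs half of rho w on the left. If instead 8 M >= p rho^2, then rho w is
    at most a constant times p rho^2 by [sample_size_width] and [N <= b p]. *)
Lemma width_le_lower_bound : rho * w <= packing_const * lgp R p 1 ^+ 2 * M.
Proof.
have w0 := gaussian_width_gt0 cbK Ks Ksp p0 sp.
have N0 := sample_size_gt0 a0 Na; have NR : 0 < N%:R :> R by rewrite ltr0n.
have hW := sample_size_width cbK Ks Ksp p0 sp sigma0 a0 Na.
have hS := sample_size_noise cbK Ks Ksp p0 sp sigma0 a0 Na.
set A := Num.sqrt a in hW hS *; set S := Num.sqrt (N%:R : R) in hW hS *.
have l7 := ell_ge R s.
have q1 : 1 <= Num.sqrt (ell (7 : R) s) by rewrite -[leLHS]sqrtr1 ler_wsqrtr//; lra.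
set Q := Num.sqrt lam.
have A0 : 0 < A by rewrite sqrtr_gt0.
have S0 : 0 < S by rewrite sqrtr_gt0.
have Q0 : 0 < Q by rewrite sqrtr_gt0.
have S2 : S ^+ 2 = N%:R by rewrite sqr_sqrtr.
have rho0 : 0 < rho by rewrite rhoE -/Q -/S divr_gt0// !mulr_gt0.
have sigE : sigma = rho * (2 * Q * S) by rewrite rhoE -/Q -/S mulfVK// gt_eqF// !mulr_gt0.
have cK := convex_body_cvx cbK; have Kbd := convex_body_bounded cbK.
have K0 := convex_body0 cbK Ks.
have M0 : 0 <= M := packing_ge0 K0 rho0 HM.
have p1 : (0 < 1 <= p)%N by rewrite p0.
have L1 := lgp_ge1 R p0 p1.
have L2 : 1 <= lgp R p 1 ^+ 2 by rewrite -[leLHS](expr1n _ 2) lerXn2r ?nnegrE//; lra.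
have LM : M <= lgp R p 1 ^+ 2 * M by rewrite ler_peMl.
set k := (2 * Q * A)^-1.
have k0 : 0 < k by rewrite invr_gt0 !mulr_gt0.
have e : packing_const = 64 ^+ 2 * k + 384 + 16 * Q * b / A by [].
have c3 : 0 <= 16 * Q * b / A by rewrite divr_ge0 ?(ltW A0)// mulr_ge0 ?(ltW b0)// mulr_ge0 ?(ltW Q0).
rewrite e -mulrA; set LL := lgp R p 1 ^+ 2 * M in LM *.
have LL0 : 0 <= LL by exact: le_trans LM.
have kLL : 0 <= k * LL by rewrite mulr_ge0// ltW.
have cLL : 0 <= 16 * Q * b / A * LL by exact: mulr_ge0.
have [big|small] := ltP (8 * M) (p%:R * rho ^+ 2); last first.
  have h1 : A * w <= sigma * S.
    by apply: le_trans hW; rewrite ler_pM2l// ler_peMr// ltW.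
  have h2 : A * (rho * w) <= 2 * Q * b * (p%:R * rho ^+ 2).
    apply: (@le_trans _ _ (rho * (sigma * S))); first by rewrite mulrCA ler_pM2l.
    have -> : rho * (sigma * S) = 2 * Q * rho ^+ 2 * N%:R by rewrite sigE -S2; ring.
    have -> : 2 * Q * b * (p%:R * rho ^+ 2) = 2 * Q * rho ^+ 2 * (b * p%:R) by ring.
    by rewrite ler_wpM2l// mulr_ge0 ?sqr_ge0// mulr_ge0// ltW.
  have h3 : A * (rho * w) <= 16 * Q * b * M.
    apply: le_trans h2 _; have -> : 16 * Q * b * M = 2 * Q * b * (8 * M) by ring.
    by rewrite ler_wpM2l// mulr_ge0 ?(ltW b0)// mulr_ge0// ltW.
  rewrite mulrC -ler_pdivlMr// in h3.
  have h4 : 16 * Q * b * M / A <= 16 * Q * b / A * LL.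
    by rewrite mulrAC ler_wpM2l.
  apply: le_trans (le_trans h3 h4) _; apply: ler_wpM2r => //.
  have h5 : 0 <= 64 ^+ 2 * k by apply: mulr_ge0; [exact: sqr_ge0|exact: ltW].
  move: (16 * Q * b / A) (64 ^+ 2 * k) h5 => u v h5; lra.
have h1 := width_le_packing cK K0 Ksp p0 Kbd sp rho0 HM big.
have h2 : s%:R * rho ^+ 2 <= k * (rho * w).
  rewrite /k ler_pdivlMl ?mulr_gt0//.
  have -> : 2 * Q * A * (s%:R * rho ^+ 2) = rho / S * (A * (rho * (2 * Q * S) * s%:R)).
    by field; rewrite gt_eqF.
  rewrite -sigE; apply: (@le_trans _ _ (rho / S * (w * S))).
    by rewrite ler_wpM2l// divr_ge0// ltW.
  by rewrite le_eqVlt; apply/orP; left; apply/eqP; field; rewrite gt_eqF.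
set x := 64 * slp R p 1 * Num.sqrt M in h1; set y := Num.sqrt s%:R * rho in h1.
have y2 : y ^+ 2 = s%:R * rho ^+ 2 by rewrite /y exprMn sqr_sqrtr.
have x2 : x ^+ 2 = 64 ^+ 2 * (lgp R p 1 * M).
  by rewrite /x [in LHS]exprMn [in LHS]exprMn (sqr_slp R p0 p1) sqr_sqrtr// mulrA.
have h3 : x * y <= k * x ^+ 2 / 2 + y ^+ 2 / k / 2.
  have := sqr_ge0 (k * x - y); rewrite sqrrB exprMn => h.
  have : 0 <= (k ^+ 2 * x ^+ 2 - k * x * y *+ 2 + y ^+ 2) / k by rewrite divr_ge0// ltW.
  have -> : (k ^+ 2 * x ^+ 2 - k * x * y *+ 2 + y ^+ 2) / k = k * x ^+ 2 - 2 * (x * y) + y ^+ 2 / k.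
    by field; rewrite gt_eqF.
  lra.
have h4 : y ^+ 2 / k <= rho * w by rewrite y2 ler_pdivrMr// [leRHS]mulrC.
have h5 : lgp R p 1 * M <= LL.
  by rewrite /LL ler_wpM2r// expr2 ler_peMl// (le_trans _ L1).
have h6 : k * x ^+ 2 <= 64 ^+ 2 * (k * LL).
  have s64 : 0 <= 64 ^+ 2 :> R by exact: sqr_ge0.
  by rewrite x2 mulrCA ler_wpM2l// ler_wpM2l// ltW.
have h7 (c : R) : c * lgp R p 1 ^+ 2 * M = c * LL by rewrite -mulrA.
have dist (t u v : R) : (t * k + u + v) * LL = t * (k * LL) + u * LL + v * LL.
  by ring.
rewrite h7 in h1; rewrite dist.
move: h6; set t := 64 ^+ 2 * (k * LL) => h6.
move: (rho * w) h1 h4 => Y h1 h4; move: (x * y) h1 h3 => xy h1 h3.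
move: (k * x ^+ 2) (y ^+ 2 / k) h3 h4 h6 => u v h3 h4 h6.
move: (16 * Q * b / A * LL) cLL => r r0; lra.
Qed.

End width_lower_bound.

Lemma quadratic_form_subr (R : realType) (p : nat) (S : 'M[R]_p) (c : R) (v : 'cV[R]_p) :
  (v^T *m (S - c%:M) *m v) 0 0 = (v^T *m S *m v) 0 0 - c * sqnorm2 v.
Proof.
rewrite mulmxBr mulmxBl mxE; congr (_ + _); rewrite mxE; congr (- _).
rewrite mul_mx_scalar -scalemxAl mxE; congr (_ * _).
by rewrite mxE /sqnorm2 /dotv; apply: eq_bigr => i _; rewrite mxE.
Qed.

Section design_facts.
Context d (T : measurableType d) (R : realType) (P : probability T R).
Variables (N p : nat) (X : {RV P >-> 'M[R]_(N, p)}) (L lo hi : R) (Sigma : 'M[R]_p).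
Hypothesis design : sub_gaussian_design P X L Sigma.
Hypotheses (Slo : loewner_le lo%:M Sigma) (Shi : loewner_le Sigma hi%:M).
Local Open Scope ereal_scope.

Let mXr i : measurable_fun setT (fun w => (row i (X w))^T).
Proof. by apply: measurable_trmx; apply: measurable_row; exact: measurable_funPT. Qed.

Lemma design_independent : mutually_independent P (fun i w => (row i (X w))^T).
Proof. by case: design. Qed.

Lemma design_sub_gaussian i (delta : R) v : sqnorm2 v = 1%R ->
  \int[P]_w (expR (delta * dotv v (row i (X w))^T))%:E <=
  (expR (delta ^+ 2 * (`|L| + 1) ^+ 2 / 2))%:E.
Proof.
move=> v1; have [_ /(_ i)[_ sg _]] := design.
have := sg delta v v1; rewrite expectation.unlock => /le_trans; apply.
rewrite lee_fin ler_expR ler_pM2r ?invr_gt0// ler_wpM2l ?sqr_ge0//.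
rewrite -[(L ^+ 2)%R]real_normK ?num_real// lerXn2r ?nnegrE ?addr_ge0//.
by rewrite lerDl.
Qed.

Let sqr_dotvE i v : \int[P]_w (dotv v (row i (X w))^T ^+ 2)%:E =
  ((v^T *m Sigma *m v) 0%R 0%R)%:E.
Proof.
have [_ /(_ i)[mz _ cov]] := design.
exact: (integral_sqr_dotv (mXr i) mz cov).
Qed.

Lemma design_lower i u : sqnorm2 u = 1%R ->
  lo%:E <= \int[P]_w (dotv u (row i (X w))^T ^+ 2)%:E.
Proof.
move=> u1; rewrite sqr_dotvE lee_fin.
by have := Slo u; rewrite quadratic_form_subr u1 mulr1 subr_ge0.
Qed.

Lemma design_upper i v :
  \int[P]_w (dotv v (row i (X w))^T ^+ 2)%:E <= (hi * sqnorm2 v)%:E.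
Proof.
rewrite sqr_dotvE lee_fin.
have := Shi v; rewrite -opprB mulmxN mulNmx mxE quadratic_form_subr opprB subr_ge0.
by [].
Qed.

End design_facts.

Section risk_constant.
Variables (R : realType) (L lo a b lambda : R).
Hypotheses (a0 : 0 < a) (b0 : 0 < b) (lambda0 : 0 < lambda).
Local Notation G := (4 / gap_const R).
Local Notation CI := (iso_const (48 * L ^+ 2) (lo / 4) (sparse_radius L lo) b).

Definition risk_const : R :=
  (CI ^+ 2 * (3 * lambda + 24 * G ^+ 2) + CI ^+ 2 * (4 + 8 * G ^+ 2 / lambda) * lambda)
    * (1 + 2 / Num.sqrt a)
  + CI ^+ 2 * (4 + 8 * G ^+ 2 / lambda) * 24 / Num.sqrt a
  + 12 * G ^+ 2 * b / Num.sqrt a.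

Let G0 : 0 < G. Proof. by rewrite divr_gt0// gap_const_gt0. Qed.
Let A0 : 0 < Num.sqrt a. Proof. by rewrite sqrtr_gt0. Qed.
Let c1 : 0 <= CI ^+ 2 * (3 * lambda + 24 * G ^+ 2).
Proof.
apply: mulr_ge0; first exact: sqr_ge0.
by apply: addr_ge0; apply: mulr_ge0; rewrite ?sqr_ge0// ltW.
Qed.
Let c2 : 0 <= CI ^+ 2 * (4 + 8 * G ^+ 2 / lambda).
Proof.
apply: mulr_ge0; first exact: sqr_ge0.
apply: addr_ge0 => //; apply: divr_ge0; last exact: ltW.
by apply: mulr_ge0; rewrite ?sqr_ge0.
Qed.

Lemma risk_const_gt0 : 0 < risk_const.
Proof.
rewrite /risk_const; apply: ltr_wpDl.
  apply: addr_ge0.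
    apply: mulr_ge0; first by apply: addr_ge0 => //; apply: mulr_ge0 => //; exact: ltW.
    by apply: addr_ge0 => //; apply: divr_ge0 => //; exact: ltW.
  by apply: divr_ge0; [exact: mulr_ge0|exact: ltW].
by apply: divr_gt0 => //; apply: mulr_gt0 => //; apply: mulr_gt0 => //; exact: exprn_gt0.
Qed.

Variables (N p s : nat) (K : set 'cV[R]_p) (sigma : R).
Hypotheses (cbK : convex_body K) (Ks : centrally_symmetric K) (Ksp : sign_perm_invariant K).
Hypotheses (p0 : (0 < p)%N) (sp : (1 <= s <= p)%N) (sigma0 : 0 < sigma).
Hypotheses (Nbp : N%:R <= b * p%:R).
Local Notation w := (gaussian_width (sparse_hull K s)).
Local Notation l := (ell (7 : R) s).
Hypothesis Na : a * Num.max (Num.max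
        ((sigma * s%:R * ln (expR 1 * p%:R / s%:R) / w) ^+ 2)
        (w ^+ 2 * l / sigma ^+ 2)) l <= N%:R.

Lemma risk_bound_le_rate :
  CI ^+ 2 * (3 * lambda + 24 * G ^+ 2) * pen N 7 sigma K s
  + CI ^+ 2 * (4 + 8 * G ^+ 2 / lambda) * (lambda * pen N 7 sigma K s)
  + CI ^+ 2 * (4 + 8 * G ^+ 2 / lambda) * (24 * sigma ^+ 2 / N%:R)
  + p%:R * (4 * (G * w) ^+ 2) * (3 * expR (- (2 * lgp R p 1)))
  <= risk_const * rate N s K sigma.
Proof.
have h1 := pen_le_rate cbK Ks Ksp p0 sp sigma0 a0 Na.
have h2 := noise_le_rate cbK Ks Ksp p0 sp sigma0 a0 Na.
have h3 := bad_event_le_rate cbK Ks Ksp p0 sp sigma0 a0 b0 Nbp Na G.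
rewrite /risk_const.
move: (CI ^+ 2 * (3 * lambda + 24 * G ^+ 2)) c1 => u u0.
move: (CI ^+ 2 * (4 + 8 * G ^+ 2 / lambda)) c2 => v v0.
have dist (x y t r : R) : (x + y + t) * r = x * r + y * r + t * r by ring.
rewrite dist; apply: lerD => //; apply: lerD.
  rewrite [v * (lambda * _)]mulrA -mulrDl -[leRHS]mulrA; apply: ler_wpM2l => //.
  by apply: addr_ge0 => //; apply: mulr_ge0 => //; exact: ltW.
have -> : v * (24 * sigma ^+ 2 / N%:R) = v * 24 * (sigma ^+ 2 / N%:R) by ring.
have -> : v * 24 / Num.sqrt a * rate N s K sigma = v * 24 * ((Num.sqrt a)^-1 * rate N s K sigma) by ring.
by apply: ler_wpM2l => //; apply: mulr_ge0.
Qed.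

End risk_constant.

(** * Conclusion *)

Theorem theorem3p3 (R : realType) :
  exists c c0 : R, [/\ 6 < c, 0 < c0 &
  forall L lambda_lo lambda_hi : R, 0 < lambda_lo -> lambda_lo <= lambda_hi ->
  exists lambda0 : R,
  forall lambda a b : R, lambda0 <= lambda -> 0 < a -> 0 < b ->
  exists C : R, 0 < C /\
  forall (N p s : nat) (K : set 'cV[R]_p) (sigma : R)
    (d : measure_display) (T : measurableType d) (P : probability T R)
    (X : {RV P >-> 'M[R]_(N, p)}) (Sigma : 'M[R]_p)
    (shat : data R N p -> nat) (bhat : data R N p -> 'cV[R]_p),
  let w := gaussian_width (sparse_hull K s) in
  let l := ell c s in
  convex_body K -> centrally_symmetric K -> sign_perm_invariant K ->
  0 < sigma ->
  sub_gaussian_design P X L Sigma ->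
  loewner_le lambda_lo%:M Sigma -> loewner_le Sigma lambda_hi%:M ->
  measurable_fun setT bhat ->
  penalized_argmin c sigma K lambda shat bhat ->
  (1 <= s)%N -> s%:R <= c0 * p%:R ->
  a * Num.max (Num.max
        ((sigma * s%:R * ln (expR 1 * p%:R / s%:R) / w) ^+ 2)
        (w ^+ 2 * l / sigma ^+ 2)) l <= N%:R ->
  N%:R <= b * p%:R ->
  (worst_risk P X (sparse_hull K s) sigma bhat
   <= (C * ln (expR 1 * p%:R) ^+ 2 * Num.sqrt l)%:E
      * minimax_risk P X (sparse_hull K s) sigma)%E].
Proof.
(* With c0 = 1 the sparsity condition reads s <= p; c = 7 makes every [ell s] at least 7. *)
exists 7, 1; split; [lra|lra|] => L lo hi lo0 lohi.
have hi0 : 0 < hi by exact: lt_le_trans lohi.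
pose L' := `|L| + 1; have L0 : 0 < L' by rewrite ltr_wpDl.
pose lambda0 : R := 2 * (16 * (4 / gap_const R) * L' * Num.sqrt 12).
exists lambda0 => lambda a b lam0 a0 b0.
pose CU := risk_const L' lo a b lambda; pose CL := packing_const a b hi.
have l0 : 0 < lambda.
  by apply: lt_le_trans lam0; rewrite /lambda0 !mulr_gt0 ?invr_gt0 ?gap_const_gt0.
have CU0 : 0 < CU by exact: risk_const_gt0.
have CL0 : 0 < CL by exact: packing_const_gt0.
have Q0 : 0 < Num.sqrt hi by rewrite sqrtr_gt0.
exists (CU * (2 * Num.sqrt hi) * CL); split; first by rewrite !mulr_gt0.
move=> N p s K sigma d T P X Sigma shat bhat w l cbK Ks Ksp s0 design Slo Shi mb opt.
move=> s1; rewrite mul1r ler_nat => sp Na Nbp.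
have p0 : (0 < p)%N by exact: leq_trans sp.
have ssp : (1 <= s <= p)%N by rewrite s1.
have N0 := sample_size_gt0 a0 Na; have NR : 0 < N%:R :> R by rewrite ltr0n.
have S0 : 0 < Num.sqrt (N%:R : R) by rewrite sqrtr_gt0.
have S2 : Num.sqrt (N%:R : R) ^+ 2 = N%:R by rewrite sqr_sqrtr.
set q := Num.sqrt l; have q0 : 0 <= q by exact: sqrtr_ge0.
have up : (worst_risk P X (sparse_hull K s) sigma bhat <= (CU * rate N s K sigma)%:E)%E.
  apply: ge_ereal_sup => _ [beta [Q [betas admQ ->]]].
  apply: le_trans (estimator_risk_le p0 N0 L0 lo0 (design_independent design)
    (design_sub_gaussian design) (design_lower design Slo) cbK Ks Ksp s0 b0 Nbp lam0 opt ssp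
    betas admQ) _.
  rewrite lee_fin.
  apply: risk_bound_le_rate => //; exact: Na.
apply: le_trans up _.
(* The largest half-side allowed by [assouad]: N hi rho^2 = (sigma/2)^2, and Gaussian noise of
   standard deviation sigma/2 has psi_2 norm at most sigma. *)
pose rho := sigma / (2 * Num.sqrt hi * Num.sqrt N%:R).
have rateE : rate N s K sigma = 2 * Num.sqrt hi * (rho * w) * q.
  by rewrite /rate /rho -/w -/l -/q; field; rewrite !gt_eqF.
have rate0 : 0 <= rate N s K sigma by exact/ltW/(rate_gt0 cbK Ks Ksp p0 ssp s0 a0 Na).
have L2 : 0 < ln (expR 1 * p%:R) ^+ 2 :> R.
  have p1 : (0 < 1 <= p)%N by rewrite p0.
  by rewrite -lgp1 exprn_gt0// (lt_le_trans ltr01 (lgp_ge1 R p0 p1)).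
set D := ln (expR 1 * p%:R) ^+ 2 in L2 *.
have q1 : 0 < q by rewrite sqrtr_gt0; apply: lt_le_trans (ell_ge R s).
have Q2 : 0 < 2 * Num.sqrt hi by exact: mulr_gt0.
have cst0 : 0 < CU * (2 * Num.sqrt hi) * CL * D * q by do 4![apply: mulr_gt0 => //].
(* The worst risk of each estimator is compared with the real number [r0] before the infimum is
   taken, which keeps the algebra out of the extended reals. *)
pose r0 := CU * rate N s K sigma / (CU * (2 * Num.sqrt hi) * CL * D * q).
have -> : CU * rate N s K sigma = CU * (2 * Num.sqrt hi) * CL * D * q * r0.
  by rewrite /r0 [RHS]mulrC divfK// gt_eqF.
rewrite EFinM lee_wpmul2l ?lee_fin ?(ltW cst0)//.
apply: le_ereal_inf_tmp => _ [est mest <-].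
have [->|Wfin] := eqVneq (worst_risk P X (sparse_hull K s) sigma est) +oo%E; first exact: leey.
have HM m t : (m <= p)%N -> 0 <= t <= rho ->
    (forall eps : {ffun 'I_p -> bool}, sparse_hull K s (cube_vertex m t eps)) ->
    ((m%:R * t ^+ 2 / 4)%:E <= worst_risk P X (sparse_hull K s) sigma est)%E.
  move=> mp /andP[t0 tr] Kt.
  have tau0 : 0 < sigma / 2 by rewrite divr_gt0.
  apply: (assouad tau0 (design_upper design Shi) mest mp _ _ Kt); first by field.
  have t2 : t ^+ 2 <= rho ^+ 2 by rewrite lerXn2r ?nnegrE// (le_trans t0).
  apply: (@le_trans _ _ (N%:R * (hi * rho ^+ 2))); first by rewrite !ler_pM2l.
  have hi2 : Num.sqrt hi ^+ 2 = hi by rewrite sqr_sqrtr// ltW.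
  rewrite -{1}hi2 -S2 /rho le_eqVlt; apply/orP; left; apply/eqP.
  by field; rewrite !gt_eqF.
have W0 : (0 <= worst_risk P X (sparse_hull K s) sigma est)%E.
  have rho0 : 0 <= rho by rewrite divr_ge0 ?(ltW s0)// !mulr_ge0 ?sqrtr_ge0.
  have := HM 0 0 (leq0n _); rewrite lexx mul0r mul0r => /(_ rho0); apply => eps.
  apply: sub_conv_hull; have -> : cube_vertex 0 0 eps = 0 :> 'cV[R]_p.
    by apply/colP => i; rewrite !mxE.
  split; first exact: convex_body0.
  rewrite /norm0 (_ : #|_| = 0%N)//; apply: eq_card0 => i.
  by rewrite !inE mxE eqxx.
have WE : worst_risk P X (sparse_hull K s) sigma est =
    (fine (worst_risk P X (sparse_hull K s) sigma est))%:E.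
  by rewrite fineK// ge0_fin_numE// ltey.
rewrite WE in HM *; rewrite lee_fin.
have := width_le_lower_bound cbK Ks Ksp p0 ssp s0 a0 b0 Nbp hi0 Na (erefl rho)
  (fun m t mp tr Kt => HM m t mp tr Kt).
rewrite -/CL lgp1 -/D -/w => hw.
rewrite /r0 ler_pdivrMr// rateE.
move: (fine _) hw => M hw.
have -> : CU * (2 * Num.sqrt hi * (rho * w) * q) = CU * (2 * Num.sqrt hi) * q * (rho * w) by ring.
have -> : M * (CU * (2 * Num.sqrt hi) * CL * D * q) = CU * (2 * Num.sqrt hi) * q * (CL * D * M) by ring.
by rewrite ler_pM2l//; do 2![apply: mulr_gt0 => //].
Qed.
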